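(* Let $v\in\mathbb{R}$, $(\rho_L,\alpha_L)\in\mathbb{R}_+^*\times\mathbb{R}$ and $(\rho_R,\alpha_R)\in\mathbb{R}_+^*\times\mathbb{R}$ be such that $$-c\le u_L-v\le c\quad\text{and}\quad -c\le u_R-v\le c,$$ where $u_L=v+\alpha_L/\rho_L$ and $u_R=v+\alpha_R/\rho_R$. Then there is exactly one pair $((\rho_-,\alpha_-),(\rho_+,\alpha_+))\in V_-(\rho_L,\alpha_L,v)\times V_+(\rho_R,\alpha_R,v)$ such that $((\rho_-,\alpha_-+v\rho_-),(\rho_+,\alpha_++v\rho_+))\in\mathcal{G}_D(v)$. Moreover, both $(\rho_-,\alpha_-)$ and $(\rho_+,\alpha_+)$ belong to the subsonic triangle $\{(\rho,\alpha):\ -c\rho\le\alpha\le c\rho\}$.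
   Context: $c>0$ is a fixed constant. The drag force $D:\mathbb{R}_+^*\times\mathbb{R}\to\mathbb{R}$, $(\rho,\alpha)\mapsto D(\rho,\alpha)$, is $\mathcal{C}^1$, has the same sign as $\alpha$ ($D>0$ for $\alpha>0$, $D<0$ for $\alpha<0$, $D(\rho,0)=0$), is an increasing function of $\alpha$, and $|D|$ is a decreasing (in the non-strict sense) function of $\rho$. Euler Riemann solution. For $(\rho_a,q_a),(\rho_b,q_b)\in\mathbb{R}_+^*\times\mathbb{R}$, $W(x/t;(\rho_a,q_a),(\rho_b,q_b))$ denotes the unique self-similar entropy solution of the isothermal Euler equations $\partial_t\rho+\partial_x q=0$, $\partial_t q+\partial_x(q^2/\rho+c^2\rho)=0$ with initial data $(\rho_a,q_a)$ for $x<0$ and $(\rho_b,q_b)$ for $x>0$; $W(v_-;\cdot)$ and $W(v_+;\cdot)$ are its left and right limits at $x/t=v$. Accessible sets. $U_-(\rho_L,q_L,v)=\{W(v_-;(\rho_L,q_L),(\underline\rho,\underline q)):(\underline\rho,\underline q)\in\mathbb{R}_+^*\times\mathbb{R}\}$, $U_+(\rho_R,q_R,v)=\{W(v_+;(\bar\rho,\bar q),(\rho_R,q_R)):(\bar\rho,\bar q)\in\mathbb{R}_+^*\times\mathbb{R}\}$, and $V_-(\rho_L,\alpha_L,v)=\{(\rho,q-v\rho):(\rho,q)\in U_-(\rho_L,\alpha_L+v\rho_L,v)\}$, $V_+(\rho_R,\alpha_R,v)=\{(\rho,q-v\rho):(\rho,q)\in U_+(\rho_R,\alpha_R+v\rho_R,v)\}$.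 For $\alpha\neq 0$ let $F_\alpha(\rho)=\int_{|\alpha|/c}^{\rho}\frac{1}{|D(r,\alpha)|}\left(c^2-\frac{\alpha^2}{r^2}\right)dr$. Germ. $\mathcal{G}_D(v)$ is the set of pairs $((\rho_-,q_-),(\rho_+,q_+))\in(\mathbb{R}_+^*\times\mathbb{R})^2$ such that $q_--v\rho_-=q_+-v\rho_+=:\alpha$ and one of the following holds: - $\alpha=0$, $\rho_-=\rho_+$ and $q_-=q_+$; - $\alpha>0$, $(\frac{\alpha}{c}-\rho_+)(\frac{\alpha}{c}-\rho_-)\ge0$ and $F_\alpha(\rho_-)-F_\alpha(\rho_+)=1$; - $\alpha<0$, $(\frac{|\alpha|}{c}-\rho_+)(\frac{|\alpha|}{c}-\rho_-)\ge0$ and $F_\alpha(\rho_+)-F_\alpha(\rho_-)=1$; - $c\rho_-<\alpha$, $\rho_+\ge\frac{\alpha}{c}$ and there exist $\rho\in[\rho_-,\frac{\alpha}{c})$ and $\theta\in[0,1]$ with $F_\alpha(\rho_-)-F_\alpha(\rho)=\theta$ and $F_\alpha\left(\frac{\alpha^2}{c^2\rho}\right)-F_\alpha(\rho_+)=1-\theta$; - $\alpha<-c\rho_+$, $\rho_-\ge\frac{|\alpha|}{c}$ and there exist $\rho\in[\rho_+,\frac{|\alpha|}{c})$ and $\theta\in[0,1]$ with $F_\alpha(\rho_+)-F_\alpha(\rho)=\theta$ and $F_\alpha\left(\frac{\alpha^2}{c^2\rho}\right)-F_\alpha(\rho_-)=1-\theta$. *)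

(* Defs.v *)
From Stdlib Require Export Reals.
From Coquelicot Require Export Coquelicot.
Open Scope R_scope.

(* A fluid state is a pair (density, momentum). *)
Definition state : Type := (R * R)%type.

Definition Omega (U : state) : Prop := 0 < fst U.

Definition D1 (f : R -> R -> R) (x y : R) : R := Derive (fun s => f s y) x.
Definition D2 (f : R -> R -> R) (x y : R) : R := Derive (fun s => f x s) y.

(* Meant for an open set P: the derivatives are two-sided, and the partial
   derivatives are continuous as functions of both variables. *)
Definition C1_on (P : R * R -> Prop) (f : R -> R -> R) : Prop :=
  forall x y : R, P (x, y) ->
    ex_derive (fun s => f s y) x /\
    ex_derive (fun s => f x s) y /\
    continuous (fun z : R * R => D1 f (fst z) (snd z)) (x, y) /\
    continuous (fun z : R * R => D2 f (fst z) (snd z)) (x, y).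

(* [D rho alpha] is only constrained for [0 < rho]. "Increasing" in alpha is
   strict, "decreasing" in rho is not. *)
Record drag_force (D : R -> R -> R) : Prop := {
  drag_C1 : C1_on Omega D;
  drag_pos : forall rho alpha, 0 < rho -> 0 < alpha -> 0 < D rho alpha;
  drag_neg : forall rho alpha, 0 < rho -> alpha < 0 -> D rho alpha < 0;
  drag_0 : forall rho, 0 < rho -> D rho 0 = 0;
  drag_incr : forall rho alpha1 alpha2, 0 < rho -> alpha1 < alpha2 ->
    D rho alpha1 < D rho alpha2;
  drag_abs_decr : forall rho1 rho2 alpha, 0 < rho1 -> rho1 <= rho2 ->
    Rabs (D rho2 alpha) <= Rabs (D rho1 alpha)
}.

(* Functions of class C^1 on the (t, x) plane supported in
   [a, b] x [-M, M], a compact subset of the open half-plane t > 0. *)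
Definition test_function (phi : R -> R -> R) (a b M : R) : Prop :=
  0 < a < b /\ 0 < M /\ C1_on (fun _ => True) phi /\
  forall t x, ~ (a <= t <= b /\ -M <= x <= M) -> phi t x = 0.

(* The integral of u * d_t phi + f * d_x phi over [a, b] x [-M, M], i.e. minus
   the distribution d_t u + d_x f applied to phi. *)
Definition weak_pairing (u f phi : R -> R -> R) (a b M : R) : R :=
  RInt (fun t => RInt (fun x => u t x * D1 phi t x + f t x * D2 phi t x)
                   (- M) M) a b.

Definition momentum_flux (c : R) (U : state) : R :=
  (snd U) ^ 2 / fst U + c ^ 2 * fst U.

(* A convex entropy eta on Omega with entropy flux Q. The last field is
   grad Q = (grad eta) A, where A is the Jacobian matrix of the flux
   (q, q^2/rho + c^2 rho). *)
Record entropy_pair (c : R) (eta Q : R -> R -> R) : Prop := {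
  entropy_C1 : C1_on Omega eta;
  entropy_flux_C1 : C1_on Omega Q;
  entropy_convex : forall U V lam, Omega U -> Omega V -> 0 <= lam <= 1 ->
    eta (lam * fst U + (1 - lam) * fst V) (lam * snd U + (1 - lam) * snd V)
      <= lam * eta (fst U) (snd U) + (1 - lam) * eta (fst V) (snd V);
  entropy_compat : forall rho q, 0 < rho ->
    D1 Q rho q = (c ^ 2 - (q / rho) ^ 2) * D2 eta rho q /\
    D2 Q rho q = D1 eta rho q + 2 * (q / rho) * D2 eta rho q
}.

(* Entropy solutions, in the sense of distributions on t > 0, of
     d_t rho + d_x q = 0,   d_t q + d_x (q^2/rho + c^2 rho) = 0. *)
Record entropy_solution (c : R) (S : R -> R -> state) : Prop := {
  sol_mass : forall phi a b M, test_function phi a b M ->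
    weak_pairing (fun t x => fst (S t x)) (fun t x => snd (S t x)) phi a b M
      = 0;
  sol_momentum : forall phi a b M, test_function phi a b M ->
    weak_pairing (fun t x => snd (S t x))
      (fun t x => momentum_flux c (S t x)) phi a b M = 0;
  sol_entropy : forall eta Q, entropy_pair c eta Q ->
    forall phi a b M, test_function phi a b M ->
      (forall t x, 0 <= phi t x) ->
      0 <= weak_pairing (fun t x => eta (fst (S t x)) (snd (S t x)))
             (fun t x => Q (fst (S t x)) (snd (S t x))) phi a b M
}.

(* One-sided limits in Omega exist everywhere. On compact sets such a profile
   is bounded and stays away from vacuum, so all the integrals in
   [weak_pairing] are genuine Riemann integrals. *)
Definition regulated (w : R -> state) : Prop :=
  forall xi,
    Omega (w xi) /\
    (exists l, Omega l /\ filterlim w (at_left xi) (locally l)) /\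
    (exists r, Omega r /\ filterlim w (at_right xi) (locally r)).

(* [w] is the profile of the self-similar entropy solution w(x/t) =
   W(x/t; Ua, Ub) of the Riemann problem. It is determined by Ua and Ub up to
   its values at its discontinuities, which the one-sided limits ignore. *)
Record riemann_solution (c : R) (Ua Ub : state) (w : R -> state) : Prop := {
  riemann_regulated : regulated w;
  riemann_entropy_solution : entropy_solution c (fun t x => w (x / t));
  riemann_left : forall x, x < 0 ->
    filterlim (fun t => w (x / t)) (at_right 0) (locally Ua);
  riemann_right : forall x, 0 < x ->
    filterlim (fun t => w (x / t)) (at_right 0) (locally Ub)
}.

Definition U_minus (c : R) (UL : state) (v : R) (U : state) : Prop :=
  exists (Ub : state) (w : R -> state),
    Omega Ub /\ riemann_solution c UL Ub w /\
    filterlim w (at_left v) (locally U).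

Definition U_plus (c : R) (UR : state) (v : R) (U : state) : Prop :=
  exists (Ua : state) (w : R -> state),
    Omega Ua /\ riemann_solution c Ua UR w /\
    filterlim w (at_right v) (locally U).

(* In V_minus, V_plus and [subsonic] pairs are (rho, alpha), alpha = q - v rho. *)
Definition V_minus (c rhoL alphaL v : R) (p : R * R) : Prop :=
  exists rho q, U_minus c (rhoL, alphaL + v * rhoL) v (rho, q) /\
    p = (rho, q - v * rho).

Definition V_plus (c rhoR alphaR v : R) (p : R * R) : Prop :=
  exists rho q, U_plus c (rhoR, alphaR + v * rhoR) v (rho, q) /\
    p = (rho, q - v * rho).

Definition subsonic (c : R) (p : R * R) : Prop :=
  - (c * fst p) <= snd p <= c * fst p.

(* Only meaningful for [alpha <> 0] and [0 < rho]. *)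
Definition F (c : R) (D : R -> R -> R) (alpha rho : R) : R :=
  RInt (fun r => 1 / Rabs (D r alpha) * (c ^ 2 - alpha ^ 2 / r ^ 2))
    (Rabs alpha / c) rho.

Definition germ (c : R) (D : R -> R -> R) (v : R) (Um Up : state) : Prop :=
  let rhom := fst Um in let qm := snd Um in
  let rhop := fst Up in let qp := snd Up in
  let alpha := qm - v * rhom in
  let Fa := F c D alpha in
  Omega Um /\ Omega Up /\ qm - v * rhom = qp - v * rhop /\
  (  (alpha = 0 /\ rhom = rhop /\ qm = qp)
  \/ (0 < alpha /\ 0 <= (alpha / c - rhop) * (alpha / c - rhom) /\
      Fa rhom - Fa rhop = 1)
  \/ (alpha < 0 /\ 0 <= (Rabs alpha / c - rhop) * (Rabs alpha / c - rhom) /\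
      Fa rhop - Fa rhom = 1)
  \/ (c * rhom < alpha /\ alpha / c <= rhop /\
      exists rho theta, rhom <= rho < alpha / c /\ 0 <= theta <= 1 /\
        Fa rhom - Fa rho = theta /\
        Fa (alpha ^ 2 / (c ^ 2 * rho)) - Fa rhop = 1 - theta)
  \/ (alpha < - (c * rhop) /\ Rabs alpha / c <= rhom /\
      exists rho theta, rhop <= rho < Rabs alpha / c /\ 0 <= theta <= 1 /\
        Fa rhop - Fa rho = theta /\
        Fa (alpha ^ 2 / (c ^ 2 * rho)) - Fa rhom = 1 - theta)).

(* Main.v *)
Require Import Defs.
From Stdlib Require Import Reals.
From Coquelicot Require Import Coquelicot.
From Stdlib Require Import Lra Psatz Classical IndefiniteDescription.
Open Scope R_scope.

(** In a self-similar solution let [m = q - xi rho] be the mass flux relative to the ray of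
    speed xi, and let [N = m ^ 2 / rho + c ^ 2 rho]. The weak equations say that [m] and [N]
    are continuous with [m' = - rho] and [N' = - 2 m]. Given [m] and [N], the density is one
    of two roots, a supersonic one ([c rho < |m|]) and a subsonic one, and the entropy
    condition only allows jumps that raise the density in the direction of the mass flux.
    Away from the sonic density a continuous solution is constant ([flow_local_const]).
    Hence, while [m > 0], the solution is the constant left state, then a shock or a sonic
    fan, then a constant subsonic state ([flow_continue], [on_wave_curve]); where [m < 0]
    the reflected picture holds. So a state of [V_minus] with nonnegative flux is subsonic,
    and every subsonic state of [V_minus] lies on the graph [alpha = rho * max (k rho, - c)],
    where [k] is the velocity along the 1-wave curve of the left state, relative to [v]
    ([V_minus_shape]). Conversely all of that graph with [k rho <= c] is reached by explicit
    solutions, made of a rarefaction, or of a shock and possibly a 2-fan ([V_minus_mem]).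
    Their entropy inequalities for all convex entropies come from differentiating along the
    shock curve ([shock_entropy]). [V_plus] is treated by reflection ([V_plus_mirror]).

    What remains is a problem on the line. All pairs of the germ in the two accessible sets
    are subsonic ([germ_balanced]). The flux [alpha] decreases with the density along the
    left branch and increases along the right one. For [alpha > 0] the germ condition says
    that the integral over [[rho_+, rho_-]] of the derivative of [F] is 1. When [alpha]
    grows, the interval shrinks and the integrand decreases, whence uniqueness
    ([balanced_order]). When [alpha] tends to 0 the drag vanishes and the integral blows up,
    while at the sonic end of the left branch it is at most 0, whence existence by the
    intermediate value theorem ([balanced_exists_pos]). The order of the two densities at
    zero flux decides the sign of [alpha]. *)

(** * Regulated functions, and C1 functions of two variables *)

(** Unification does not find these carriers by itself for real-valued functions. *)
Notation continuous_Rplus := (continuous_plus (V := R_NormedModule)) (only parsing).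
Notation continuous_Rminus := (continuous_minus (V := R_NormedModule)) (only parsing).
Notation continuous_Ropp := (continuous_opp (V := R_NormedModule)) (only parsing).
Notation continuous_Rmult := (continuous_mult (K := R_AbsRing)) (only parsing).
Notation is_derive_Rplus := (is_derive_plus (V := R_NormedModule)) (only parsing).
Notation is_derive_Rminus := (is_derive_minus (V := R_NormedModule)) (only parsing).
Notation RInt_correct_R := (RInt_correct (V := R_CompleteNormedModule)) (only parsing).
Notation RInt_Chasles_R := (RInt_Chasles (V := R_CompleteNormedModule)) (only parsing).
Notation opp_RInt_swap_R := (opp_RInt_swap (V := R_CompleteNormedModule)) (only parsing).
Notation is_RInt_derive_R := (is_RInt_derive (V := R_CompleteNormedModule)) (only parsing).
Notation ex_RInt_continuous_R := (ex_RInt_continuous (V := R_CompleteNormedModule)) (only parsing).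

(** [ring] does not see through the carrier of a normed module. *)
Ltac eq_in_R := match goal with |- @eq _ ?a ?b => change (@eq R a b) end.

Lemma at_right_eps (f : R -> R) (x l : R) :
  filterlim f (at_right x) (locally l) <->
  forall e, 0 < e -> exists d, 0 < d /\
    forall y, x < y < x + d -> Rabs (f y - l) < e.
Proof.
  split.
  - intros H e He.
    destruct (proj1 (filterlim_locally _ _) H (mkposreal e He)) as [d Hd].
    exists d. split. { apply cond_pos. }
    intros y Hy.
    apply (Hd y).
    + change (Rabs (y - x) < d). rewrite Rabs_pos_eq; lra.
    + lra.
  - intros H. apply filterlim_locally. intros [e He].
    destruct (H e He) as [d [Hd Hf]].
    exists (mkposreal d Hd). intros y Hy Hxy.
    change (Rabs (y - x) < d) in Hy. apply Rabs_def2 in Hy.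
    change (Rabs (f y - l) < e). apply Hf. lra.
Qed.

Lemma at_left_eps (f : R -> R) (x l : R) :
  filterlim f (at_left x) (locally l) <->
  forall e, 0 < e -> exists d, 0 < d /\
    forall y, x - d < y < x -> Rabs (f y - l) < e.
Proof.
  split.
  - intros H e He.
    destruct (proj1 (filterlim_locally _ _) H (mkposreal e He)) as [d Hd].
    exists d. split. { apply cond_pos. }
    intros y Hy.
    apply (Hd y).
    + change (Rabs (y - x) < d). rewrite Rabs_left; lra.
    + lra.
  - intros H. apply filterlim_locally. intros [e He].
    destruct (H e He) as [d [Hd Hf]].
    exists (mkposreal d Hd). intros y Hy Hxy.
    change (Rabs (y - x) < d) in Hy. apply Rabs_def2 in Hy.
    change (Rabs (f y - l) < e). apply Hf. lra.
Qed.

Lemma continuous_eps (f : R -> R) (x : R) :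
  continuous f x <->
  forall e, 0 < e -> exists d, 0 < d /\
    forall y, Rabs (y - x) < d -> Rabs (f y - f x) < e.
Proof.
  split.
  - intros H e He.
    destruct (proj1 (filterlim_locally _ _) H (mkposreal e He)) as [d Hd].
    exists d. split. { apply cond_pos. } exact Hd.
  - intros H. apply filterlim_locally. intros [e He].
    destruct (H e He) as [d [Hd Hf]].
    exists (mkposreal d Hd). exact Hf.
Qed.

(** Regulated functions. *)
Definition has_limits (f : R -> R) : Prop :=
  forall x, (exists l, filterlim f (at_left x) (locally l)) /\
            (exists r, filterlim f (at_right x) (locally r)).

Lemma continuous_has_limits (f : R -> R) :
  (forall x, continuous f x) -> has_limits f.
Proof.
  intros H x; split; exists (f x); intros P HP;
    apply (filter_le_within _ _); apply (H x P HP).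
Qed.

Lemma has_limits_plus (f g : R -> R) :
  has_limits f -> has_limits g -> has_limits (fun x => f x + g x).
Proof.
  intros Hf Hg x. destruct (Hf x) as [[l1 H1] [r1 K1]], (Hg x) as [[l2 H2] [r2 K2]].
  split; [exists (l1 + l2) | exists (r1 + r2)];
  eapply filterlim_comp_2; try eassumption; exact (filterlim_plus (V:=R_NormedModule) _ _).
Qed.

Lemma has_limits_mult (f g : R -> R) :
  has_limits f -> has_limits g -> has_limits (fun x => f x * g x).
Proof.
  intros Hf Hg x. destruct (Hf x) as [[l1 H1] [r1 K1]], (Hg x) as [[l2 H2] [r2 K2]].
  split; [exists (l1 * l2) | exists (r1 * r2)];
  eapply filterlim_comp_2; try eassumption; exact (filterlim_mult (K:=R_AbsRing) _ _).
Qed.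

(** The set of [x] for which [[a, x]] admits an approximation contains its supremum and
    extends beyond it, by the constants equal to the one-sided limits there. *)
Lemma has_limits_step_approx (f : R -> R) (a b e : R) :
  has_limits f -> a <= b -> 0 < e ->
  exists g, ex_RInt g a b /\ forall y, a <= y <= b -> Rabs (g y - f y) < e.
Proof.
  intros Hf Hab He.
  set (E := fun x => a <= x <= b /\ exists g, ex_RInt g a x /\
              forall y, a <= y <= x -> Rabs (g y - f y) < e).
  assert (HEa : E a).
  { split; [lra|]. exists f. split; [apply ex_RInt_point|].
    intros y Hy. replace (f y - f y) with 0 by ring. rewrite Rabs_R0; lra. }
  destruct (completeness E) as [s [Hub Hlub]].
  { exists b. intros x [Hx _]; lra. }
  { exists a; exact HEa. }
  assert (Has : a <= s) by (apply Hub, HEa).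
  assert (Hsb : s <= b) by (apply Hlub; intros x [Hx _]; lra).
  destruct (Hf s) as [[l Hl] [r Hr]].
  destruct (proj1 (at_left_eps _ _ _) Hl e He) as [d1 [Hd1 H1]].
  destruct (proj1 (at_right_eps _ _ _) Hr e He) as [d2 [Hd2 H2]].
  assert (Hx : exists x, E x /\ s - d1 < x).
  { apply NNPP; intro N. assert (s <= s - d1); [|lra].
    apply Hlub. intros x Ex. apply Rnot_lt_le; intro. apply N. exists x. auto. }
  destruct Hx as [x [[Hxab [g [Hg1 Hg2]]] Hxs]].
  assert (Hxs' : x <= s) by (apply Hub; split; [assumption|]; exists g; auto).
  set (t := Rmin b (s + d2 / 2)).
  assert (Ht : s <= t) by (apply Rmin_glb; lra).
  assert (Ht2 : t < s + d2) by (apply Rle_lt_trans with (s + d2 / 2); [apply Rmin_r|lra]).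
  assert (Htb : t <= b) by apply Rmin_l.
  assert (HEt : E t).
  { split; [lra|].
    set (g' := fun y => if Rle_dec y x then g y else
                        if Rlt_dec y s then l else
                        if Req_EM_T y s then f s else r).
    exists g'. split.
    - apply ex_RInt_Chasles with x; [|apply ex_RInt_Chasles with s].
      + apply ex_RInt_ext with g; [|assumption].
        intros y Hy. rewrite Rmin_left, Rmax_right in Hy by lra.
        unfold g'. destruct (Rle_dec y x); [reflexivity|lra].
      + apply ex_RInt_ext with (fun _ => l); [|apply ex_RInt_const].
        intros y Hy. rewrite Rmin_left, Rmax_right in Hy by lra.
        unfold g'. destruct (Rle_dec y x); [lra|].
        destruct (Rlt_dec y s); [reflexivity|lra].
      + apply ex_RInt_ext with (fun _ => r); [|apply ex_RInt_const].
        intros y Hy. rewrite Rmin_left, Rmax_right in Hy by lra.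
        unfold g'. destruct (Rle_dec y x); [lra|].
        destruct (Rlt_dec y s); [lra|]. destruct (Req_EM_T y s); [lra|reflexivity].
    - intros y Hy. unfold g'. destruct (Rle_dec y x); [apply Hg2; lra|].
      destruct (Rlt_dec y s); [rewrite Rabs_minus_sym; apply H1; lra|].
      destruct (Req_EM_T y s) as [->|].
      + replace (f s - f s) with 0 by ring. rewrite Rabs_R0; lra.
      + rewrite Rabs_minus_sym; apply H2; lra. }
  assert (Hts : t <= s) by (apply Hub, HEt).
  assert (t = b).
  { unfold t in *. destruct (Rle_dec b (s + d2/2)); [apply Rmin_left; lra|].
    rewrite Rmin_right in * by lra. lra. }
  destruct HEt as [_ HEt]. rewrite <- H. exact HEt.
Qed.

(** Uniform limits of integrable functions are integrable. The approximants are cut off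
    outside [[a, b]], because [filterlim_RInt] speaks of uniform convergence on the whole
    line. *)
Lemma has_limits_ex_RInt (f : R -> R) (a b : R) :
  has_limits f -> ex_RInt f a b.
Proof.
  intros Hf.
  assert (W : forall a b, a <= b -> ex_RInt f a b).
  { clear a b. intros a b Hab.
    destruct (functional_choice
      (fun (n : nat) (g : R -> R) => ex_RInt g a b /\
         forall y, a <= y <= b -> Rabs (g y - f y) < / INR (S n))) as [g Hg].
    { intros n. apply has_limits_step_approx; auto.
      apply Rinv_0_lt_compat, lt_0_INR, Nat.lt_0_succ. }
    set (cut := fun (k : R -> R) y => if Rle_dec a y then if Rle_dec y b then k y else 0 else 0).
    assert (Hcut : forall k y, Rmin a b < y < Rmax a b -> k y = cut k y).
    { intros k y Hy. rewrite Rmin_left, Rmax_right in Hy by lra. unfold cut.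
      destruct (Rle_dec a y); [|lra]. destruct (Rle_dec y b); [reflexivity|lra]. }
    destruct (filterlim_RInt (V := R_CompleteNormedModule)
      (fun n => cut (g n)) a b eventually eventually_filter (cut f)
      (fun n => RInt (g n) a b)) as [I [_ HI]].
    - intros n. apply is_RInt_ext with (g n); [apply Hcut|].
      apply RInt_correct_R, Hg.
    - apply filterlim_locally. intros e.
      destruct (nfloor_ex (/ e)) as [N HN].
      { apply Rlt_le, Rinv_0_lt_compat, cond_pos. }
      exists N. intros n Hn y.
      change (Rabs (cut (g n) y - cut f y) < e).
      unfold cut. destruct (Rle_dec a y);
        [|rewrite Rminus_0_r, Rabs_R0; apply cond_pos].
      destruct (Rle_dec y b); [|rewrite Rminus_0_r, Rabs_R0; apply cond_pos].
      apply Rlt_trans with (/ INR (S n)); [apply Hg; lra|].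
      rewrite <- (Rinv_inv e). apply Rinv_lt_contravar.
      + apply Rmult_lt_0_compat; [apply Rinv_0_lt_compat, cond_pos|].
        apply lt_0_INR, Nat.lt_0_succ.
      + apply Rlt_le_trans with (INR N + 1); [apply HN|].
        rewrite S_INR. apply le_INR in Hn. lra.
    - exists I. apply is_RInt_ext with (cut f); [|exact HI].
      intros y Hy. symmetry. apply Hcut; exact Hy. }
  destruct (Rle_dec a b); [auto|]. apply ex_RInt_swap, W; lra.
Qed.

Lemma RInt_near_const (f : R -> R) (a b l e : R) :
  a <= b -> ex_RInt f a b ->
  (forall x, a < x < b -> Rabs (f x - l) <= e) ->
  Rabs (RInt f a b - l * (b - a)) <= e * (b - a).
Proof.
  intros Hab Hf H.
  assert (H1 : RInt f a b <= RInt (fun _ => l + e) a b).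
  { apply RInt_le; auto; [apply ex_RInt_const|].
    intros x Hx. specialize (H x Hx). apply Rabs_le_between in H. lra. }
  assert (H2 : RInt (fun _ => l - e) a b <= RInt f a b).
  { apply RInt_le; auto; [apply ex_RInt_const|].
    intros x Hx. specialize (H x Hx). apply Rabs_le_between in H. lra. }
  rewrite RInt_const in H1, H2. unfold scal in H1, H2; simpl in H1, H2.
  unfold mult in H1, H2; simpl in H1, H2.
  apply Rabs_le_between. lra.
Qed.

(** Joint continuity is uniform over the compact interval of integration. *)
Lemma continuous_RInt_param (f : R -> R -> R) (a b x : R) :
  a <= b ->
  (forall t, a <= t <= b -> continuity_2d_pt f x t) ->
  locally x (fun y => ex_RInt (f y) a b) ->
  continuous (fun y => RInt (f y) a b) x.
Proof.
  intros Hab Hf Hex.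
  apply continuous_eps. intros e He.
  assert (He' : 0 < e / (2 * (b - a + 1))) by (apply Rdiv_lt_0_compat; lra).
  destruct (uniform_continuity_2d_1d' f a b x Hf (mkposreal _ He')) as [d1 Hd1].
  destruct Hex as [d2 Hex].
  exists (Rmin d1 d2). split. { apply Rmin_pos; apply cond_pos. }
  intros y Hy.
  assert (Hy1 : Rabs (y - x) < d1) by (eapply Rlt_le_trans; [exact Hy|apply Rmin_l]).
  assert (Hy2 : Rabs (y - x) < d2) by (eapply Rlt_le_trans; [exact Hy|apply Rmin_r]).
  assert (Ey : ex_RInt (f y) a b) by (apply Hex; exact Hy2).
  assert (Ex : ex_RInt (f x) a b) by (apply Hex, ball_center).
  change (Rabs (minus (RInt (f y) a b) (RInt (f x) a b)) < e).
  rewrite <- (RInt_minus (V := R_CompleteNormedModule)) by assumption.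
  assert (K := RInt_near_const (fun t => minus (f y t) (f x t)) a b 0 (e / (2 * (b - a + 1))) Hab).
  rewrite Rmult_0_l, Rminus_0_r in K.
  eapply Rle_lt_trans.
  - apply K; [apply (ex_RInt_minus (V := R_NormedModule)); assumption|].
    intros t Ht. rewrite Rminus_0_r. apply Rlt_le.
    apply Rabs_def2 in Hy1.
    apply (Hd1 t x t y); try lra.
    rewrite Rminus_diag, Rabs_R0. apply cond_pos.
  - apply Rle_lt_trans with (e / 2); [|lra].
    apply Rmult_le_reg_r with (2 * (b - a + 1)); [lra|].
    replace (e / (2 * (b - a + 1)) * (b - a) * (2 * (b - a + 1))) with (e * (b - a))
      by (field; lra).
    nra.
Qed.

Lemma C1_on_filterdiff (P : R * R -> Prop) (f : R -> R -> R) (x y : R) :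
  open P -> C1_on P f -> P (x, y) ->
  filterdiff (fun z : R * R => f (fst z) (snd z)) (locally (x, y))
    (fun z => plus (scal (fst z) (D1 f x y)) (scal (snd z) (D2 f x y))).
Proof.
  intros HP Hf Hxy.
  apply (is_derive_filterdiff f x y (D1 f) (D2 f x y)).
  - generalize (HP (x, y) Hxy). apply filter_imp. intros [x' y'] H'.
    simpl. apply Derive_correct. apply (Hf x' y' H').
  - apply Derive_correct. apply (Hf x y Hxy).
  - apply (Hf x y Hxy).
Qed.

Lemma C1_on_continuous (P : R * R -> Prop) (f : R -> R -> R) (x y : R) :
  open P -> C1_on P f -> P (x, y) ->
  continuous (fun z : R * R => f (fst z) (snd z)) (x, y).
Proof.
  intros HP Hf Hxy. apply (filterdiff_continuous (V := R_NormedModule)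
    (U := prod_NormedModule _ R_NormedModule R_NormedModule)
    (fun z : R * R => f (fst z) (snd z))).
  eexists. apply (C1_on_filterdiff P); assumption.
Qed.

Lemma C1_on_chain (P : R * R -> Prop) (f : R -> R -> R) (g h : R -> R) (t dg dh : R) :
  open P -> C1_on P f -> P (g t, h t) ->
  is_derive g t dg -> is_derive h t dh ->
  is_derive (fun s => f (g s) (h s)) t
    (D1 f (g t) (h t) * dg + D2 f (g t) (h t) * dh).
Proof.
  intros HP Hf Hxy Hg Hh.
  unfold is_derive in *.
  eapply filterdiff_ext_lin.
  - apply (filterdiff_comp'_2 (T := R_NormedModule) (U := R_NormedModule) (V := R_NormedModule)
      (W := R_NormedModule) g h f t _ _
      (fun a b => plus (scal a (D1 f (g t) (h t))) (scal b (D2 f (g t) (h t)))) Hg Hh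
      (C1_on_filterdiff P f _ _ HP Hf Hxy)).
  - intros s. simpl. unfold plus, scal; simpl. unfold mult; simpl. ring.
Qed.

Lemma open_Omega : open Omega.
Proof.
  intros [x y] H. unfold Omega in *. simpl in *.
  exists (mkposreal x H). intros [x' y'] [Hx _]. simpl in *.
  change (Rabs (x' - x) < x) in Hx. apply Rabs_def2 in Hx. lra.
Qed.

(** * Reflection of the line *)

Definition mirror (U : state) : state := (fst U, - snd U).

Lemma is_RInt_reflect (f : R -> R) (a l : R) :
  is_RInt f (- a) a l -> is_RInt (fun x => f (- x)) (- a) a l.
Proof.
  intros H.
  replace l with (- - l) by ring.
  apply (is_RInt_ext (fun x => opp (opp (f (- x))))); [intros; unfold opp; simpl; ring|].
  apply (is_RInt_opp (V := R_NormedModule) (fun x => opp (f (- x)))).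
  apply (is_RInt_comp_opp (V := R_NormedModule) f).
  rewrite Ropp_involutive. apply (is_RInt_swap (V := R_NormedModule)). exact H.
Qed.

(** The two sides are the [iota] of equivalent predicates. *)
Lemma RInt_reflect (f : R -> R) (a : R) :
  RInt (fun x => f (- x)) (- a) a = RInt f (- a) a.
Proof.
  apply eq_close. apply (close_iota (T := R_CompleteSpace)). intros l. split; intros H.
  - apply is_RInt_reflect in H.
    eapply is_RInt_ext; [|exact H]. intros; simpl. rewrite Ropp_involutive. reflexivity.
  - apply is_RInt_reflect, H.
Qed.

Lemma continuous_flip_snd (f : R * R -> R) (t x : R) :
  continuous f (t, - x) -> continuous (fun z : R * R => f (fst z, - snd z)) (t, x).
Proof.
  intros H.
  apply (continuous_comp_2 (fun z : R * R => fst z) (fun z : R * R => - snd z) (fun a b => f (a, b))).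
  - apply continuous_fst.
  - apply continuous_Ropp, continuous_snd.
  - simpl. eapply continuous_ext; [|exact H]. intros [a b]; reflexivity.
Qed.

Lemma D2_flip (f : R -> R -> R) (t x : R) :
  ex_derive (fun s => f t s) (- x) ->
  is_derive (fun s => f t (- s)) x (- D2 f t (- x)).
Proof.
  intros H. evar_last.
  - apply (is_derive_comp (fun s => f t s) Ropp x (D2 f t (- x)) (-1)).
    + apply Derive_correct, H.
    + auto_derive; [trivial|ring].
  - unfold scal; simpl. unfold mult; simpl. ring.
Qed.

Lemma C1_on_flip (P : R * R -> Prop) (f : R -> R -> R) :
  open P -> (forall x y, P (x, y) -> P (x, - y)) -> C1_on P f -> C1_on P (fun t x => f t (- x)).
Proof.
  intros HO HP Hf t x Hx. destruct (Hf t (- x) (HP _ _ Hx)) as [H1 [H2 [H3 H4]]].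
  split; [exact H1|]. split; [eexists; apply D2_flip, H2|]. split.
  - apply (continuous_flip_snd (fun z => D1 f (fst z) (snd z))). exact H3.
  - apply continuous_ext_loc with (fun z : R * R => - D2 f (fst z) (- snd z)).
    + generalize (HO (t, x) Hx). apply filter_imp. intros [a b] Hab. simpl. symmetry.
      apply is_derive_unique, D2_flip, (Hf a (- b) (HP _ _ Hab)).
    + apply continuous_Ropp.
      apply (continuous_flip_snd (fun z => D2 f (fst z) (snd z))). exact H4.
Qed.

Lemma open_all : open (fun _ : R * R => True).
Proof. apply open_true. Qed.

Lemma test_function_flip (phi : R -> R -> R) (a b M : R) :
  test_function phi a b M -> test_function (fun t x => phi t (- x)) a b M.
Proof.
  intros [H1 [H2 [H3 H4]]]. split; [exact H1|split; [exact H2|split]].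
  - apply C1_on_flip; [apply open_all|trivial|exact H3].
  - intros t x H. apply H4. intros [Ha Hb]. apply H. split; [exact Ha|lra].
Qed.

Lemma C1_on_opp (P : R * R -> Prop) (f : R -> R -> R) :
  C1_on P f -> C1_on P (fun t x => - f t x).
Proof.
  intros Hf t x Hx. destruct (Hf t x Hx) as [H1 [H2 [H3 H4]]].
  split; [apply (ex_derive_opp (V := R_NormedModule)), H1|].
  split; [apply (ex_derive_opp (V := R_NormedModule)), H2|]. split.
  - eapply continuous_ext; [|apply continuous_Ropp, H3].
    intros [a b]. simpl. symmetry. apply Derive_opp.
  - eapply continuous_ext; [|apply continuous_Ropp, H4].
    intros [a b]. simpl. symmetry. apply Derive_opp.
Qed.

Lemma test_function_opp (phi : R -> R -> R) (a b M : R) :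
  test_function phi a b M -> test_function (fun t x => - phi t x) a b M.
Proof.
  intros [H1 [H2 [H3 H4]]]. split; [exact H1|split; [exact H2|split]].
  - apply C1_on_opp, H3.
  - intros t x H. rewrite H4 by assumption. ring.
Qed.

(** The sign is moved onto the test function, as taking it out of the integrals would require
    integrability. *)
Lemma weak_pairing_opp (u f phi : R -> R -> R) (a b M : R) :
  weak_pairing (fun t x => - u t x) (fun t x => - f t x) phi a b M =
  weak_pairing u f (fun t x => - phi t x) a b M.
Proof.
  unfold weak_pairing. apply RInt_ext. intros t _. apply RInt_ext. intros x _.
  unfold D1, D2. rewrite (Derive_opp (fun s => phi s x)), (Derive_opp (fun s => phi t s)).
  eq_in_R. ring.
Qed.

Lemma weak_pairing_flip (u f phi : R -> R -> R) (a b M : R) :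
  test_function phi a b M ->
  weak_pairing (fun t x => u t (- x)) (fun t x => - f t (- x)) phi a b M =
  weak_pairing u f (fun t x => phi t (- x)) a b M.
Proof.
  intros [_ [_ [Hphi _]]]. unfold weak_pairing. apply RInt_ext. intros t _.
  rewrite <- RInt_reflect. apply RInt_ext. intros x _.
  rewrite !Ropp_involutive.
  assert (E : D2 (fun t x => phi t (- x)) t x = - D2 phi t (- x)).
  { apply is_derive_unique, D2_flip, (Hphi t (- x) I). }
  rewrite E. unfold D1. eq_in_R. ring.
Qed.

Lemma entropy_pair_mirror (c : R) (eta Q : R -> R -> R) :
  entropy_pair c eta Q ->
  entropy_pair c (fun r q => eta r (- q)) (fun r q => - Q r (- q)).
Proof.
  intros [H1 H2 H3 H4]. split.
  - apply C1_on_flip; [exact open_Omega|auto|exact H1].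
  - apply C1_on_opp. apply C1_on_flip; [exact open_Omega|auto|exact H2].
  - intros [r1 q1] [r2 q2] l Hr1 Hr2 Hl. simpl in *.
    replace (- (l * q1 + (1 - l) * q2)) with (l * (- q1) + (1 - l) * (- q2)) by ring.
    apply (H3 (r1, - q1) (r2, - q2)); assumption.
  - intros r q Hr.
    destruct (H4 r (- q) Hr) as [E1 E2].
    assert (F1 : D2 (fun r q => eta r (- q)) r q = - D2 eta r (- q)).
    { apply is_derive_unique, D2_flip, (H1 r (- q) Hr). }
    assert (F2 : D2 (fun r q => - Q r (- q)) r q = D2 Q r (- q)).
    { transitivity (- D2 (fun r q => Q r (- q)) r q); [apply Derive_opp|].
      assert (G : D2 (fun r q => Q r (- q)) r q = - D2 Q r (- q)).
      { apply is_derive_unique, D2_flip, (H2 r (- q) Hr). }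
      rewrite G. ring. }
    assert (F3 : D1 (fun r q => - Q r (- q)) r q = - D1 Q r (- q)) by apply Derive_opp.
    assert (F4 : D1 (fun r q => eta r (- q)) r q = D1 eta r (- q)) by reflexivity.
    rewrite F1, F2, F3, F4, E1, E2. split; field; lra.
Qed.

Lemma filterlim_mirror (F : (R -> Prop) -> Prop) (w : R -> state) (l : state) :
  filterlim w F (locally l) -> filterlim (fun x => mirror (w x)) F (locally (mirror l)).
Proof.
  intros H. eapply filterlim_comp; [exact H|].
  apply (continuous_comp_2 (fun z : R * R => fst z) (fun z : R * R => - snd z) (fun a b : R => (a, b))).
  - apply continuous_fst.
  - apply continuous_Ropp, continuous_snd.
  - eapply continuous_ext; [|apply continuous_id]. intros [a b]; reflexivity.
Qed.

Lemma mirror_left (w : R -> state) (x : R) (l : state) :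
  filterlim w (at_right (- x)) (locally l) ->
  filterlim (fun y => mirror (w (- y))) (at_left x) (locally (mirror l)).
Proof.
  intros H. apply filterlim_mirror. eapply filterlim_comp; [apply filterlim_Ropp_left|exact H].
Qed.

Lemma mirror_right (w : R -> state) (x : R) (l : state) :
  filterlim w (at_left (- x)) (locally l) ->
  filterlim (fun y => mirror (w (- y))) (at_right x) (locally (mirror l)).
Proof.
  intros H. apply filterlim_mirror. eapply filterlim_comp; [apply filterlim_Ropp_right|exact H].
Qed.

(** The isothermal Euler system is invariant under x -> - x, q -> - q, which carries test
    functions to test functions and entropy pairs to entropy pairs. *)
Lemma riemann_mirror (c : R) (Ua Ub : state) (w : R -> state) :
  riemann_solution c Ua Ub w ->
  riemann_solution c (mirror Ub) (mirror Ua) (fun x => mirror (w (- x))).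
Proof.
  intros [Reg [Smass Smom Sent] Hl Hr].
  assert (Arg : forall t x, - (x / t) = - x / t) by (intros; unfold Rdiv; ring).
  split.
  - intros x. destruct (Reg (- x)) as [H0 [[l [Pl Ll]] [r [Pr Lr]]]].
    split; [exact H0|]. split.
    + exists (mirror r). split; [exact Pr|]. apply mirror_left, Lr.
    + exists (mirror l). split; [exact Pl|]. apply mirror_right, Ll.
  - split.
    + intros phi a b M T.
      rewrite <- (Smass _ _ _ _ (test_function_flip _ _ _ _ T)).
      rewrite <- weak_pairing_flip by exact T.
      unfold weak_pairing. apply RInt_ext. intros t _. apply RInt_ext. intros x _.
      simpl. rewrite Arg. reflexivity.
    + intros phi a b M T.
      rewrite <- (Smom _ _ _ _ (test_function_opp _ _ _ _ (test_function_flip _ _ _ _ T))).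
      rewrite <- weak_pairing_opp, <- weak_pairing_flip by exact T.
      unfold weak_pairing. apply RInt_ext. intros t _. apply RInt_ext. intros x _.
      unfold momentum_flux. simpl. rewrite Arg. eq_in_R. unfold Rdiv. ring.
    + intros eta Q HE phi a b M T Hp.
      assert (K := Sent _ _ (entropy_pair_mirror _ _ _ HE) _ _ _ _
        (test_function_flip _ _ _ _ T) (fun t x => Hp t (- x))).
      rewrite <- weak_pairing_flip in K by exact T.
      eapply Rle_trans; [exact K|]. apply Req_le.
      unfold weak_pairing. apply RInt_ext. intros t _. apply RInt_ext. intros x _.
      simpl. rewrite Arg, Ropp_involutive. reflexivity.
  - intros x Hx. assert (K := Hr (- x) ltac:(lra)).
    apply filterlim_mirror in K. eapply filterlim_ext; [|exact K].
    intros t. simpl. rewrite Arg. reflexivity.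
  - intros x Hx. assert (K := Hl (- x) ltac:(lra)).
    apply filterlim_mirror in K. eapply filterlim_ext; [|exact K].
    intros t. simpl. rewrite Arg. reflexivity.
Qed.

(** This reduces every question about [V_plus] to one about [V_minus]. *)
Lemma V_plus_mirror (c r0 a0 v r a : R) :
  V_plus c r0 a0 v (r, a) <-> V_minus c r0 (- a0) (- v) (r, - a).
Proof.
  split.
  - intros [r' [q [[Ua [w [HU [Hw Hl]]]] E]]]. injection E as -> ->.
    exists r', (- q). split; [|f_equal; ring].
    exists (mirror Ua), (fun x => mirror (w (- x))). split; [exact HU|]. split.
    + replace (r0, - a0 + - v * r0) with (mirror (r0, a0 + v * r0)) by (unfold mirror; simpl; f_equal; ring).
      apply riemann_mirror, Hw.
    + apply (mirror_left w (- v) (r', q)). rewrite Ropp_involutive. exact Hl.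
  - intros [r' [q [[Ub [w [HU [Hw Hl]]]] E]]]. injection E as -> E.
    exists r', (- q). split; [|f_equal; lra].
    exists (mirror Ub), (fun x => mirror (w (- x))). split; [exact HU|]. split.
    + replace (r0, a0 + v * r0) with (mirror (r0, - a0 + - v * r0)) by (unfold mirror; simpl; f_equal; ring).
      apply riemann_mirror, Hw.
    + apply (mirror_right w v (r', q)). exact Hl.
Qed.

(** * Testing with steep ramps *)

Definition pos_part (x : R) : R := Rmax 0 x.

Lemma continuous_pos_part (x : R) : continuous pos_part x.
Proof.
  apply continuous_eps. intros e He. exists e. split; [assumption|].
  intros y Hy. eapply Rle_lt_trans; [|exact Hy].
  unfold pos_part, Rmax. destruct (Rle_dec 0 x), (Rle_dec 0 y);
  unfold Rabs; repeat destruct Rcase_abs; lra.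
Qed.

Lemma is_derive_pos_part_sqr (x : R) : is_derive (fun x => pos_part x ^ 2) x (2 * pos_part x).
Proof.
  apply is_derive_Reals. intros e He. exists (mkposreal e He).
  intros h Hh Hhe. simpl in Hhe.
  assert (Rabs ((pos_part (x + h) ^ 2 - pos_part x ^ 2) / h - 2 * pos_part x) <= Rabs h);
    [|lra].
  replace ((pos_part (x + h) ^ 2 - pos_part x ^ 2) / h - 2 * pos_part x)
    with ((pos_part (x + h) ^ 2 - pos_part x ^ 2 - 2 * pos_part x * h) / h) by (field; lra).
  unfold Rdiv. rewrite Rabs_mult, Rabs_inv.
  assert (0 < Rabs h) by (apply Rabs_pos_lt; lra).
  apply Rmult_le_reg_r with (Rabs h); [assumption|].
  rewrite Rmult_assoc, Rinv_l, Rmult_1_r by lra.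
  rewrite <- Rabs_mult. rewrite (Rabs_pos_eq (h * h)) by nra.
  unfold pos_part, Rmax. apply Rabs_le_between.
  destruct (Rle_dec 0 x), (Rle_dec 0 (x + h)); split; nra.
Qed.

(** A C1 ramp from 0 to 1 over the unit interval. As a quadratic spline it inherits its
    derivative [tent] from that of [pos_part x ^ 2]. *)
Definition smoothstep (x : R) : R :=
  2 * (pos_part x ^ 2 - 2 * pos_part (x - 1 / 2) ^ 2 + pos_part (x - 1) ^ 2).
Definition tent (x : R) : R := 4 * (pos_part x - 2 * pos_part (x - 1 / 2) + pos_part (x - 1)).

Ltac pos_cases := unfold smoothstep, tent, pos_part, Rmax;
  repeat match goal with |- context [Rle_dec ?a ?b] => destruct (Rle_dec a b) end.

Lemma smoothstep_left (x : R) : x <= 0 -> smoothstep x = 0.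
Proof. intros; pos_cases; nra. Qed.
Lemma smoothstep_right (x : R) : 1 <= x -> smoothstep x = 1.
Proof. intros; pos_cases; nra. Qed.
Lemma tent_left (x : R) : x <= 0 -> tent x = 0.
Proof. intros; pos_cases; nra. Qed.
Lemma tent_right (x : R) : 1 <= x -> tent x = 0.
Proof. intros; pos_cases; nra. Qed.
Lemma tent_nonneg (x : R) : 0 <= tent x.
Proof. intros; pos_cases; nra. Qed.
Lemma smoothstep_bounds (x : R) : 0 <= smoothstep x <= 1.
Proof. intros; pos_cases; nra. Qed.
Lemma smoothstep_inside (x : R) : 0 < x < 1 -> 0 < smoothstep x < 1.
Proof. intros; pos_cases; nra. Qed.

Lemma is_derive_smoothstep (x : R) : is_derive smoothstep x (tent x).
Proof.
  assert (K : forall a, is_derive (fun x => pos_part (x - a) ^ 2) x (2 * pos_part (x - a))).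
  { intros a. evar_last.
    - apply (is_derive_comp (fun x => pos_part x ^ 2) (fun x => x - a) x (2 * pos_part (x - a)) 1).
      + apply is_derive_pos_part_sqr.
      + auto_derive; [trivial|ring].
    - unfold scal; simpl. unfold mult; simpl. ring. }
  unfold smoothstep, tent. evar_last.
  - apply (is_derive_scal (fun x => pos_part x ^ 2 - 2 * pos_part (x - 1 / 2) ^ 2 + pos_part (x - 1) ^ 2)).
    apply (is_derive_Rplus (fun x => pos_part x ^ 2 - 2 * pos_part (x - 1 / 2) ^ 2)).
    + apply (is_derive_Rminus (fun x => pos_part x ^ 2)).
      * apply is_derive_pos_part_sqr.
      * apply (is_derive_scal (fun x => pos_part (x - 1 / 2) ^ 2)). apply K.
    + apply K.
  - unfold plus, minus, plus, opp, scal; simpl. ring.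
Qed.

Lemma continuous_affine_arg (f : R -> R) (u v x : R) :
  (forall x, continuous f x) -> continuous (fun x => f (u * x + v)) x.
Proof.
  intros H. apply (continuous_comp (fun x => u * x + v) f); [|apply H].
  apply continuous_Rplus; [|apply continuous_const].
  apply continuous_Rmult; [apply continuous_const|apply continuous_id].
Qed.

Lemma continuous_tent (x : R) : continuous tent x.
Proof.
  unfold tent.
  apply (continuous_Rmult (fun _ => 4)); [apply continuous_const|].
  apply (continuous_Rplus (fun x => pos_part x - 2 * pos_part (x - 1 / 2))).
  - apply (continuous_Rminus pos_part); [apply continuous_pos_part|].
    apply (continuous_Rmult (fun _ => 2)); [apply continuous_const|].
    apply continuous_ext with (fun x => pos_part (1 * x + - (1/2))).
    { intros; f_equal; lra. } apply continuous_affine_arg, continuous_pos_part.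
  - apply continuous_ext with (fun x => pos_part (1 * x + - 1)).
    { intros; f_equal; lra. } apply continuous_affine_arg, continuous_pos_part.
Qed.

(** The weak form of [h' <= - e]. For a profile in xi = x / t and a law d_t u + d_x f <= 0,
    one has [e = u] and [h = f - xi u]. *)
Definition weak_ineq (h e : R -> R) : Prop :=
  forall A B th dth, A <= B ->
    (forall x, is_derive th x (dth x)) -> (forall x, continuous dth x) ->
    (forall x, 0 <= th x) ->
    (forall x, x <= A \/ B <= x -> th x = 0 /\ dth x = 0) ->
    0 <= RInt (fun x => h x * dth x - e x * th x) A B.

Definition weak_eq (h e : R -> R) : Prop :=
  forall A B th dth, A <= B ->
    (forall x, is_derive th x (dth x)) -> (forall x, continuous dth x) ->
    (forall x, x <= A \/ B <= x -> th x = 0 /\ dth x = 0) ->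
    RInt (fun x => h x * dth x - e x * th x) A B = 0.

Lemma is_derive_continuous (f : R -> R) (x l : R) :
  is_derive f x l -> continuous f x.
Proof. intros H. apply (ex_derive_continuous f). exists l; exact H. Qed.

Lemma ex_RInt_pairing (h e th dth : R -> R) (a b : R) :
  has_limits h -> has_limits e ->
  (forall x, continuous th x) -> (forall x, continuous dth x) ->
  ex_RInt (fun x => h x * dth x - e x * th x) a b.
Proof.
  intros Hh He Ht Hdt. apply has_limits_ex_RInt.
  assert (K := has_limits_plus _ _ (has_limits_mult _ _ Hh (continuous_has_limits _ Hdt))
    (has_limits_mult _ _ He (has_limits_mult _ _
       (continuous_has_limits (fun _ => -1) (fun x => continuous_const _ x))
       (continuous_has_limits _ Ht)))).
  intros x. destruct (K x) as [[l Hl] [r Hr]].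
  split; [exists l|exists r]; (eapply filterlim_ext; [|eassumption]); intros; simpl; ring.
Qed.

(** The test function is a plateau of height 1 over [[x1, x2]] with ramps of width [d] outside
    it. As [d] tends to 0 the ramps pick out the limits [hl] and [hr], while what they
    contribute through [e] is of order [d]. The case [x1 = x2] is the jump condition. *)
Lemma weak_ineq_jump (h e : R -> R) (x1 x2 hl hr : R) :
  has_limits h -> has_limits e -> weak_ineq h e -> x1 <= x2 ->
  filterlim h (at_left x1) (locally hl) ->
  filterlim h (at_right x2) (locally hr) ->
  hr - hl + RInt e x1 x2 <= 0.
Proof.
  intros Hh He Hw Hx Hl Hr.
  apply Rnot_lt_le; intro Hneg.
  (* Each ramp costs at most 2 ep, which contradicts a gap of 8 ep. *)
  set (ep := (hr - hl + RInt e x1 x2) / 8).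
  assert (Hep : 0 < ep) by (unfold ep; lra).
  destruct (He x1) as [[el Hel] _]. destruct (He x2) as [_ [er Her]].
  destruct (proj1 (at_left_eps _ _ _) Hl ep Hep) as [d1 [Hd1 K1]].
  destruct (proj1 (at_left_eps _ _ _) Hel 1 Rlt_0_1) as [d2 [Hd2 K2]].
  destruct (proj1 (at_right_eps _ _ _) Hr ep Hep) as [d3 [Hd3 K3]].
  destruct (proj1 (at_right_eps _ _ _) Her 1 Rlt_0_1) as [d4 [Hd4 K4]].
  set (C := Rabs el + Rabs er + 1).
  assert (HC : 0 < C) by (unfold C; generalize (Rabs_pos el) (Rabs_pos er); lra).
  assert (Hd : exists d, 0 < d /\ d <= d1 /\ d <= d2 /\ d <= d3 /\ d <= d4 /\ C * d <= ep).
  { exists (Rmin (Rmin (Rmin d1 d2) (Rmin d3 d4)) (ep / C)).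
    assert (0 < ep / C) by (apply Rdiv_lt_0_compat; lra).
    split. { repeat apply Rmin_pos; assumption. }
    generalize (Rmin_l (Rmin (Rmin d1 d2) (Rmin d3 d4)) (ep / C))
      (Rmin_r (Rmin (Rmin d1 d2) (Rmin d3 d4)) (ep / C))
      (Rmin_l (Rmin d1 d2) (Rmin d3 d4)) (Rmin_r (Rmin d1 d2) (Rmin d3 d4))
      (Rmin_l d1 d2) (Rmin_r d1 d2) (Rmin_l d3 d4) (Rmin_r d3 d4).
    intros. repeat split; try lra.
    replace ep with (C * (ep / C)) at 2 by (field; lra).
    apply Rmult_le_compat_l; lra. }
  destruct Hd as [d [Hd0 [L1 [L2 [L3 [L4 L5]]]]]].
  set (th := fun x => smoothstep (/ d * x + (1 - x1 / d)) - smoothstep (/ d * x + (- x2 / d))).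
  set (dth := fun x => / d * tent (/ d * x + (1 - x1 / d)) - / d * tent (/ d * x + (- x2 / d))).
  assert (Hid : 0 < / d) by (apply Rinv_0_lt_compat; lra).
  assert (E1 : forall x, / d * x + (1 - x1 / d) = 1 + (x - x1) / d) by (intros; field; lra).
  assert (E2 : forall x, / d * x + (- x2 / d) = (x - x2) / d) by (intros; field; lra).
  assert (Dle : forall x y, x <= y * d -> x / d <= y).
  { intros x y H. apply Rle_div_l; lra. }
  assert (Dge : forall x y, y * d <= x -> y <= x / d).
  { intros x y H. apply Rle_div_r; lra. }
  assert (Dth : forall x, is_derive th x (dth x)).
  { intros x. unfold th, dth.
    apply (is_derive_Rminus
       (fun x => smoothstep (/ d * x + (1 - x1 / d)))).
    - apply (is_derive_comp smoothstep (fun x => / d * x + (1 - x1 / d))).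
      + apply is_derive_smoothstep.
      + auto_derive; [trivial|ring].
    - apply (is_derive_comp smoothstep (fun x => / d * x + (- x2 / d))).
      + apply is_derive_smoothstep.
      + auto_derive; [trivial|ring]. }
  assert (Cth : forall x, continuous th x) by (intros x; eapply is_derive_continuous, Dth).
  assert (Cdth : forall x, continuous dth x).
  { intros x. unfold dth. apply continuous_Rminus;
    apply continuous_Rmult; try apply continuous_const;
    apply (continuous_affine_arg tent), continuous_tent. }
  assert (Ex : forall a b, ex_RInt (fun x => h x * dth x - e x * th x) a b).
  { intros a b. apply ex_RInt_pairing; auto. }
  assert (TA : th (x1 - d) = 0).
  { unfold th. rewrite E1, E2, !smoothstep_left; [lra| |].
    - apply Dle; lra.
    - assert ((x1 - d - x1) / d <= -1) by (apply Dle; lra). lra. }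
  assert (TB : th (x2 + d) = 0).
  { unfold th. rewrite E1, E2, !smoothstep_right; [lra| |].
    - apply Dge; lra.
    - assert (1 <= (x2 + d - x1) / d) by (apply Dge; lra). lra. }
  assert (TM : forall x, x1 <= x <= x2 -> th x = 1 /\ dth x = 0).
  { intros x Hxx. unfold th, dth. rewrite E1, E2.
    assert (0 <= (x - x1) / d) by (apply Dge; lra).
    assert ((x - x2) / d <= 0) by (apply Dle; lra).
    rewrite smoothstep_right, smoothstep_left, tent_right, tent_left; lra. }
  assert (TL : forall x, x <= x1 -> 0 <= dth x /\ 0 <= th x <= 1).
  { intros x Hxx. unfold th, dth. rewrite E1, E2.
    assert ((x - x2) / d <= 0) by (apply Dle; lra).
    rewrite (smoothstep_left ((x - x2) / d)), (tent_left ((x - x2) / d)) by assumption.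
    generalize (smoothstep_bounds (1 + (x - x1) / d)) (tent_nonneg (1 + (x - x1) / d)).
    intros. split; [|lra]. nra. }
  assert (TR : forall x, x2 <= x -> dth x <= 0 /\ 0 <= th x <= 1).
  { intros x Hxx. unfold th, dth. rewrite E1, E2.
    assert (0 <= (x - x1) / d) by (apply Dge; lra).
    rewrite (smoothstep_right (1 + (x - x1) / d)), (tent_right (1 + (x - x1) / d)) by lra.
    generalize (smoothstep_bounds ((x - x2) / d)) (tent_nonneg ((x - x2) / d)).
    intros. split; [|lra]. nra. }
  assert (W := Hw (x1 - d) (x2 + d) th dth).
  assert (IL : RInt (fun x => h x * dth x - e x * th x) (x1 - d) x1 <= (hl + ep) + ep).
  { assert (I : is_RInt (fun x => (hl + ep) * dth x + C) (x1 - d) x1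
                 (((hl + ep) * th x1 + C * x1) - ((hl + ep) * th (x1 - d) + C * (x1 - d)))).
    { apply (is_RInt_derive_R (fun x => (hl + ep) * th x + C * x)).
      - intros x _. evar_last.
        + apply is_derive_Rplus; [apply is_derive_scal, Dth|].
          apply (is_derive_scal (fun x => x)), is_derive_id.
        + unfold plus, one; simpl. ring.
      - intros x _. apply continuous_Rplus; [|apply continuous_const].
        apply continuous_Rmult; [apply continuous_const|apply Cdth]. }
    apply Rle_trans with (RInt (fun x => (hl + ep) * dth x + C) (x1 - d) x1).
    - apply RInt_le; [lra|apply Ex|eexists; exact I|].
      intros x Hxx.
      specialize (K1 x ltac:(lra)). specialize (K2 x ltac:(lra)).
      destruct (TL x ltac:(lra)) as [P1 P2].
      apply Rabs_def2 in K1. apply Rabs_def2 in K2.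
      assert (- e x <= C).
      { unfold C. generalize (Rle_abs (- el)) (Rabs_pos er). rewrite Rabs_Ropp. lra. }
      nra.
    - rewrite (is_RInt_unique _ _ _ _ I), TA, (proj1 (TM x1 ltac:(lra))). lra. }
  assert (IR : RInt (fun x => h x * dth x - e x * th x) x2 (x2 + d) <= - (hr - ep) + ep).
  { assert (I : is_RInt (fun x => (hr - ep) * dth x + C) x2 (x2 + d)
                 (((hr - ep) * th (x2 + d) + C * (x2 + d)) - ((hr - ep) * th x2 + C * x2))).
    { apply (is_RInt_derive_R (fun x => (hr - ep) * th x + C * x)).
      - intros x _. evar_last.
        + apply is_derive_Rplus; [apply is_derive_scal, Dth|].
          apply (is_derive_scal (fun x => x)), is_derive_id.
        + unfold plus, one; simpl. ring.
      - intros x _. apply continuous_Rplus; [|apply continuous_const].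
        apply continuous_Rmult; [apply continuous_const|apply Cdth]. }
    apply Rle_trans with (RInt (fun x => (hr - ep) * dth x + C) x2 (x2 + d)).
    - apply RInt_le; [lra|apply Ex|eexists; exact I|].
      intros x Hxx.
      specialize (K3 x ltac:(lra)). specialize (K4 x ltac:(lra)).
      destruct (TR x ltac:(lra)) as [P1 P2].
      apply Rabs_def2 in K3. apply Rabs_def2 in K4.
      assert (- e x <= C).
      { unfold C. generalize (Rle_abs (- er)) (Rabs_pos el). rewrite Rabs_Ropp. lra. }
      nra.
    - rewrite (is_RInt_unique _ _ _ _ I), TB, (proj1 (TM x2 ltac:(lra))). lra. }
  assert (IM : RInt (fun x => h x * dth x - e x * th x) x1 x2 = - RInt e x1 x2).
  { rewrite <- (RInt_opp (V := R_CompleteNormedModule)) by (apply has_limits_ex_RInt, He).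
    apply RInt_ext. intros x Hxx. rewrite Rmin_left, Rmax_right in Hxx by lra.
    destruct (TM x ltac:(lra)) as [-> ->]. unfold opp; simpl. ring. }
  rewrite <- (RInt_Chasles_R _ (x1 - d) x1 (x2 + d)) in W by apply Ex.
  rewrite <- (RInt_Chasles_R _ x1 x2 (x2 + d)) in W by apply Ex.
  unfold plus in W; simpl in W. rewrite IM in W.
  assert (WW := W ltac:(lra) Dth Cdth).
  assert (0 <= RInt (fun x => h x * dth x - e x * th x) (x1 - d) x1 +
     (- RInt e x1 x2 + RInt (fun x => h x * dth x - e x * th x) x2 (x2 + d))).
  { apply WW.
    - intros x. destruct (Rle_dec x x1); [apply TL; lra|].
      destruct (Rle_dec x2 x); [apply TR; lra|]. rewrite (proj1 (TM x ltac:(lra))). lra.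
    - intros x [Hxx|Hxx]; unfold th, dth; rewrite E1, E2.
      + assert ((x - x1) / d <= -1) by (apply Dle; lra).
        assert ((x - x2) / d <= 0) by (apply Dle; lra).
        rewrite !smoothstep_left, !tent_left by lra. lra.
      + assert (1 <= (x - x2) / d) by (apply Dge; lra).
        assert (0 <= (x - x1) / d) by (apply Dge; lra).
        rewrite !smoothstep_right, !tent_right by lra. lra. }
  unfold ep in *. lra.
Qed.

Lemma RInt_opp_pairing (h e th dth : R -> R) (a b : R) :
  RInt (fun x => - h x * dth x - - e x * th x) a b =
  RInt (fun x => - (h x * dth x - e x * th x)) a b.
Proof. apply RInt_ext; intros; simpl; ring. Qed.

Lemma weak_eq_jump (h e : R -> R) (x1 x2 hl hr : R) :
  has_limits h -> has_limits e -> weak_eq h e -> x1 <= x2 ->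
  filterlim h (at_left x1) (locally hl) ->
  filterlim h (at_right x2) (locally hr) ->
  hr - hl + RInt e x1 x2 = 0.
Proof.
  intros Hh He Hw Hx Hl Hr.
  assert (N : forall f, has_limits f -> has_limits (fun x => - f x)).
  { intros f Hf x. destruct (Hf x) as [[l L] [r R]].
    split; [exists (- l)|exists (- r)]; (eapply filterlim_comp; [eassumption|]);
    exact (filterlim_opp (V := R_NormedModule) _). }
  apply Rle_antisym.
  - apply (weak_ineq_jump h e); auto.
    intros A B th dth HAB H1 H2 _ H3. rewrite (Hw A B th dth); auto; lra.
  - assert (- hr - - hl + RInt (fun x => - e x) x1 x2 <= 0) as K.
    { apply (weak_ineq_jump (fun x => - h x) (fun x => - e x)); auto.
      - intros A B th dth HAB H1 H2 _ H3.
        rewrite RInt_opp_pairing.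
        rewrite (RInt_opp (V := R_CompleteNormedModule)).
        + rewrite (Hw A B th dth); auto. unfold opp; simpl; lra.
        + apply ex_RInt_pairing; auto. intros; eapply is_derive_continuous, H1.
      - eapply filterlim_comp; [exact Hl|]; exact (filterlim_opp (V := R_NormedModule) _).
      - eapply filterlim_comp; [exact Hr|]; exact (filterlim_opp (V := R_NormedModule) _). }
    rewrite (RInt_opp (V := R_CompleteNormedModule)) in K by (apply has_limits_ex_RInt, He).
    unfold opp in K; simpl in K. lra.
Qed.

(** Obtained by testing the first equation with [x * th x] in place of [th x]. For the
    relative mass flux [m] and the relative momentum flux [P] it is the equation of [N = P - x
    m], whose derivative is [- 2 m]. *)
Lemma weak_eq_shift (m rho P q : R -> R) :
  has_limits m -> has_limits rho -> has_limits P -> has_limits q ->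
  weak_eq m rho -> weak_eq P q ->
  weak_eq (fun x => P x - x * m x) (fun x => q x + m x - x * rho x).
Proof.
  intros Hm Hr HP Hq H1 H2 A B th dth HAB Dth Cdth Z.
  assert (Cth : forall x, continuous th x) by (intros x; eapply is_derive_continuous, Dth).
  assert (D' : forall x, is_derive (fun x => x * th x) x (th x + x * dth x)).
  { intros x. evar_last.
    - apply (is_derive_mult (fun x => x) th x); [apply is_derive_id|apply Dth|].
      intros; apply Rmult_comm.
    - unfold plus, mult, one; simpl. ring. }
  assert (C' : forall x, continuous (fun x => th x + x * dth x) x).
  { intros x. apply continuous_Rplus; [apply Cth|].
    apply continuous_Rmult; [apply continuous_id|apply Cdth]. }
  assert (K1 := H1 A B (fun x => x * th x) (fun x => th x + x * dth x) HAB D' C').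
  assert (K2 := H2 A B th dth HAB Dth Cdth Z).
  transitivity (minus (RInt (fun x => P x * dth x - q x * th x) A B)
    (RInt (fun x => m x * (th x + x * dth x) - rho x * (x * th x)) A B)).
  - rewrite <- (RInt_minus (V := R_CompleteNormedModule)).
    + apply RInt_ext. intros x _. unfold minus, plus, opp; simpl. ring.
    + apply ex_RInt_pairing; auto.
    + apply (ex_RInt_pairing m rho (fun x => x * th x) (fun x => th x + x * dth x)); auto.
      intros x. eapply is_derive_continuous, D'.
  - rewrite K1, K2; [unfold minus, plus, opp; simpl; ring|].
    intros x Hx. destruct (Z x Hx) as [-> ->]. lra.
Qed.

(** * Product test functions for self-similar fields *)

(** Its support [[1, 2]] avoids t = 0, where x / t is singular. *)
Definition bump (t : R) : R := smoothstep (t - 1) * (1 - smoothstep (t - 1)).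
Definition dbump (t : R) : R := tent (t - 1) * (1 - 2 * smoothstep (t - 1)).

Lemma is_derive_bump (t : R) : is_derive bump t (dbump t).
Proof.
  assert (K : is_derive (fun t => smoothstep (t - 1)) t (tent (t - 1))).
  { evar_last.
    - apply (is_derive_comp smoothstep (fun x => x - 1) t (tent (t - 1)) 1).
      + apply is_derive_smoothstep.
      + auto_derive; [trivial|ring].
    - unfold scal; simpl. unfold mult; simpl. ring. }
  unfold bump, dbump. evar_last.
  - apply (is_derive_mult (fun t => smoothstep (t - 1)) (fun t => 1 - smoothstep (t - 1)));
      [exact K| |intros; apply Rmult_comm].
    apply (is_derive_Rminus (fun _ => 1)); [|exact K].
    apply is_derive_const.
  - unfold minus, plus, mult, opp, zero; simpl. ring.
Qed.

Lemma continuous_shift1 (f : R -> R) (t : R) :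
  (forall x, continuous f x) -> continuous (fun t => f (t - 1)) t.
Proof.
  intros H. apply continuous_ext with (fun x => f (1 * x + - 1)).
  { intros; f_equal; lra. } apply continuous_affine_arg, H.
Qed.

Lemma continuous_dbump (t : R) : continuous dbump t.
Proof.
  unfold dbump. apply continuous_Rmult.
  - apply continuous_shift1, continuous_tent.
  - apply continuous_Rminus; [apply continuous_const|].
    apply continuous_Rmult; [apply continuous_const|].
    apply continuous_shift1. intros x. eapply is_derive_continuous, is_derive_smoothstep.
Qed.

Lemma continuous_bump (t : R) : continuous bump t.
Proof. eapply is_derive_continuous, is_derive_bump. Qed.

Lemma bump_outside (t : R) : t <= 1 \/ 2 <= t -> bump t = 0 /\ dbump t = 0.
Proof.
  intros [H|H]; unfold bump, dbump.
  - rewrite smoothstep_left, tent_left by lra. lra.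
  - rewrite smoothstep_right, tent_right by lra. lra.
Qed.

Lemma bump_nonneg (t : R) : 0 <= bump t.
Proof. unfold bump. generalize (smoothstep_bounds (t - 1)). nra. Qed.

Lemma RInt_bump_pos : 0 < RInt bump 1 2.
Proof.
  apply RInt_gt_0; [lra| |].
  - intros x Hx. unfold bump. generalize (smoothstep_inside (x - 1) ltac:(lra)). nra.
  - intros x _. apply continuous_bump.
Qed.

Lemma continuous_fst_comp (f : R -> R) (z : R * R) :
  continuous f (fst z) -> continuous (fun z : R * R => f (fst z)) z.
Proof. intros H. apply (continuous_comp fst f); [apply continuous_fst|exact H]. Qed.

Lemma continuous_quot (f : R -> R) (t x : R) : t <> 0 ->
  continuous f (x / t) -> continuous (fun z : R * R => f (snd z / fst z)) (t, x).
Proof.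
  intros Ht H. apply (continuous_comp (fun z : R * R => snd z / fst z) f); [|exact H].
  apply continuous_Rmult; [apply continuous_snd|].
  apply (continuous_fst_comp Rinv). simpl. apply continuous_Rinv; exact Ht.
Qed.

Definition product_fun (th : R -> R) (t x : R) : R := bump t * th (x / t).
Definition product_dt (th dth : R -> R) (t x : R) : R :=
  dbump t * th (x / t) + bump t * (dth (x / t) * (- x / t ^ 2)).
Definition product_dx (dth : R -> R) (t x : R) : R := bump t * (dth (x / t) * / t).
(** The factor 2 bounds t on the support of [bump]. *)
Definition product_radius (A B : R) : R := 2 * (Rabs A + Rabs B + 1).

Lemma product_D1 (th dth : R -> R) (t x : R) :
  (forall x, is_derive th x (dth x)) ->
  is_derive (fun s => product_fun th s x) t (product_dt th dth t x).
Proof.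
  intros Dth.
  destruct (Rlt_dec 0 t) as [Ht|Ht].
  - unfold product_fun, product_dt. evar_last.
    + apply (is_derive_mult bump (fun s => th (x / s))); [apply is_derive_bump| |intros; apply Rmult_comm].
      apply (is_derive_comp th (fun s => x / s) t (dth (x / t)) (- x / t ^ 2)); [apply Dth|].
      auto_derive; [lra|field; lra].
    + unfold plus, mult, scal; simpl. unfold mult; simpl. ring.
  - destruct (bump_outside t ltac:(lra)) as [E1 E2].
    replace (product_dt th dth t x) with 0 by (unfold product_dt; rewrite E1, E2; ring).
    apply is_derive_ext_loc with (fun _ => 0); [|apply @is_derive_const].
    exists (mkposreal 1 Rlt_0_1). intros s Hs.
    change (Rabs (s - t) < 1) in Hs. apply Rabs_def2 in Hs.
    unfold product_fun. rewrite (proj1 (bump_outside s ltac:(lra))). simpl. ring.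
Qed.

Lemma product_D2 (th dth : R -> R) (t x : R) :
  (forall x, is_derive th x (dth x)) ->
  is_derive (fun y => product_fun th t y) x (product_dx dth t x).
Proof.
  intros Dth.
  unfold product_fun, product_dx. destruct (Rlt_dec 0 t) as [Ht|Ht].
  - apply (is_derive_scal (fun y => th (y / t))).
    evar_last.
    + apply (is_derive_comp th (fun y => y / t) x (dth (x / t)) (/ t)); [apply Dth|].
      auto_derive; [trivial|field; lra].
    + unfold scal; simpl. unfold mult; simpl. ring.
  - rewrite (proj1 (bump_outside t ltac:(lra))).
    apply is_derive_ext with (fun _ => 0); [intros; simpl; ring|].
    rewrite Rmult_0_l. apply @is_derive_const.
Qed.

Lemma product_test (A B : R) (th dth : R -> R) :
  (forall x, is_derive th x (dth x)) -> (forall x, continuous dth x) ->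
  (forall x, x <= A \/ B <= x -> th x = 0 /\ dth x = 0) ->
  test_function (product_fun th) 1 2 (product_radius A B).
Proof.
  intros Dth Cdth Z. set (phi := product_fun th). set (M := product_radius A B).
  assert (HM : 0 < M) by (unfold M, product_radius; generalize (Rabs_pos A) (Rabs_pos B); lra).
  split; [lra|split; [exact HM|split]].
  - intros t x _.
    assert (E1 : forall t x, D1 phi t x = product_dt th dth t x)
      by (intros; apply is_derive_unique, product_D1, Dth).
    assert (E2 : forall t x, D2 phi t x = product_dx dth t x)
      by (intros; apply is_derive_unique, product_D2, Dth).
    split; [eexists; apply (product_D1 th dth), Dth|split; [eexists; apply (product_D2 th dth), Dth|]].
    split.
    + apply continuous_ext with (fun z => product_dt th dth (fst z) (snd z)).
      { intros [a b]; simpl; symmetry; apply E1. }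
      destruct (Rlt_dec 0 t) as [Ht|Ht].
      * unfold product_dt. apply continuous_Rplus.
        -- apply continuous_Rmult.
           ++ apply (continuous_fst_comp dbump), continuous_dbump.
           ++ apply continuous_quot; [lra|]. eapply is_derive_continuous, Dth.
        -- apply continuous_Rmult.
           ++ apply (continuous_fst_comp bump), continuous_bump.
           ++ apply continuous_Rmult.
              ** apply continuous_quot; [lra|]. apply Cdth.
              ** apply continuous_Rmult.
                 --- apply continuous_Ropp, continuous_snd.
                 --- apply (continuous_fst_comp (fun t => / t ^ 2)). simpl.
                     apply (continuous_Rinv_comp (fun t => t * (t * 1))); [|nra].
                     apply continuous_Rmult; [apply continuous_id|].
                     apply continuous_Rmult; [apply continuous_id|].
                     apply continuous_const.
      * apply continuous_ext_loc with (fun _ => 0); [|apply continuous_const].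
        exists (mkposreal 1 Rlt_0_1). intros [s y] [Hs _]. simpl in *.
        change (Rabs (s - t) < 1) in Hs. apply Rabs_def2 in Hs.
        unfold product_dt. destruct (bump_outside s ltac:(lra)) as [-> ->]. ring.
    + apply continuous_ext with (fun z => product_dx dth (fst z) (snd z)).
      { intros [a b]; simpl; symmetry; apply E2. }
      destruct (Rlt_dec 0 t) as [Ht|Ht].
      * unfold product_dx. apply continuous_Rmult.
        ++ apply (continuous_fst_comp bump), continuous_bump.
        ++ apply continuous_Rmult.
           ** apply continuous_quot; [lra|]. apply Cdth.
           ** apply (continuous_fst_comp Rinv), continuous_Rinv. simpl; lra.
      * apply continuous_ext_loc with (fun _ => 0); [|apply continuous_const].
        exists (mkposreal 1 Rlt_0_1). intros [s y] [Hs _]. simpl in *.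
        change (Rabs (s - t) < 1) in Hs. apply Rabs_def2 in Hs.
        unfold product_dx. rewrite (proj1 (bump_outside s ltac:(lra))). ring.
  - intros t x H. unfold phi, product_fun.
    destruct (Rlt_dec t 1); [rewrite (proj1 (bump_outside t ltac:(lra))); ring|].
    destruct (Rlt_dec 2 t); [rewrite (proj1 (bump_outside t ltac:(lra))); ring|].
    enough (Hq : x / t <= A \/ B <= x / t) by (rewrite (proj1 (Z (x / t) Hq)); ring).
    destruct (Rlt_dec x (- M)).
    + left. apply Rle_div_l; [lra|].
      unfold M, product_radius in *. generalize (Rle_abs (- A)) (Rabs_pos A) (Rabs_pos B). rewrite Rabs_Ropp. nra.
    + destruct (Rlt_dec M x); [|exfalso; apply H; lra].
      right. apply Rle_div_r; [lra|].
      unfold M, product_radius in *. generalize (Rle_abs B) (Rabs_pos B) (Rabs_pos A). nra.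
Qed.

(** With y = x / t the inner integral is [t * dbump t * a + bump t * b], where [a] and [b] are
    the integrals of [e * th] and [h * dth]; integrating by parts in t leaves [b - a] times
    the integral of [bump]. *)
Lemma product_pairing (A B : R) (th dth h e f : R -> R) :
  A <= B ->
  (forall x, is_derive th x (dth x)) -> (forall x, continuous dth x) ->
  (forall x, x <= A \/ B <= x -> th x = 0 /\ dth x = 0) ->
  has_limits h -> has_limits e -> (forall x, f x = h x + x * e x) ->
  weak_pairing (fun t x => e (x / t)) (fun t x => f (x / t))
    (product_fun th) 1 2 (product_radius A B) =
  RInt (fun x => h x * dth x - e x * th x) A B * RInt bump 1 2.
Proof.
  intros HAB Dth Cdth Z Hh He Hf.
  set (phi := product_fun th). set (M := product_radius A B).
  assert (Cth : forall x, continuous th x) by (intros x; eapply is_derive_continuous, Dth).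
  set (a := RInt (fun x => e x * th x) A B).
  set (b := RInt (fun x => h x * dth x) A B).
  assert (Xa : forall A B, ex_RInt (fun x => e x * th x) A B).
  { intros; apply has_limits_ex_RInt. apply has_limits_mult; [assumption|apply continuous_has_limits; assumption]. }
  assert (Xb : forall A B, ex_RInt (fun x => h x * dth x) A B).
  { intros; apply has_limits_ex_RInt. apply has_limits_mult; [assumption|apply continuous_has_limits; assumption]. }
  assert (Eab : RInt (fun x => h x * dth x - e x * th x) A B = b - a).
  { apply (RInt_minus (V := R_CompleteNormedModule)); auto. }
  assert (In : forall t, 1 < t < 2 ->
    RInt (fun x => e (x / t) * D1 phi t x + f (x / t) * D2 phi t x) (- M) M =
    t * dbump t * a + bump t * b).
  { intros t Ht.
    set (G := fun x => t * dbump t * (e x * th x) + bump t * (h x * dth x)).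
    assert (XG : forall A B, ex_RInt G A B).
    { intros. apply (ex_RInt_plus (V := R_NormedModule));
      apply (ex_RInt_scal (V := R_NormedModule)); auto. }
    assert (ZG : forall x, x <= A \/ B <= x -> G x = 0).
    { intros x Hx. unfold G. destruct (Z x Hx) as [-> ->]. ring. }
    assert (HMA : - M / t <= A).
    { apply Rle_div_l; [lra|].
      unfold M, product_radius in *. generalize (Rle_abs (- A)) (Rabs_pos A) (Rabs_pos B). rewrite Rabs_Ropp. nra. }
    assert (HMB : B <= M / t).
    { apply Rle_div_r; [lra|].
      unfold M, product_radius in *. generalize (Rle_abs B) (Rabs_pos B) (Rabs_pos A). nra. }
    transitivity (RInt (fun x => scal (/ t) (G (/ t * x + 0))) (- M) M).
    - apply RInt_ext. intros x _.
      assert (E1 : D1 phi t x = product_dt th dth t x) by apply is_derive_unique, product_D1, Dth.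
      assert (E2 : D2 phi t x = product_dx dth t x) by apply is_derive_unique, product_D2, Dth.
      rewrite E1, E2.
      unfold product_dt, product_dx, G. rewrite Hf.
      replace (/ t * x + 0) with (x / t) by (unfold Rdiv; ring).
      unfold scal; simpl; unfold mult; simpl. field. lra.
    - rewrite (RInt_comp_lin (V := R_CompleteNormedModule)) by apply XG.
      replace (/ t * - M + 0) with (- M / t) by (unfold Rdiv; ring).
      replace (/ t * M + 0) with (M / t) by (unfold Rdiv; ring).
      rewrite <- (RInt_Chasles_R _ _ A) by apply XG.
      rewrite <- (RInt_Chasles_R _ A B) by apply XG.
      rewrite (RInt_ext G (fun _ => 0) (- M / t) A), (RInt_ext G (fun _ => 0) B (M / t)).
      + rewrite !RInt_const. unfold G.
        rewrite (RInt_plus (V := R_CompleteNormedModule))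
          by (apply (ex_RInt_scal (V := R_NormedModule)); auto).
        rewrite !(RInt_scal (V := R_CompleteNormedModule)) by auto.
        fold a b. unfold plus, scal; simpl. unfold mult; simpl. ring.
      + intros x Hx. rewrite Rmin_left, Rmax_right in Hx by lra. apply ZG; lra.
      + intros x Hx. rewrite Rmin_left, Rmax_right in Hx by lra. apply ZG; lra. }
  unfold weak_pairing.
  rewrite (RInt_ext _ (fun t => t * dbump t * a + bump t * b)).
  2:{ intros t Ht. rewrite Rmin_left, Rmax_right in Ht by lra. apply In; lra. }
  rewrite Eab.
  assert (I1 : is_RInt (fun t => bump t + t * dbump t) 1 2 (2 * bump 2 - 1 * bump 1)).
  { apply (is_RInt_derive_R (fun t => t * bump t)).
    - intros t _. evar_last.
      + apply (is_derive_mult (fun t => t) bump); [apply is_derive_id|apply is_derive_bump|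
          intros; apply Rmult_comm].
      + unfold plus, mult, one; simpl. ring.
    - intros t _. apply continuous_Rplus; [apply continuous_bump|].
      apply continuous_Rmult; [apply continuous_id|apply continuous_dbump]. }
  rewrite (proj1 (bump_outside 2 ltac:(lra))), (proj1 (bump_outside 1 ltac:(lra))) in I1.
  assert (I2 : is_RInt bump 1 2 (RInt bump 1 2)).
  { apply RInt_correct_R, ex_RInt_continuous_R.
    intros; apply continuous_bump. }
  apply is_RInt_unique. evar_last.
  - apply (is_RInt_ext (fun t => plus (scal a (bump t + t * dbump t)) (scal (b - a) (bump t)))).
    2:{ apply (is_RInt_plus (V := R_NormedModule));
        apply (is_RInt_scal (V := R_NormedModule)); [exact I1|exact I2]. }
    intros t _. unfold plus, scal; simpl. unfold mult; simpl. ring.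
  - unfold plus, scal; simpl. unfold mult; simpl. ring.
Qed.

Lemma weak_ineq_of_pairing (h e f : R -> R) :
  has_limits h -> has_limits e -> (forall x, f x = h x + x * e x) ->
  (forall phi a b M, test_function phi a b M -> (forall t x, 0 <= phi t x) ->
     0 <= weak_pairing (fun t x => e (x / t)) (fun t x => f (x / t)) phi a b M) ->
  weak_ineq h e.
Proof.
  intros Hh He Hf H A B th dth HAB Dth Cdth Pth Z.
  assert (K := H _ _ _ _ (product_test A B th dth Dth Cdth Z)
    (fun t x => Rmult_le_pos _ _ (bump_nonneg t) (Pth _))).
  rewrite (product_pairing A B th dth h e f) in K by assumption.
  generalize RInt_bump_pos. nra.
Qed.

Lemma weak_eq_of_pairing (h e f : R -> R) :
  has_limits h -> has_limits e -> (forall x, f x = h x + x * e x) ->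
  (forall phi a b M, test_function phi a b M ->
     weak_pairing (fun t x => e (x / t)) (fun t x => f (x / t)) phi a b M = 0) ->
  weak_eq h e.
Proof.
  intros Hh He Hf H A B th dth HAB Dth Cdth Z.
  assert (K := H _ _ _ _ (product_test A B th dth Dth Cdth Z)).
  rewrite (product_pairing A B th dth h e f) in K by assumption.
  generalize RInt_bump_pos. nra.
Qed.

(** * Mass flux and density along a self-similar solution *)

(** What the weak equations leave of a self-similar solution, as functions of the speed x: the
    mass flux [m = q - x rho] relative to the ray, [N = m ^ 2 / rho + c ^ 2 rho], and the
    one-sided limits [rl] and [rr] of the density. The sign [eps] is 1 for a solution and -1
    for a solution read from right to left, so that a statement about continuing a state to
    the right also serves to continue it to the left. *)
Record flow (c eps : R) (m N rl rr : R -> R) : Prop := {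
  flow_sign : eps = 1 \/ eps = -1;
  flow_rl_pos : forall x, 0 < rl x;
  flow_rr_pos : forall x, 0 < rr x;
  flow_Nl : forall x, N x = m x ^ 2 / rl x + c ^ 2 * rl x;
  flow_Nr : forall x, N x = m x ^ 2 / rr x + c ^ 2 * rr x;
  flow_mono : forall x y, x < y -> 0 < eps * (m x - m y);
  flow_cm : forall x, continuous m x;
  flow_dm : forall x, rl x = rr x -> is_derive m x (- eps * rl x);
  flow_dN : forall x, is_derive N x (- 2 * eps * m x);
  flow_entropy : forall x, 0 <= eps * m x * (rr x - rl x);
  flow_lim_l : forall x e, 0 < e -> exists d, 0 < d /\
    forall y, x - d < y < x -> Rabs (rl y - rl x) < e /\ Rabs (rr y - rl x) < e;
  flow_lim_r : forall x e, 0 < e -> exists d, 0 < d /\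
    forall y, x < y < x + d -> Rabs (rl y - rr x) < e /\ Rabs (rr y - rr x) < e
}.

Arguments flow_sign {c eps m N rl rr}.
Arguments flow_rl_pos {c eps m N rl rr}.
Arguments flow_rr_pos {c eps m N rl rr}.
Arguments flow_Nl {c eps m N rl rr}.
Arguments flow_Nr {c eps m N rl rr}.
Arguments flow_mono {c eps m N rl rr}.
Arguments flow_cm {c eps m N rl rr}.
Arguments flow_dm {c eps m N rl rr}.
Arguments flow_dN {c eps m N rl rr}.
Arguments flow_entropy {c eps m N rl rr}.
Arguments flow_lim_l {c eps m N rl rr}.
Arguments flow_lim_r {c eps m N rl rr}.

Lemma continuous_opp_arg (f : R -> R) (x : R) :
  continuous f (- x) -> continuous (fun y => f (- y)) x.
Proof.
  intros H. apply (continuous_comp Ropp f); [|exact H].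
  apply (continuous_Ropp (fun x => x)), continuous_id.
Qed.

Lemma is_derive_opp_arg (f : R -> R) (x l : R) :
  is_derive f (- x) l -> is_derive (fun y => f (- y)) x (- l).
Proof.
  intros H. evar_last.
  - apply (is_derive_comp f Ropp x l (-1)); [exact H|].
    auto_derive; [trivial|ring].
  - unfold scal; simpl. unfold mult; simpl. ring.
Qed.

Lemma flow_reverse {c eps : R} {m N rl rr : R -> R} :
  flow c eps m N rl rr ->
  flow c (- eps) (fun x => m (- x)) (fun x => N (- x)) (fun x => rr (- x)) (fun x => rl (- x)).
Proof.
  intros H. destruct H as [F1 F2 F3 F4 F5 F6 F7 F8 F9 F10 F11 F12]. split; auto.
  - lra.
  - intros x y Hxy. specialize (F6 (- y) (- x) ltac:(lra)). nra.
  - intros x. apply continuous_opp_arg, F7.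
  - intros x Hx. replace (- - eps * rr (- x)) with (- (- eps * rl (- x))) by (rewrite Hx; ring).
    apply is_derive_opp_arg, F8; auto.
  - intros x. replace (-2 * - eps * m (- x)) with (- (-2 * eps * m (- x))) by ring.
    apply is_derive_opp_arg, F9.
  - intros x. specialize (F10 (- x)). nra.
  - intros x e He. destruct (F12 (- x) e He) as [d [Hd K]]. exists d. split; auto.
    intros y Hy. destruct (K (- y) ltac:(lra)); auto.
  - intros x e He. destruct (F11 (- x) e He) as [d [Hd K]]. exists d. split; auto.
    intros y Hy. destruct (K (- y) ltac:(lra)); auto.
Qed.

Lemma flow_mirror {c eps : R} {m N rl rr : R -> R} :
  flow c eps m N rl rr ->
  flow c eps (fun x => - m (- x)) (fun x => N (- x)) (fun x => rr (- x)) (fun x => rl (- x)).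
Proof.
  intros H. destruct H as [F1 F2 F3 F4 F5 F6 F7 F8 F9 F10 F11 F12]. split; auto.
  - intros x. rewrite F5. field. apply Rgt_not_eq, F3.
  - intros x. rewrite F4. field. apply Rgt_not_eq, F2.
  - intros x y Hxy. specialize (F6 (- y) (- x) ltac:(lra)). nra.
  - intros x. apply continuous_Ropp, continuous_opp_arg, F7.
  - intros x Hx. replace (- eps * rr (- x)) with (- - (- eps * rl (- x))) by (rewrite Hx; ring).
    apply (is_derive_opp (V := R_NormedModule) (fun x => m (- x))), is_derive_opp_arg, F8; auto.
  - intros x. replace (-2 * eps * - m (- x)) with (- (-2 * eps * m (- x))) by ring.
    apply is_derive_opp_arg, F9.
  - intros x. specialize (F10 (- x)). nra.
  - intros x e He. destruct (F12 (- x) e He) as [d [Hd K]]. exists d. split; auto.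
    intros y Hy. destruct (K (- y) ltac:(lra)); auto.
  - intros x e He. destruct (F11 (- x) e He) as [d [Hd K]]. exists d. split; auto.
    intros y Hy. destruct (K (- y) ltac:(lra)); auto.
Qed.

(** The densities with given [m] and [N] are the roots of a quadratic with product [m ^ 2 / c
    ^ 2]. This is the Rankine-Hugoniot relation. *)
Lemma equal_N_product (c m r1 r2 : R) : 0 < r1 -> 0 < r2 ->
  m ^ 2 / r1 + c ^ 2 * r1 = m ^ 2 / r2 + c ^ 2 * r2 ->
  r1 = r2 \/ m ^ 2 = c ^ 2 * (r1 * r2).
Proof.
  intros P1 P2 E.
  assert (K : (r1 - r2) * (c ^ 2 * (r1 * r2) - m ^ 2) = 0).
  { replace ((r1 - r2) * (c ^ 2 * (r1 * r2) - m ^ 2))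
      with (r1 * r2 * ((m ^ 2 / r1 + c ^ 2 * r1) - (m ^ 2 / r2 + c ^ 2 * r2))) by (field; lra).
    rewrite E. ring. }
  apply Rmult_integral in K. destruct K; [left|right]; lra.
Qed.

(** The sonic density [m / c] separates the two roots. *)
Lemma density_unique (c eps m r1 r2 : R) :
  0 < r1 -> 0 < r2 -> 0 < c -> 0 < m ->
  m ^ 2 / r1 + c ^ 2 * r1 = m ^ 2 / r2 + c ^ 2 * r2 ->
  0 < eps * (c * r1 - m) -> 0 < eps * (c * r2 - m) -> (eps = 1 \/ eps = -1) ->
  r1 = r2.
Proof.
  intros P1 P2 Hc Hm E H1 H2 He.
  destruct (equal_N_product c m r1 r2 P1 P2 E) as [K|K]; [exact K|exfalso].
  destruct He as [-> | ->].
  - assert (m * (c * r2) < (c * r1) * (c * r2)) by (apply Rmult_lt_compat_r; nra).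
    assert (m * m < m * (c * r2)) by (apply Rmult_lt_compat_l; lra). nra.
  - assert ((c * r1) * (c * r2) < m * (c * r2)) by (apply Rmult_lt_compat_r; nra).
    assert (m * (c * r2) < m * m) by (apply Rmult_lt_compat_l; lra). nra.
Qed.

Lemma flow_linear {c eps : R} {m N rl rr : R -> R} (x y r : R) :
  flow c eps m N rl rr -> x <= y ->
  (forall z, x < z < y -> rl z = r /\ rr z = r) ->
  m y = m x - eps * r * (y - x).
Proof.
  intros F Hxy H.
  destruct (MVT_gen m x y (fun _ => - eps * r)) as [z [_ Hz]].
  - rewrite Rmin_left, Rmax_right by lra. intros z Hz.
    destruct (H z Hz) as [E1 E2]. rewrite <- E1.
    apply (flow_dm F). congruence.
  - intros z _. apply continuity_pt_filterlim, (flow_cm F).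
  - lra.
Qed.

Lemma flow_left_const {c eps : R} {m N rl rr : R -> R} (x y r : R) :
  flow c eps m N rl rr -> x < y ->
  (forall z, x < z < y -> rl z = r) -> rl y = r.
Proof.
  intros F Hxy H. apply cond_eq. intros e He.
  destruct (flow_lim_l F y e He) as [d [Hd K]].
  set (z := Rmax ((x + y) / 2) (y - d / 2)).
  assert ((x + y) / 2 <= z) by apply Rmax_l.
  assert (y - d / 2 <= z) by apply Rmax_r.
  assert (z < y) by (apply Rmax_lub_lt; lra).
  destruct (K z ltac:(lra)) as [K1 _].
  rewrite (H z ltac:(lra)) in K1. rewrite Rabs_minus_sym. exact K1.
Qed.

Lemma flow_right_const {c eps : R} {m N rl rr : R -> R} (x y r : R) :
  flow c eps m N rl rr -> x < y ->
  (forall z, x < z < y -> rr z = r) -> rr x = r.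
Proof.
  intros F Hxy H.
  assert (K := flow_left_const (- y) (- x) r (flow_reverse F)).
  simpl in K. rewrite Ropp_involutive in K. apply K; [lra|].
  intros z Hz. apply H. lra.
Qed.

(** Differentiating [N = m ^ 2 / rho + c ^ 2 rho] with [m' = - eps rho] and [N' = - 2 eps m]
    leaves [(c ^ 2 - m ^ 2 / rho ^ 2) rho' = 0]. The density is only known to be continuous,
    so the computation is made on difference quotients. *)
Lemma flow_local_const (c eps : R) (m N rl rr : R -> R) (x y : R) :
  flow c eps m N rl rr ->
  (forall z, x < z < y -> rl z = rr z /\ m z ^ 2 <> c ^ 2 * rl z ^ 2) ->
  forall z1 z2, x < z1 < y -> x < z2 < y -> rl z1 = rl z2.
Proof.
  intros F H.
  assert (P := flow_rl_pos F).
  assert (D : forall z, x < z < y -> is_derive rl z 0).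
  { intros z Hz. destruct (H z Hz) as [E NS].
    assert (Dm := flow_dm F z E).
    assert (DN := flow_dN F z).
    assert (Cr : continuous rl z).
    { apply continuous_eps. intros e He.
      destruct (flow_lim_l F z e He) as [d1 [Hd1 K1]].
      destruct (flow_lim_r F z e He) as [d2 [Hd2 K2]].
      exists (Rmin d1 d2). split; [apply Rmin_pos; assumption|].
      intros t Ht. apply Rabs_def2 in Ht.
      generalize (Rmin_l d1 d2) (Rmin_r d1 d2). intros.
      destruct (Rtotal_order t z) as [Htz|[->|Htz]].
      - apply K1; lra.
      - rewrite Rminus_diag, Rabs_R0; exact He.
      - rewrite E. apply K2; lra. }
    (* The difference quotient of rl, times a factor G with limit c^2 - m^2 / rl^2, is that
       of the differentiable K. *)
    set (G := fun t => c ^ 2 - m z ^ 2 / (rl z * rl t)).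
    set (K := fun t => N t - m t ^ 2 / rl z + (m t ^ 2 - m z ^ 2) * (/ rl z - / rl t)).
    assert (EK : forall t, (rl t - rl z) * G t = K t - K z).
    { intros t. unfold G, K. rewrite !(flow_Nl F). field.
      split; apply Rgt_not_eq, P. }
    assert (Cm := flow_cm F).
    assert (Cinv : continuous (fun t => / rl t) z).
    { apply (continuous_Rinv_comp rl); [exact Cr|apply Rgt_not_eq, P]. }
    assert (CG : continuous G z).
    { unfold G. apply continuous_Rminus; [apply continuous_const|].
      apply continuous_Rmult; [apply continuous_const|].
      apply (continuous_Rinv_comp (fun t => rl z * rl t)).
      - apply continuous_Rmult; [apply continuous_const|exact Cr].
      - generalize (P z). nra. }
    assert (GZ : G z <> 0).
    { unfold G. intro E0. apply NS. generalize (P z). intros.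
      replace (m z ^ 2) with (rl z ^ 2 * (m z ^ 2 / (rl z * rl z))) by (field; lra).
      replace (m z ^ 2 / (rl z * rl z)) with (c ^ 2) by lra. ring. }
    assert (DK : is_derive K z 0).
    (* The last summand of K is a differentiable function that vanishes at z times a
       continuous one that vanishes at z, so its derivative there is 0. *)
    {
      assert (DQ : is_derive (fun t => m t ^ 2 - m z ^ 2) z (2 * m z * (- eps * rl z))).
      { evar_last.
        - apply is_derive_Rminus; [apply is_derive_pow, Dm|apply @is_derive_const].
        - unfold minus, plus, opp, zero; simpl. ring. }
      assert (DR : is_derive (fun t => (m t ^ 2 - m z ^ 2) * (/ rl z - / rl t)) z 0).
      { apply is_derive_Reals. apply is_derive_Reals in DQ.
        intros e He.
        set (L := 2 * m z * (- eps * rl z)) in *.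
        assert (HL : 0 < Rabs L + 1) by (generalize (Rabs_pos L); lra).
        destruct (DQ 1 Rlt_0_1) as [d1 K1].
        destruct (proj1 (continuous_eps _ _) Cinv (e / (Rabs L + 1))) as [d2 [Hd2 K2]].
        { apply Rdiv_lt_0_compat; lra. }
        exists (mkposreal (Rmin d1 d2) (Rmin_pos _ _ (cond_pos d1) Hd2)).
        intros h Hh Hhd. simpl in Hhd.
        assert (Rabs h < d1) by (eapply Rlt_le_trans; [exact Hhd|apply Rmin_l]).
        assert (Rabs h < d2) by (eapply Rlt_le_trans; [exact Hhd|apply Rmin_r]).
        specialize (K1 h Hh ltac:(assumption)).
        specialize (K2 (z + h)). replace (z + h - z) with h in K2 by ring.
        specialize (K2 ltac:(assumption)).
        rewrite Rminus_diag, Rmult_0_l, !Rminus_0_r in *.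
        replace ((m (z + h) ^ 2 - m z ^ 2) * (/ rl z - / rl (z + h)) / h)
          with ((m (z + h) ^ 2 - m z ^ 2) / h * (/ rl z - / rl (z + h))) by (unfold Rdiv; ring).
        rewrite Rabs_mult, (Rabs_minus_sym (/ rl z)).
        assert (Rabs ((m (z + h) ^ 2 - m z ^ 2) / h) < Rabs L + 1).
        { replace ((m (z + h) ^ 2 - m z ^ 2) / h) with (((m (z + h) ^ 2 - m z ^ 2) / h - L) + L) by ring.
          eapply Rle_lt_trans; [apply Rabs_triang|]. lra. }
        apply Rle_lt_trans with ((Rabs L + 1) * Rabs (/ rl (z + h) - / rl z)).
        - apply Rmult_le_compat_r; [apply Rabs_pos|lra].
        - replace e with ((Rabs L + 1) * (e / (Rabs L + 1))) by (field; lra).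
          apply Rmult_lt_compat_l; lra. }
      unfold K. evar_last.
      - apply is_derive_Rplus; [|exact DR].
        apply is_derive_Rminus; [exact DN|].
        apply (is_derive_ext (fun t => / rl z * m t ^ 2)); [intros; unfold Rdiv; apply Rmult_comm|].
        apply is_derive_scal, is_derive_pow, Dm.
      - unfold minus, plus, opp; simpl. generalize (P z). intros. field. lra. }
    (* G is continuous and nonzero at z, so it can be divided out. *)
    apply is_derive_Reals. apply is_derive_Reals in DK. intros e He.
    assert (Hg : 0 < Rabs (G z)) by (apply Rabs_pos_lt, GZ).
    destruct (proj1 (continuous_eps _ _) CG (Rabs (G z) / 2) ltac:(lra)) as [d1 [Hd1 K1]].
    destruct (DK (e * (Rabs (G z) / 2))) as [d2 K2].
    { apply Rmult_lt_0_compat; lra. }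
    exists (mkposreal (Rmin d1 d2) (Rmin_pos _ _ Hd1 (cond_pos d2))).
    intros h Hh Hhd. simpl in Hhd.
    assert (Rabs h < d1) by (eapply Rlt_le_trans; [exact Hhd|apply Rmin_l]).
    assert (Rabs h < d2) by (eapply Rlt_le_trans; [exact Hhd|apply Rmin_r]).
    specialize (K2 h Hh ltac:(assumption)).
    specialize (K1 (z + h)). replace (z + h - z) with h in K1 by ring.
    specialize (K1 ltac:(assumption)).
    rewrite Rminus_0_r in *. rewrite <- EK in K2.
    assert (G2 : Rabs (G z) / 2 < Rabs (G (z + h))).
    { assert (T := Rabs_triang (G (z + h)) (G z - G (z + h))).
      replace (G (z + h) + (G z - G (z + h))) with (G z) in T by ring.
      rewrite (Rabs_minus_sym (G z)) in T. lra. }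
    replace ((rl (z + h) - rl z) * G (z + h) / h) with ((rl (z + h) - rl z) / h * G (z + h)) in K2
      by (unfold Rdiv; ring).
    rewrite Rabs_mult in K2.
    apply Rnot_le_lt. intro N1.
    assert (e * (Rabs (G z) / 2) <= Rabs ((rl (z + h) - rl z) / h) * Rabs (G (z + h))).
    { apply Rmult_le_compat; lra. }
    lra. }
  intros z1 z2 Hz1 Hz2.
  destruct (MVT_gen rl z1 z2 (fun _ => 0)) as [z [_ Hz]].
  - intros z Hz. apply D. unfold Rmin, Rmax in Hz.
    destruct (Rle_dec z1 z2); lra.
  - intros z Hz. apply continuity_pt_filterlim. 
    apply (ex_derive_continuous rl). exists 0. apply D. unfold Rmin, Rmax in Hz.
    destruct (Rle_dec z1 z2); lra.
  - lra.
Qed.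

(** * Continuation of states away from the sonic line *)

(** For [eps = 1] the density can only jump upwards, and an upward jump from a subsonic state
    would lead to another subsonic state with the same [m] and [N]. For [eps = -1] the same
    holds for supersonic states. *)
Lemma flow_no_shock (c eps : R) (m N rl rr : R -> R) (x : R) :
  flow c eps m N rl rr -> 0 < c -> 0 < m x -> 0 < eps * (c * rl x - m x) ->
  rr x = rl x.
Proof.
  intros F Hc Hm H.
  assert (S := flow_sign F).
  assert (E := flow_entropy F x).
  assert (E' : 0 <= eps * (rr x - rl x)).
  { apply Rmult_le_reg_l with (m x); [assumption|]. nra. }
  apply (density_unique c eps (m x)); auto.
  - apply (flow_rr_pos F).
  - apply (flow_rl_pos F).
  - rewrite <- (flow_Nl F), <- (flow_Nr F). reflexivity.
  - nra.
Qed.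

(** Such a state cannot reach the sonic density: while the density is constant, [m' = - eps
    rho] takes [eps * (c * rho - m)] away from 0, so neither a jump nor a density gradient can
    occur. The constant state is continued up to the supremum of the interval where it
    persists, and then beyond it. *)
Lemma flow_continue (c eps : R) (m N rl rr : R -> R) (x1 x2 : R) :
  flow c eps m N rl rr -> 0 < c -> x1 < x2 ->
  (forall x, x1 <= x < x2 -> 0 < m x) ->
  0 < eps * (c * rr x1 - m x1) ->
  forall z, x1 < z < x2 -> rl z = rr x1 /\ rr z = rr x1.
Proof.
  intros F Hc H12 Hm H0.
  assert (Sg := flow_sign F).
  set (r := rr x1) in *.
  set (E := fun x => x1 <= x <= x2 /\ forall z, x1 < z < x -> rl z = r /\ rr z = r).
  destruct (completeness E) as [s [Hub Hlub]].
  { exists x2. intros x [Hx _]; lra. }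
  { exists x1. split; [lra|]. intros; lra. }
  assert (H1s : x1 <= s) by (apply Hub; split; [lra|intros; lra]).
  assert (Hs2 : s <= x2) by (apply Hlub; intros x [Hx _]; lra).
  assert (Es : forall z, x1 < z < s -> rl z = r /\ rr z = r).
  { intros z Hz. apply NNPP; intro N'.
    assert (s <= z); [|lra]. apply Hlub. intros x [Hx Kx].
    apply Rnot_lt_le; intro. apply N', Kx; lra. }
  destruct (Req_dec s x2) as [Es2|Ns2]; [subst s; exact Es|exfalso].
  assert (Hms : 0 < m s) by (apply Hm; lra).
  assert (Lin : m s = m x1 - eps * r * (s - x1)) by (apply (flow_linear _ _ r F); auto).
  assert (Ss : 0 < eps * (c * r - m s)).
  { rewrite Lin. unfold r in *. generalize (flow_rr_pos F x1). intros.
    replace (eps * (c * rr x1 - (m x1 - eps * rr x1 * (s - x1))))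
      with (eps * (c * rr x1 - m x1) + eps ^ 2 * (rr x1 * (s - x1))) by ring.
    assert (0 <= rr x1 * (s - x1)) by nra.
    destruct Sg as [-> | ->]; nra. }
  assert (Rs : rr s = r).
  { destruct (Req_dec s x1) as [->|]; [reflexivity|].
    assert (Ls : rl s = r) by (apply (flow_left_const x1 s r F); [lra|apply Es]).
    rewrite <- Ls. apply (flow_no_shock c eps m N); auto. rewrite Ls; exact Ss. }
  (* Just after s the state is still on the same side of the sonic density, so the density is
     continuous there and flow_local_const applies. *)
  assert (Near : exists d, 0 < d /\ s + d <= x2 /\ forall z, s < z < s + d ->
    0 < eps * (c * rl z - m z) /\ 0 < eps * (c * rr z - m z)).
  { set (g := eps * (c * r - m s)) in *.
    assert (Hg : 0 < g / (4 * c)) by (apply Rdiv_lt_0_compat; lra).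
    destruct (flow_lim_r F s _ Hg) as [d1 [Hd1 K1]].
    destruct (proj1 (continuous_eps _ _) (flow_cm F s) (g / 4) ltac:(lra)) as [d2 [Hd2 K2]].
    exists (Rmin (Rmin d1 d2) (x2 - s)).
    generalize (Rmin_l (Rmin d1 d2) (x2 - s)) (Rmin_r (Rmin d1 d2) (x2 - s)) (Rmin_l d1 d2) (Rmin_r d1 d2).
    intros. split; [repeat apply Rmin_pos; lra|]. split; [lra|].
    intros z Hz. destruct (K1 z ltac:(lra)) as [A1 A2].
    assert (A3 : Rabs (m z - m s) < g / 4) by (apply K2; rewrite Rabs_pos_eq; lra).
    rewrite Rs in A1, A2. apply Rabs_def2 in A1. apply Rabs_def2 in A2. apply Rabs_def2 in A3.
    assert (Hcg : c * (g / (4 * c)) = g / 4) by (field; lra).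
    assert (c * (rl z - r) < g / 4 /\ - (g / 4) < c * (rl z - r)) by (rewrite <- Hcg; split; nra).
    assert (c * (rr z - r) < g / 4 /\ - (g / 4) < c * (rr z - r)) by (rewrite <- Hcg; split; nra).
    unfold g in *. destruct Sg as [-> | ->]; lra. }
  destruct Near as [d [Hd [Hd2 Near]]].
  assert (Cont : forall z, s < z < s + d -> rl z = rr z /\ m z ^ 2 <> c ^ 2 * rl z ^ 2).
  { intros z Hz. destruct (Near z Hz) as [N1 N2].
    assert (0 < m z) by (apply Hm; lra).
    split; [symmetry; apply (flow_no_shock c eps m N); auto|].
    generalize (flow_rl_pos F z). intros.
    assert (0 < c * rl z) by nra.
    intro E2. assert (E3 : (m z - c * rl z) * (m z + c * rl z) = 0) by lra.
    apply Rmult_integral in E3. destruct E3; [|lra].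
    destruct Sg as [-> | ->]; lra. }
  assert (LC := flow_local_const c eps m N rl rr s (s + d) F Cont).
  assert (Val : forall z, s < z < s + d -> rl z = r /\ rr z = r).
  { intros z Hz.
    assert (rr s = rl z).
    { apply (flow_right_const s (s + d) _ F); [lra|].
      intros y Hy. rewrite <- (proj1 (Cont y Hy)). apply LC; assumption. }
    destruct (Cont z Hz) as [E1 _]. split; congruence. }
  assert (s + d <= s); [|lra].
  apply Hub. split; [lra|]. intros z Hz.
  destruct (Rlt_dec z s); [apply Es; lra|].
  destruct (Req_dec z s) as [->|]; [|apply Val; lra].
  split; [|exact Rs].
  apply (flow_left_const x1 s r F); [lra|apply Es].
Qed.

Lemma flow_continue_end (c eps : R) (m N rl rr : R -> R) (x1 x2 : R) :
  flow c eps m N rl rr -> 0 < c -> x1 < x2 ->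
  (forall x, x1 <= x < x2 -> 0 < m x) ->
  0 < eps * (c * rr x1 - m x1) ->
  rl x2 = rr x1 /\ m x2 = m x1 - eps * rr x1 * (x2 - x1).
Proof.
  intros F Hc H12 Hm H0.
  assert (K := flow_continue _ _ _ _ _ _ _ _ F Hc H12 Hm H0).
  split.
  - apply (flow_left_const x1 x2 _ F); [lra|]. apply K.
  - apply (flow_linear _ _ _ F); [lra|]. exact K.
Qed.

Lemma root_sonic (c m r : R) : 0 < r -> m ^ 2 / r + c ^ 2 * r = 2 * c * m -> m = c * r.
Proof.
  intros Hr E.
  assert (K : (m - c * r) ^ 2 = 0).
  { replace ((m - c * r) ^ 2) with (r * (m ^ 2 / r + c ^ 2 * r - 2 * c * m)) by (field; lra).
    rewrite E. ring. }
  nra.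
Qed.

Lemma sonic_root (c r : R) : 0 < r -> (c * r) ^ 2 / r + c ^ 2 * r = 2 * c * (c * r).
Proof. intros; field; lra. Qed.

(** There [rho = m / c], so that [m' = - m / c]. *)
Lemma flow_sonic (c : R) (m N rl rr : R -> R) (a b : R) :
  flow c 1 m N rl rr -> 0 < c -> a <= b ->
  (forall z, a < z < b -> N z = 2 * c * m z) ->
  m b = m a * exp (- (b - a) / c).
Proof.
  intros F Hc Hab H.
  assert (Root : forall r z, 0 < r -> m z ^ 2 / r + c ^ 2 * r = 2 * c * m z -> r = m z / c).
  { intros r z Hr E. rewrite (root_sonic c (m z) r Hr E). field. lra. }
  assert (D : forall z, a < z < b -> is_derive m z (- (m z / c))).
  { intros z Hz.
    assert (E1 : rl z = m z / c).
    { apply Root; [apply (flow_rl_pos F)|].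
      rewrite <- (flow_Nl F). auto. }
    assert (E2 : rr z = m z / c).
    { apply Root; [apply (flow_rr_pos F)|].
      rewrite <- (flow_Nr F). auto. }
    rewrite <- E1. replace (- rl z) with (- (1) * rl z) by ring.
    apply (flow_dm F). congruence. }
  destruct (MVT_gen (fun z => m z * exp ((z - a) / c)) a b (fun _ => 0)) as [z [_ Hz]].
  - rewrite Rmin_left, Rmax_right by lra. intros z Hz. evar_last.
    + apply (is_derive_mult m (fun z => exp ((z - a) / c)) z (- (m z / c)) (exp ((z - a) / c) / c));
        [apply D, Hz| |intros; apply Rmult_comm].
      auto_derive; [trivial|unfold Rminus, Rdiv; ring].
    + unfold plus, mult; simpl. field. lra.
  - intros z _. apply continuity_pt_filterlim.
    apply (continuous_Rmult m (fun z => exp ((z - a) / c))); [apply (flow_cm F)|].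
    apply (ex_derive_continuous (fun z => exp ((z - a) / c))). auto_derive. trivial.
  - replace ((a - a) / c) with 0 in Hz by (field; lra). rewrite exp_0 in Hz.
    replace (m a) with (m b * exp ((b - a) / c)) by lra.
    rewrite Rmult_assoc, <- exp_plus.
    replace ((b - a) / c + - (b - a) / c) with 0 by (field; lra).
    rewrite exp_0. ring.
Qed.

(** The velocity lost through a 1-wave, in units of [c], as a function of the logarithm of the
    density ratio [s]: [ln s] through a rarefaction, and [sqrt s - / sqrt s], a hyperbolic
    sine of the logarithm, through a shock. The maximum selects the right one. *)
Definition u_drop (y : R) : R := Rmax y (exp (y / 2) - exp (- (y / 2))).
(** The velocity on the 1-wave curve of the left state with density [r0] and velocity [u]. *)
Definition wave_u (c u r0 r : R) : R := u - c * u_drop (ln (r / r0)).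

Lemma sinh_slope (a b : R) : a <= b ->
  b - a <= (exp (b / 2) - exp (- (b / 2))) - (exp (a / 2) - exp (- (a / 2))).
Proof.
  intros Hab.
  destruct (MVT_gen (fun y => exp (y / 2) - exp (- (y / 2)) - y) a b
    (fun y => (exp (y / 2) + exp (- (y / 2))) / 2 - 1)) as [z [_ Hz]].
  - intros z _. auto_derive; [trivial|unfold Rdiv; field].
  - intros z _. apply continuity_pt_filterlim.
    apply (ex_derive_continuous (fun y => exp (y / 2) - exp (- (y / 2)) - y)). auto_derive. trivial.
  - assert (0 <= (exp (z / 2) + exp (- (z / 2))) / 2 - 1).
    { rewrite exp_Ropp. assert (P := exp_pos (z / 2)). set (t := exp (z / 2)) in *.
      replace ((t + / t) / 2 - 1) with ((t - 1) ^ 2 / (2 * t)) by (field; lra).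
      apply Rdiv_le_0_compat; [apply pow2_ge_0|lra]. }
    nra.
Qed.

Lemma exp_half_diff (y : R) : 0 <= y -> y <= exp (y / 2) - exp (- (y / 2)).
Proof.
  intros Hy. assert (K := sinh_slope 0 y Hy).
  replace (- (0 / 2)) with (0 / 2) in K by field. lra.
Qed.

Lemma u_drop_neg (y : R) : y <= 0 -> u_drop y = y.
Proof.
  intros Hy. apply Rmax_left.
  assert (K := exp_half_diff (- y) ltac:(lra)).
  replace (- y / 2) with (- (y / 2)) in K by field. rewrite Ropp_involutive in K. lra.
Qed.

Lemma u_drop_pos (y : R) : 0 <= y -> u_drop y = exp (y / 2) - exp (- (y / 2)).
Proof. intros Hy. apply Rmax_right, exp_half_diff, Hy. Qed.

Lemma wave_u_base (c u r0 : R) : 0 < r0 -> wave_u c u r0 r0 = u.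
Proof.
  intros H. unfold wave_u. replace (r0 / r0) with 1 by (field; lra).
  rewrite ln_1, u_drop_neg; lra.
Qed.

(** The states of a centred 1-fan, where the velocity increases as fast as the speed of the
    ray. *)
Lemma wave_u_exp (c u r0 y : R) : 0 < c -> 0 < r0 -> 0 <= y ->
  wave_u c u r0 (r0 * exp (- y / c)) = u + y.
Proof.
  intros Hc Hr Hy. unfold wave_u.
  replace (r0 * exp (- y / c) / r0) with (exp (- y / c)) by (field; lra).
  rewrite ln_exp, u_drop_neg; [field; lra|].
  apply Rle_div_l; lra.
Qed.

(** The states behind 1-shocks; [u - c * s] is the speed of the shock. *)
Lemma wave_u_sqr (c u r0 s : R) : 0 < r0 -> 1 <= s ->
  wave_u c u r0 (r0 * s ^ 2) = u - c * (s - / s).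
Proof.
  intros Hr Hs. unfold wave_u.
  replace (r0 * s ^ 2 / r0) with (s * s) by (field; lra).
  rewrite ln_mult by lra.
  assert (0 <= ln s) by (rewrite <- ln_1; apply ln_le; lra).
  rewrite u_drop_pos by lra.
  replace ((ln s + ln s) / 2) with (ln s) by field.
  rewrite exp_Ropp, exp_ln by lra. reflexivity.
Qed.

Lemma u_drop_slope (x y : R) : x <= y -> y - x <= u_drop y - u_drop x.
Proof.
  assert (Neg : forall x y, x <= y -> y <= 0 -> y - x <= u_drop y - u_drop x).
  { intros a b H1 H2. rewrite !u_drop_neg; lra. }
  assert (Pos : forall x y, 0 <= x -> x <= y -> y - x <= u_drop y - u_drop x).
  { intros a b H1 H2. rewrite !u_drop_pos by lra. apply sinh_slope, H2. }
  intros H. destruct (Rle_dec y 0); [apply Neg; lra|].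
  destruct (Rle_dec 0 x); [apply Pos; lra|].
  generalize (Neg x 0 ltac:(lra) ltac:(lra)) (Pos 0 y ltac:(lra) ltac:(lra)). lra.
Qed.

Lemma ln_ge_1_minus_inv (x : R) : 0 < x -> 1 - / x <= ln x.
Proof.
  intros H. assert (K := exp_ineq1_le (ln (/ x))).
  rewrite exp_ln in K by (apply Rinv_0_lt_compat; lra).
  rewrite ln_Rinv in K by lra. lra.
Qed.

Lemma wave_u_decr (c u r0 r1 r2 : R) : 0 < c -> 0 < r0 -> 0 < r1 -> r1 <= r2 ->
  c * ln (r2 / r1) <= wave_u c u r0 r1 - wave_u c u r0 r2.
Proof.
  intros Hc H0 H1 H12. unfold wave_u.
  assert (E : ln (r2 / r1) = ln (r2 / r0) - ln (r1 / r0)).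
  { rewrite !ln_div by lra. ring. }
  assert (0 <= ln (r2 / r1)).
  { rewrite <- ln_1. apply ln_le; [lra|]. apply Rle_div_r; lra. }
  assert (K := u_drop_slope (ln (r1 / r0)) (ln (r2 / r0)) ltac:(lra)).
  rewrite E. nra.
Qed.

Lemma wave_u_antitone (c u r0 r1 r2 : R) : 0 < c -> 0 < r0 -> 0 < r1 -> r1 <= r2 ->
  wave_u c u r0 r2 <= wave_u c u r0 r1.
Proof.
  intros Hc H0 H1 H12. assert (K := wave_u_decr c u r0 r1 r2 Hc H0 H1 H12).
  assert (0 <= ln (r2 / r1)).
  { rewrite <- ln_1. apply ln_le; [lra|]. apply Rle_div_r; lra. }
  nra.
Qed.

(** * States with positive mass flux *)

(** [m x + x * rl x] is the momentum on the left of x. *)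
Definition far_left (m rl rr : R -> R) (r0 u0 : R) : Prop :=
  forall e, 0 < e -> exists X, forall x, x < X ->
    Rabs (rl x - r0) < e /\ Rabs (rr x - r0) < e /\
    Rabs (m x + x * rl x - r0 * u0) < e.

Lemma zero_at_lub (f : R -> R) (E : R -> Prop) (b : R) :
  continuous f b -> is_lub E b -> (forall y, E y -> f y = 0) -> f b = 0.
Proof.
  intros Cf [Hub Hlub] Z. apply NNPP; intro Hn.
  destruct (proj1 (continuous_eps _ _) Cf _ (Rabs_pos_lt _ Hn)) as [d [Hd K]].
  assert (b <= b - d); [|lra].
  apply Hlub. intros y Hy. apply Rnot_lt_le; intro.
  assert (y <= b) by (apply Hub, Hy).
  assert (Kz := K y ltac:(rewrite Rabs_left1; lra)).
  rewrite (Z y Hy), Rminus_0_l, Rabs_Ropp in Kz. lra.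
Qed.

(** [N = 2 c m] characterises the sonic states, as [N - 2 c m] is [rho] times the square of [m
    / rho - c]. *)
Lemma flow_sonic_lub {c eps : R} {m N rl rr : R -> R} (E : R -> Prop) (b : R) :
  flow c eps m N rl rr -> is_lub E b -> (forall y, E y -> N y = 2 * c * m y) ->
  N b = 2 * c * m b.
Proof.
  intros F Hb Z. apply Rminus_diag_uniq.
  apply (zero_at_lub (fun y => N y - 2 * c * m y) E b); [|exact Hb|].
  - apply continuous_Rminus.
    + apply (ex_derive_continuous N). eexists. apply (flow_dN F).
    + apply continuous_Rmult; [apply continuous_const|apply (flow_cm F)].
  - intros y Hy. apply Rminus_diag_eq, Z, Hy.
Qed.

Lemma far_supersonic (c : R) (m rl rr : R -> R) (r0 u0 : R) :
  0 < c -> 0 < r0 -> far_left m rl rr r0 u0 ->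
  exists X, forall x, x < X -> c * rr x < m x.
Proof.
  intros Hc Hr H.
  destruct (H (Rmin 1 (r0 / 2))) as [X K]; [apply Rmin_pos; lra|].
  exists (Rmin X (Rmin 0 (- (2 / r0) * (2 * c * r0 + 1 - r0 * u0)))).
  intros x Hx.
  assert (L1 := Rmin_l X (Rmin 0 (- (2 / r0) * (2 * c * r0 + 1 - r0 * u0)))).
  assert (L2 := Rmin_r X (Rmin 0 (- (2 / r0) * (2 * c * r0 + 1 - r0 * u0)))).
  assert (L3 := Rmin_l 0 (- (2 / r0) * (2 * c * r0 + 1 - r0 * u0))).
  assert (L4 := Rmin_r 0 (- (2 / r0) * (2 * c * r0 + 1 - r0 * u0))).
  assert (L5 := Rmin_l 1 (r0 / 2)). assert (L6 := Rmin_r 1 (r0 / 2)).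
  destruct (K x ltac:(lra)) as [K1 [K2 K3]].
  apply Rabs_def2 in K1. apply Rabs_def2 in K2. apply Rabs_def2 in K3.
  assert (c * rr x <= c * (2 * r0)) by (apply Rmult_le_compat_l; lra).
  assert (- x * (r0 / 2) <= - x * rl x) by (apply Rmult_le_compat_l; lra).
  assert (x * (r0 / 2) < - (2 * c * r0 + 1 - r0 * u0)).
  { replace (- (2 * c * r0 + 1 - r0 * u0))
      with (- (2 / r0) * (2 * c * r0 + 1 - r0 * u0) * (r0 / 2)) by (field; lra).
    apply Rmult_lt_compat_r; lra. }
  lra.
Qed.

Lemma flow_m_pos_before (c : R) (m N rl rr : R -> R) (x y : R) :
  flow c 1 m N rl rr -> x <= y -> 0 <= m y -> x <> y \/ 0 < m y -> 0 < m x.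
Proof.
  intros F Hxy Hm Hs. destruct (Req_dec x y) as [->|]; [lra|].
  assert (K := flow_mono F x y ltac:(lra)). lra.
Qed.

(** For the reversed flow, [flow_continue] carries the state back to minus infinity, where it
    must agree with the datum. *)
Lemma supersonic_before (c : R) (m N rl rr : R -> R) (r0 u0 x : R) :
  0 < c -> flow c 1 m N rl rr -> far_left m rl rr r0 u0 ->
  0 < m x -> c * rl x < m x ->
  rl x = r0 /\ m x = r0 * (u0 - x) /\
  forall z, z < x -> rl z = r0 /\ rr z = r0.
Proof.
  intros Hc F Far Hm Hs.
  assert (C : forall z, z < x -> rl z = rl x /\ rr z = rl x).
  { intros z Hz.
    assert (K := flow_continue _ _ _ _ _ _ (- x) (- z + 1) (flow_reverse F) Hc).
    simpl in K. rewrite Ropp_involutive in K.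
    destruct (K ltac:(lra)) with (z := - z) as [K1 K2].
    - intros y Hy. apply (flow_m_pos_before c m N rl rr (- y) x); auto; lra.
    - lra.
    - lra.
    - rewrite Ropp_involutive in *. auto. }
  assert (E : rl x = r0).
  { apply cond_eq. intros e He. destruct (Far e He) as [X K].
    set (z := Rmin (x - 1) (X - 1)).
    assert (z <= x - 1) by apply Rmin_l. assert (z <= X - 1) by apply Rmin_r.
    destruct (K z ltac:(lra)) as [K1 _]. destruct (C z ltac:(lra)) as [C1 _]. congruence. }
  split; [exact E|split].
  - apply cond_eq. intros e He. destruct (Far e He) as [X K].
    set (z := Rmin (x - 1) (X - 1)).
    assert (z <= x - 1) by apply Rmin_l. assert (z <= X - 1) by apply Rmin_r.
    destruct (K z ltac:(lra)) as [_ [_ K1]].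
    assert (L := flow_linear z x r0 F ltac:(lra)).
    rewrite L.
    + rewrite (proj1 (C z ltac:(lra))), E in K1.
      replace (m z - 1 * r0 * (x - z) - r0 * (u0 - x)) with (m z + z * r0 - r0 * u0) by ring.
      exact K1.
    + intros y Hy. rewrite <- E. apply C; lra.
  - intros z Hz. rewrite <- E. apply C, Hz.
Qed.

(** Let [a] be the supremum of the supersonic speeds; before [a] the state is the datum. From
    [a] on no state is supersonic. Either a shock at [a] leads to a subsonic state, which
    persists; or [a] is sonic, the sonic states form a centred fan over an interval [[a, b]],
    and after [b] the state is constant. *)
Lemma on_wave_curve (c : R) (m N rl rr : R -> R) (r0 u0 x : R) :
  0 < c -> 0 < r0 -> flow c 1 m N rl rr -> far_left m rl rr r0 u0 ->
  0 < m x ->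
  m x = rl x * (wave_u c u0 r0 (rl x) - x) /\ (u0 - c <= x -> m x <= c * rl x).
Proof.
  intros Hc Hr F Far Hm.
  assert (Pl := flow_rl_pos F). assert (Pr := flow_rr_pos F).
  set (A := fun y => 0 < m y /\ c * rr y < m y).
  assert (rl_le : forall y, 0 < m y -> rl y <= rr y).
  { intros y Hy. assert (E := flow_entropy F y). nra. }
  assert (HA : forall y, A y -> rl y = r0 /\ m y = r0 * (u0 - y) /\ y < u0 - c /\
                 forall z, z < y -> rl z = r0 /\ rr z = r0).
  { intros y [Hy1 Hy2].
    assert (c * rl y < m y).
    { apply Rle_lt_trans with (c * rr y); [apply Rmult_le_compat_l; [lra|auto]|exact Hy2]. }
    destruct (supersonic_before c m N rl rr r0 u0 y) as [E1 [E2 E3]]; auto.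
    repeat split; try tauto; [|apply (E3 z H0)|apply (E3 z H0)].
    rewrite E1, E2 in H. nra. }
  destruct (far_supersonic c m rl rr r0 u0 Hc Hr Far) as [X HX].
  assert (HAX : forall y, y < X -> A y).
  { intros y Hy. specialize (HX y Hy). split; [|exact HX]. generalize (Pr y). nra. }
  destruct (completeness A) as [a [Hub Hlub]].
  { exists (u0 - c). intros y Hy. apply HA in Hy. lra. }
  { exists (X - 1). apply HAX. lra. }
  assert (Ha : a <= u0 - c) by (apply Hlub; intros y Hy; apply HA in Hy; lra).
  assert (Before : forall z, z < a -> A z /\ rl z = r0 /\ rr z = r0 /\ m z = r0 * (u0 - z)).
  { intros z Hz.
    assert (HH : exists y, A y /\ z < y).
    { apply NNPP; intro No. assert (a <= z); [|lra]. apply Hlub. intros y Hy.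
      apply Rnot_lt_le; intro. apply No. exists y; auto. }
    destruct HH as [y [Hy Hzy]]. destruct (HA y Hy) as [_ [_ [Hyc E3]]].
    destruct (E3 z Hzy) as [E4 E5].
    assert (Em : m z = r0 * (u0 - z)).
    { destruct (HA y Hy) as [_ [E6 _]].
      assert (L := flow_linear z y r0 F ltac:(lra)).
      rewrite L in E6; [lra|]. intros t Ht. apply E3; lra. }
    split; [|auto]. split; [rewrite Em; nra|]. rewrite E5, Em. nra. }
  assert (Hla : rl a = r0).
  { apply (flow_left_const (a - 1) a _ F); [lra|]. intros z Hz. apply Before; lra. }
  assert (Hma : m a = r0 * (u0 - a)).
  { assert (L := flow_linear (a - 1) a r0 F ltac:(lra)).
    rewrite L; [rewrite (proj2 (proj2 (proj2 (Before (a - 1) ltac:(lra))))); ring|].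
    intros z Hz. destruct (Before z ltac:(lra)) as [_ [? [? _]]]. auto. }
  assert (Hma' : c * r0 <= m a) by (rewrite Hma; nra).
  destruct (Rtotal_order x a) as [Hxa|[->|Hxa]].
  { destruct (Before x Hxa) as [_ [-> [_ ->]]]. rewrite wave_u_base by lra.
    split; [reflexivity|lra]. }
  { rewrite Hla, Hma, wave_u_base by lra. split; [reflexivity|]. intros. nra. }
  assert (NotA : forall y, a <= y -> 0 < m y -> m y <= c * rr y).
  { intros y Hy Hmy. apply Rnot_lt_le; intro Hn.
    destruct (Req_dec y a) as [->|]; [|assert (y <= a) by (apply Hub; split; auto); lra].
    (* At a itself: being supersonic would persist a little to the right of a. *)
    set (g := m a - c * rr a).
    assert (Hg : 0 < g / (4 * c)) by (apply Rdiv_lt_0_compat; unfold g; lra).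
    destruct (flow_lim_r F a _ Hg) as [d1 [Hd1 K1]].
    destruct (proj1 (continuous_eps _ _) (flow_cm F a) (Rmin (g / 4) (m a))) as [d2 [Hd2 K2]].
    { apply Rmin_pos; unfold g; lra. }
    set (z := a + Rmin d1 d2 / 2).
    assert (0 < Rmin d1 d2) by (apply Rmin_pos; lra).
    assert (L1 := Rmin_l d1 d2). assert (L2 := Rmin_r d1 d2).
    destruct (K1 z) as [_ B1]; [unfold z; lra|].
    assert (B2 : Rabs (m z - m a) < Rmin (g / 4) (m a)).
    { apply K2. unfold z. rewrite Rabs_pos_eq; lra. }
    assert (L3 := Rmin_l (g / 4) (m a)). assert (L4 := Rmin_r (g / 4) (m a)).
    apply Rabs_def2 in B1. apply Rabs_def2 in B2.
    assert (c * (rr z - rr a) < g / 4).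
    { replace (g / 4) with (c * (g / (4 * c))) by (field; lra). apply Rmult_lt_compat_l; lra. }
    assert (z <= a); [|unfold z in *; lra].
    apply Hub. split; unfold g in *; lra. }
  assert (Mpos : forall y, y <= x -> 0 < m y).
  { intros y Hy. apply (flow_m_pos_before c m N rl rr y x); auto; lra. }
  assert (NotAl : forall y, a < y <= x -> m y <= c * rl y).
  { intros y Hy. apply Rnot_lt_le; intro Hn.
    destruct (supersonic_before c m N rl rr r0 u0 y) as [E1 [E2 E3]]; auto.
    { apply Mpos; lra. }
    set (z := (a + y) / 2).
    assert (c * rr z < m z).
    { rewrite (proj2 (E3 z ltac:(unfold z; lra))).
      assert (K := flow_mono F z y ltac:(unfold z; lra)).
      rewrite E1 in Hn. lra. }
    assert (m z <= c * rr z); [|lra].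
    apply NotA; [unfold z; lra|]. apply Mpos; unfold z; lra. }
  split; [|intros _; apply NotAl; lra].
  destruct (Rle_lt_or_eq_dec _ _ (NotA a ltac:(lra) (Mpos a ltac:(lra)))) as [Sh|So].
  (* A shock at a. With s = m a / (c r0), the relation m^2 = c^2 r0 r gives r = r0 s^2 and
     a = u0 - c s. *)
  - destruct (flow_continue_end c 1 m N rl rr a x) as [E1 E2]; auto; [intros; apply Mpos; lra|lra|].
    rewrite E1. set (r := rr a) in *.
    assert (P := Pr a). fold r in P.
    assert (RH : m a ^ 2 = c ^ 2 * (r0 * r)).
    { assert (E3 := flow_Nl F a). rewrite (flow_Nr F a), Hla in E3.
      fold r in E3.
      destruct (equal_N_product c (m a) r0 r Hr P (eq_sym E3)) as [E4|E4]; [|exact E4].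
      subst r. nra. }
    set (s := m a / (c * r0)).
    assert (Hs : 1 <= s) by (apply Rle_div_r; nra).
    assert (Er : r = r0 * s ^ 2).
    { unfold s. replace (r0 * (m a / (c * r0)) ^ 2) with (m a ^ 2 / (c ^ 2 * r0)) by (field; lra).
      rewrite RH. field; lra. }
    assert (Es : m a = c * r0 * s) by (unfold s; field; lra).
    rewrite E2, Er, wave_u_sqr by lra.
    assert (Ea : a = u0 - c * s).
    { apply Rmult_eq_reg_l with r0; lra. }
    rewrite Es, Ea. field. lra.
  (* a is sonic: it is the head of a centred fan, which may be reduced to a point. *)
  - assert (Na : N a = 2 * c * m a).
    { rewrite (flow_Nr F a), So. apply sonic_root, Pr. }
    assert (Ha2 : m a = c * r0).
    { apply root_sonic; [lra|]. rewrite <- Hla, <- (flow_Nl F a). exact Na. }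
    assert (Hau : a = u0 - c).
    { apply Rmult_eq_reg_l with r0; lra. }
    set (Z := fun y => a <= y <= x /\ N y = 2 * c * m y).
    destruct (completeness Z) as [b [Hubz Hlubz]].
    { exists x. intros y Hy. apply Hy. }
    { exists a. split; [lra|exact Na]. }
    assert (Hab : a <= b) by (apply Hubz; split; [lra|exact Na]).
    assert (Hbx : b <= x) by (apply Hlubz; intros y Hy; apply Hy).
    assert (Nb : N b = 2 * c * m b).
    { apply (flow_sonic_lub Z b F); [split; assumption|]. intros y Hy; apply Hy. }
    assert (Sub : forall y, a <= y <= x -> N y <> 2 * c * m y -> m y < c * rr y).
    { intros y Hy Hn. destruct (Rle_lt_or_eq_dec _ _ (NotA y ltac:(lra) (Mpos y ltac:(lra)))) as [|E]; [assumption|].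
      exfalso; apply Hn. rewrite (flow_Nr F y), E. apply sonic_root, Pr. }
    assert (Fan : forall z, a < z < b -> N z = 2 * c * m z).
    { intros z Hz. apply NNPP; intro Hn.
      assert (S1 := Sub z ltac:(lra) Hn).
      destruct (flow_continue_end c 1 m N rl rr z b) as [E1 E2]; auto; try lra; [intros; apply Mpos; lra|].
      assert (m b = c * rl b).
      { apply root_sonic; [apply Pl|]. rewrite <- (flow_Nl F b). exact Nb. }
      rewrite E1, E2 in H. generalize (Pr z). nra. }
    assert (Eb : m b = m a * exp (- (b - a) / c)) by (apply (flow_sonic c m N rl rr); auto).
    assert (Rb : rl x = m b / c /\ m x = m b - m b / c * (x - b)).
    { destruct (Req_dec b x) as [->|Hbx'].
      - split; [|ring].
        assert (m x = c * rl x).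
        { apply root_sonic; [apply Pl|]. rewrite <- (flow_Nl F x). exact Nb. }
        rewrite H. field; lra.
      - assert (Cst : forall y, b < y < x -> rr y = rl x).
        { intros y Hy.
          assert (Hn : N y <> 2 * c * m y).
          { intro E. assert (y <= b) by (apply Hubz; split; [lra|exact E]). lra. }
          assert (S1 := Sub y ltac:(lra) Hn).
          destruct (flow_continue_end c 1 m N rl rr y x) as [E1 E2]; auto; try lra; intros; apply Mpos; lra. }
        assert (Rb : rr b = rl x) by (apply (flow_right_const b x _ F); [lra|exact Cst]).
        assert (Eb2 : m b = c * rr b).
        { apply root_sonic; [apply Pr|]. rewrite <- (flow_Nr F b). exact Nb. }
        assert (Ex : rl x = m b / c) by (rewrite Eb2, Rb; field; lra).
        split; [exact Ex|]. rewrite <- Ex.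
        replace (m b - rl x * (x - b)) with (m b - 1 * rl x * (x - b)) by ring.
        apply (flow_linear _ _ _ F); [lra|].
        intros z Hz. split; [|apply Cst, Hz].
        apply (flow_left_const b z _ F); [lra|].
        intros t Ht.
        assert (Hn : N t <> 2 * c * m t).
        { intro E. assert (t <= b) by (apply Hubz; split; [lra|exact E]). lra. }
        rewrite <- (Cst t ltac:(lra)). symmetry. apply (flow_no_shock c 1 m N); auto; [apply Mpos; lra|].
        assert (m t <= c * rl t) by (apply NotAl; lra).
        assert (m t <> c * rl t).
        { intro E. apply Hn. rewrite (flow_Nl F t), E. apply sonic_root, Pl. }
        lra. }
    destruct Rb as [R1 R2].
    assert (R3 : rl x = r0 * exp (- (b - a) / c)) by (rewrite R1, Eb, Ha2; field; lra).
    rewrite R3 at 2. rewrite wave_u_exp by lra. rewrite R2, <- R1.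
    replace (m b) with (c * rl x) by (rewrite R1; field; lra).
    rewrite Hau. ring.
Qed.

(** * The state on the left of a ray *)

(** For [m = 0] the quadratic for the density has only one positive root, so there is no jump.
    Just before, the flow is subsonic, hence constant, and on the 1-wave curve. *)
Lemma stagnation_state (c : R) (m N rl rr : R -> R) (r0 u0 x : R) :
  0 < c -> 0 < r0 -> flow c 1 m N rl rr -> far_left m rl rr r0 u0 ->
  m x = 0 -> rr x = rl x /\ wave_u c u0 r0 (rl x) = x.
Proof.
  intros Hc Hr F Far Hm.
  assert (Pl := flow_rl_pos F x). assert (Pr := flow_rr_pos F x).
  split.
  { assert (E := flow_Nl F x). rewrite (flow_Nr F x), Hm in E.
    replace (0 ^ 2 / rr x) with 0 in E by (field; lra).
    replace (0 ^ 2 / rl x) with 0 in E by (field; lra).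
    assert (0 < c ^ 2) by nra. apply Rmult_eq_reg_l with (c ^ 2); lra. }
  assert (Hy : exists y, y < x /\ 0 < m y /\ m y < c * rr y).
  { destruct (flow_lim_l F x (rl x / 2) ltac:(lra)) as [d1 [Hd1 K1]].
    destruct (proj1 (continuous_eps _ _) (flow_cm F x) (c * (rl x / 2)) ltac:(nra))
      as [d2 [Hd2 K2]].
    assert (0 < Rmin d1 d2) by (apply Rmin_pos; lra).
    assert (L1 := Rmin_l d1 d2). assert (L2 := Rmin_r d1 d2).
    exists (x - Rmin d1 d2 / 2).
    destruct (K1 (x - Rmin d1 d2 / 2) ltac:(lra)) as [_ B1].
    specialize (K2 (x - Rmin d1 d2 / 2) ltac:(rewrite Rabs_left1; lra)).
    rewrite Hm, Rminus_0_r in K2. apply Rabs_def2 in B1. apply Rabs_def2 in K2.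
    split; [lra|]. split.
    - apply (flow_m_pos_before c m N rl rr _ x); auto; lra.
    - apply Rlt_le_trans with (c * (rl x / 2)); [lra|]. apply Rmult_le_compat_l; lra. }
  destruct Hy as [y [Hyx [Hy1 Hy2]]].
  assert (Mp : forall z, y <= z < x -> 0 < m z).
  { intros z Hz. apply (flow_m_pos_before c m N rl rr z x); auto; lra. }
  destruct (flow_continue_end c 1 m N rl rr y x) as [E1 E2]; auto; [lra|].
  set (z := (y + x) / 2).
  assert (Hz : y < z < x) by (unfold z; lra).
  assert (C := flow_continue c 1 m N rl rr y x F Hc Hyx Mp ltac:(lra)).
  assert (L := flow_linear z x (rr y) F ltac:(lra)).
  destruct (on_wave_curve c m N rl rr r0 u0 z) as [W _]; auto; [apply Mp; lra|].
  rewrite (proj1 (C z Hz)) in W.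
  rewrite E1. rewrite Hm in L. generalize (flow_rr_pos F y). intros P.
  assert (Lz : 0 = m z - 1 * rr y * (x - z)) by (apply L; intros; apply C; lra).
  apply Rmult_eq_reg_l with (rr y); lra.
Qed.

(** While [m] is positive the state is on the 1-wave curve. If [m v < 0], the mass flux
    vanishes at some [x0 < v], and the reflected flow is followed from [v] to [x0]. A subsonic
    state at [v] is the one at [x0]. A sonic one belongs to a 2-fan that starts at speed [x0 +
    c] from the state at [x0], so that [x0 + c <= v] and the density at [v] is at least that
    at [x0]; as [wave_u] is decreasing, its value there is at most [x0 <= v - c]. *)
Lemma left_state (c : R) (m N rl rr : R -> R) (r0 u0 v : R) :
  0 < c -> 0 < r0 -> flow c 1 m N rl rr -> far_left m rl rr r0 u0 ->
  u0 - c <= v ->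
  (0 <= m v -> m v <= c * rl v) /\
  (- (c * rl v) <= m v ->
     wave_u c u0 r0 (rl v) - v <= c /\
     m v = rl v * Rmax (wave_u c u0 r0 (rl v) - v) (- c)).
Proof.
  intros Hc Hr F Far Hv.
  assert (Pl := flow_rl_pos F v).
  destruct (Rtotal_order (m v) 0) as [Hm|[Hm|Hm]].
  - split; [lra|]. intros Hsub.
    assert (HX : exists x0, x0 < v /\ m x0 = 0).
    { destruct (far_supersonic c m rl rr r0 u0 Hc Hr Far) as [X HX].
      set (y := Rmin (X - 1) (v - 1)).
      assert (y <= X - 1) by apply Rmin_l. assert (y <= v - 1) by apply Rmin_r.
      assert (0 < m y).
      { generalize (HX y ltac:(lra)) (flow_rr_pos F y). nra. }
      destruct (IVT_gen m y v 0) as [x0 [Hx0 E]].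
      - intros z. apply continuity_pt_filterlim, (flow_cm F).
      - rewrite Rmin_right, Rmax_left by lra. lra.
      - rewrite Rmin_left, Rmax_right in Hx0 by lra. exists x0. split; [|exact E].
        destruct (Req_dec x0 v) as [->|]; lra. }
    destruct HX as [x0 [Hx0 Em0]].
    destruct (stagnation_state c m N rl rr r0 u0 x0) as [E0 K0]; auto.
    set (r := rl x0) in *.
    assert (G := flow_mirror F).
    set (m' := fun x => - m (- x)) in *. set (N' := fun x => N (- x)) in *.
    set (rl' := fun x => rr (- x)) in *. set (rr' := fun x => rl (- x)) in *.
    assert (Mp : forall z, - v <= z < - x0 -> 0 < m' z).
    { intros z Hz. unfold m'. assert (K := flow_mono F x0 (- z) ltac:(lra)). lra. }
    assert (M0 : m' (- x0) = 0) by (unfold m'; rewrite Ropp_involutive; lra).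
    assert (Mv : m' (- v) = - m v) by (unfold m'; rewrite Ropp_involutive; lra).
    assert (Rv : rr' (- v) = rl v) by (unfold rr'; rewrite Ropp_involutive; reflexivity).
    assert (R0 : rl' (- x0) = r) by (unfold rl'; rewrite Ropp_involutive; exact E0).
    assert (Pr := flow_rr_pos F x0). rewrite E0 in Pr.
    destruct (Rle_lt_or_eq_dec _ _ Hsub) as [Hs|Hs].
    + assert (Sv : 0 < 1 * (c * rr' (- v) - m' (- v))) by (rewrite Rv, Mv; lra).
      destruct (flow_continue_end c 1 m' N' rl' rr' (- v) (- x0)) as [E1 E2]; auto; try lra.
      rewrite Rv, R0 in E1. rewrite Rv, M0, Mv, <- E1 in E2.
      rewrite <- E1, K0.
      assert (x0 - v > - c) by nra.
      rewrite Rmax_left by lra. lra.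
    + set (Z := fun y => - v <= y <= - x0 /\ N' y = 2 * c * m' y).
      assert (Nv : N' (- v) = 2 * c * m' (- v)).
      { rewrite (flow_Nr G), Rv, Mv, <- Hs.
        rewrite Ropp_involutive. apply sonic_root, Pl. }
      destruct (completeness Z) as [b [Hub Hlub]].
      { exists (- x0). intros y Hy. apply Hy. }
      { exists (- v). split; [lra|exact Nv]. }
      assert (Hvb : - v <= b) by (apply Hub; split; [lra|exact Nv]).
      assert (Hbx : b <= - x0) by (apply Hlub; intros y Hy; apply Hy).
      assert (Nb : N' b = 2 * c * m' b).
      { apply (flow_sonic_lub Z b G); [split; assumption|]. intros y Hy; apply Hy. }
      assert (Hbx' : b < - x0).
      { destruct (Req_dec b (- x0)) as [E|]; [|lra].
        rewrite E, M0, (flow_Nl G), R0, M0 in Nb.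
        replace (0 ^ 2 / r) with 0 in Nb by (field; lra).
        assert (0 < c ^ 2 * r) by (apply Rmult_lt_0_compat; nra). lra. }
      (* A supersonic state of the reflected flow after b would extend back to v, which is
         sonic. *)
      assert (Sub : forall y, b < y < - x0 -> 0 < 1 * (c * rr' y - m' y)).
      { intros y Hy.
        assert (My : 0 < m' y) by (apply Mp; lra).
        assert (Py := flow_rr_pos G y).
        assert (Pyl := flow_rl_pos G y).
        assert (Hn : N' y <> 2 * c * m' y).
        { intro E. assert (y <= b) by (apply Hub; split; [lra|exact E]). lra. }
        destruct (Rtotal_order (c * rr' y) (m' y)) as [Q|[Q|Q]]; [exfalso| |lra].
        - assert (Ent := flow_entropy G y).
          assert (Lry : rl' y <= rr' y) by nra.
          assert (Ql : c * rl' y < m' y) by nra.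
          destruct (flow_continue_end c (- (1)) (fun x => m' (- x)) (fun x => N' (- x))
            (fun x => rr' (- x)) (fun x => rl' (- x)) (- y) v) as [E1 E2].
          + apply flow_reverse, G.
          + exact Hc.
          + lra.
          + intros z Hz. apply Mp; lra.
          + rewrite !Ropp_involutive. lra.
          + rewrite !Ropp_involutive in *. rewrite Rv in E1. rewrite Mv in E2. nra.
        - exfalso. apply Hn. rewrite (flow_Nr G y), <- Q.
          apply sonic_root, Py. }
      assert (Cst : forall z, b < z < - x0 -> rl' z = r /\ rr' z = r).
      { intros z Hz. set (y := (b + z) / 2).
        assert (Hy : b < y < - x0) by (unfold y; lra).
        assert (My : forall t, y <= t < - x0 -> 0 < m' t) by (intros; apply Mp; lra).
        destruct (flow_continue_end c 1 m' N' rl' rr' y (- x0)) as [E1 _]; auto; try lra.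
        rewrite R0 in E1. rewrite E1.
        apply (flow_continue c 1 m' N' rl' rr' y (- x0)); auto; unfold y in *; lra. }
      assert (Rb : rr' b = r).
      { apply (flow_right_const b (- x0) _ G); [lra|]. intros; apply Cst; auto. }
      assert (Mb : m' b = c * r).
      { rewrite <- Rb. apply root_sonic; [rewrite Rb; exact Pr|].
        rewrite <- (flow_Nr G). exact Nb. }
      assert (L := flow_linear b (- x0) r G ltac:(lra) Cst).
      rewrite M0, Mb in L.
      assert (Hlen : - x0 - b = c) by (apply Rmult_eq_reg_l with r; lra).
      assert (Hrr : r <= rl v).
      { assert (m' b <= m' (- v)).
        { destruct (Req_dec b (- v)) as [->|]; [lra|].
          assert (K := flow_mono G (- v) b ltac:(lra)). lra. }
        rewrite Mb, Mv, <- Hs in H. apply Rmult_le_reg_l with c; lra. }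
      assert (K := wave_u_antitone c u0 r0 r (rl v) Hc Hr Pr Hrr).
      rewrite Rmax_right by lra. lra.
  - destruct (stagnation_state c m N rl rr r0 u0 v) as [_ K]; auto.
    rewrite K, Rmax_left by lra. split; intros; [nra|]. lra.
  - destruct (on_wave_curve c m N rl rr r0 u0 v) as [W S]; auto.
    specialize (S Hv). split; [auto|]. intros _.
    assert (wave_u c u0 r0 (rl v) - v <= c) by nra.
    assert (0 <= wave_u c u0 r0 (rl v) - v) by nra.
    rewrite Rmax_left by lra. lra.
Qed.

(** * The physical entropy *)

Lemma C1_on_intro (P : R * R -> Prop) (f d1 d2 : R -> R -> R) :
  open P ->
  (forall x y, P (x, y) -> is_derive (fun s => f s y) x (d1 x y)) ->
  (forall x y, P (x, y) -> is_derive (fun s => f x s) y (d2 x y)) ->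
  (forall x y, P (x, y) -> continuous (fun z : R * R => d1 (fst z) (snd z)) (x, y)) ->
  (forall x y, P (x, y) -> continuous (fun z : R * R => d2 (fst z) (snd z)) (x, y)) ->
  C1_on P f.
Proof.
  intros HP H1 H2 H3 H4 x y Hxy.
  split; [eexists; apply H1, Hxy|split; [eexists; apply H2, Hxy|split]].
  - eapply continuous_ext_loc; [|apply H3, Hxy].
    generalize (HP (x, y) Hxy). apply filter_imp. intros [a b] Hab. simpl.
    symmetry. apply is_derive_unique, H1, Hab.
  - eapply continuous_ext_loc; [|apply H4, Hxy].
    generalize (HP (x, y) Hxy). apply filter_imp. intros [a b] Hab. simpl.
    symmetry. apply is_derive_unique, H2, Hab.
Qed.

(** The mechanical energy; its balance is enough to exclude expansion shocks. *)
Definition energy (c rho q : R) : R := q ^ 2 / (2 * rho) + c ^ 2 * (rho * ln rho).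
Definition energy_flux (c rho q : R) : R :=
  q ^ 3 / (2 * rho ^ 2) + c ^ 2 * (q * ln rho) + c ^ 2 * q.

Lemma quadratic_over_linear_convex (r s a b l : R) : 0 < r -> 0 < s -> 0 <= l <= 1 ->
  (l * a + (1 - l) * b) ^ 2 / (l * r + (1 - l) * s) <= l * (a ^ 2 / r) + (1 - l) * (b ^ 2 / s).
Proof.
  intros Hr Hs Hl.
  assert (X : 0 < l * r + (1 - l) * s).
  { destruct (Req_dec l 0) as [->|]; [lra|]. 
    assert (0 < l * r) by (apply Rmult_lt_0_compat; lra).
    assert (0 <= (1 - l) * s) by (apply Rmult_le_pos; lra). lra. }
  assert (E : l * (a ^ 2 / r) + (1 - l) * (b ^ 2 / s)
     - (l * a + (1 - l) * b) ^ 2 / (l * r + (1 - l) * s) =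
     l * (1 - l) * ((a * s - b * r) ^ 2 / (r * s * (l * r + (1 - l) * s)))) by (field; lra).
  assert (0 <= l * (1 - l) * ((a * s - b * r) ^ 2 / (r * s * (l * r + (1 - l) * s)))); [|lra].
  apply Rmult_le_pos; [nra|]. apply Rdiv_le_0_compat; [apply pow2_ge_0|].
  repeat apply Rmult_lt_0_compat; lra.
Qed.

Lemma xlnx_tangent (r x : R) : 0 < r -> 0 < x -> r * ln x + r - x <= r * ln r.
Proof.
  intros Hr Hx. assert (K := ln_ge_1_minus_inv (r / x) ltac:(apply Rdiv_lt_0_compat; lra)).
  rewrite ln_div in K by lra. replace (/ (r / x)) with (x / r) in K by (field; lra).
  assert (r * (1 - x / r) <= r * (ln r - ln x)) by (apply Rmult_le_compat_l; lra).
  replace (r * (1 - x / r)) with (r - x) in H by (field; lra). lra.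
Qed.

Lemma energy_pair (c : R) : entropy_pair c (energy c) (energy_flux c).
Proof.
  assert (d1e : forall x y, Omega (x, y) -> is_derive (fun s => energy c s y) x
      (- (y / x) ^ 2 / 2 + c ^ 2 * (ln x + 1))).
  { intros x y H. unfold Omega in H; simpl in H. unfold energy. auto_derive; [lra|field; lra]. }
  assert (d2e : forall x y, Omega (x, y) -> is_derive (fun s => energy c x s) y (y / x)).
  { intros x y H. unfold Omega in H; simpl in H. unfold energy. auto_derive; [trivial|field; lra]. }
  assert (d1f : forall x y, Omega (x, y) -> is_derive (fun s => energy_flux c s y) x
      (- (y / x) ^ 3 + c ^ 2 * (y / x))).
  { intros x y H. unfold Omega in H; simpl in H. unfold energy_flux.
    auto_derive; [repeat split; try lra; nra|field; lra]. }
  assert (d2f : forall x y, Omega (x, y) -> is_derive (fun s => energy_flux c x s) y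
      (3 / 2 * (y / x) ^ 2 + c ^ 2 * (ln x + 1))).
  { intros x y H. unfold Omega in H; simpl in H. unfold energy_flux.
    auto_derive; [trivial|field; lra]. }
  assert (Cu : forall x y, Omega (x, y) -> continuous (fun z : R * R => snd z / fst z) (x, y)).
  { intros x y H. unfold Omega in H; simpl in H.
    apply (continuous_quot (fun t => t)); [lra|apply continuous_id]. }
  assert (Cun : forall n x y, Omega (x, y) -> continuous (fun z : R * R => (snd z / fst z) ^ n) (x, y)).
  { intros n x y H. apply (continuous_comp (fun z : R * R => snd z / fst z) (fun t => t ^ n)).
    - apply Cu, H.
    - apply (ex_derive_continuous (fun t => t ^ n)). auto_derive. trivial. }
  assert (Cl : forall x y, Omega (x, y) -> continuous (fun z : R * R => c ^ 2 * (ln (fst z) + 1)) (x, y)).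
  { intros x y H. unfold Omega in H; simpl in H.
    apply (continuous_fst_comp (fun t => c ^ 2 * (ln t + 1))). simpl fst.
    apply (ex_derive_continuous (fun t => c ^ 2 * (ln t + 1))). auto_derive. lra. }
  split.
  - apply (C1_on_intro _ _ _ _ open_Omega d1e d2e); intros x y H.
    + apply continuous_Rplus; [|apply Cl, H].
      apply continuous_Rmult; [|apply continuous_const].
      apply continuous_Ropp, Cun, H.
    + apply Cu, H.
  - apply (C1_on_intro _ _ _ _ open_Omega d1f d2f); intros x y H.
    + apply continuous_Rplus.
      * apply continuous_Ropp, Cun, H.
      * apply continuous_Rmult; [apply continuous_const|apply Cu, H].
    + apply continuous_Rplus; [|apply Cl, H].
      apply continuous_Rmult; [apply continuous_const|apply Cun, H].
  - intros [r a] [s b] l Hr Hs Hl. unfold Omega in *; simpl in *. unfold energy.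
    set (x := l * r + (1 - l) * s).
    assert (Hx : 0 < x).
    { unfold x. destruct (Req_dec l 0) as [->|]; [lra|]. 
      assert (0 < l * r) by (apply Rmult_lt_0_compat; lra).
      assert (0 <= (1 - l) * s) by (apply Rmult_le_pos; lra). lra. }
    assert (K := quadratic_over_linear_convex r s a b l Hr Hs Hl). fold x in K.
    assert (T : x * ln x <= l * (r * ln r) + (1 - l) * (s * ln s)).
    { assert (l * (r * ln x + r - x) <= l * (r * ln r))
        by (apply Rmult_le_compat_l; [lra|apply xlnx_tangent; lra]).
      assert ((1 - l) * (s * ln x + s - x) <= (1 - l) * (s * ln s))
        by (apply Rmult_le_compat_l; [lra|apply xlnx_tangent; lra]).
      assert (E : x * ln x = l * (r * ln x + r - x) + (1 - l) * (s * ln x + s - x))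
        by (unfold x; ring).
      lra. }
    assert (c ^ 2 * (x * ln x) <= c ^ 2 * (l * (r * ln r) + (1 - l) * (s * ln s)))
      by (apply Rmult_le_compat_l; [apply pow2_ge_0|exact T]).
    replace ((l * a + (1 - l) * b) ^ 2 / (2 * x)) with ((l * a + (1 - l) * b) ^ 2 / x / 2) by (field; lra).
    replace (a ^ 2 / (2 * r)) with (a ^ 2 / r / 2) by (field; lra).
    replace (b ^ 2 / (2 * s)) with (b ^ 2 / s / 2) by (field; lra). lra.
  - intros r q Hr.
    assert (E1 : D1 (energy_flux c) r q = - (q / r) ^ 3 + c ^ 2 * (q / r))
      by apply is_derive_unique, d1f, Hr.
    assert (E2 : D2 (energy_flux c) r q = 3 / 2 * (q / r) ^ 2 + c ^ 2 * (ln r + 1))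
      by apply is_derive_unique, d2f, Hr.
    assert (E3 : D1 (energy c) r q = - (q / r) ^ 2 / 2 + c ^ 2 * (ln r + 1))
      by apply is_derive_unique, d1e, Hr.
    assert (E4 : D2 (energy c) r q = q / r) by apply is_derive_unique, d2e, Hr.
    rewrite E1, E2, E3, E4. split; field; lra.
Qed.

Lemma sinh_lt (t : R) : 1 < t -> ln t < (t - / t) / 2.
Proof.
  intros Ht. assert (P : 0 < ln t) by (rewrite <- ln_1; apply ln_increasing; lra).
  assert (K := exp_half_diff (ln t) ltac:(lra)).
  rewrite exp_Ropp in K. set (x := exp (ln t / 2)) in *.
  assert (Hx : 1 < x) by (unfold x; rewrite <- exp_0; apply exp_increasing; lra).
  assert (E : t = x * x).
  { unfold x. rewrite <- exp_plus. replace (ln t / 2 + ln t / 2) with (ln t) by field.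
    rewrite exp_ln; lra. }
  replace ((t - / t) / 2) with ((x - / x) * ((x + / x) / 2)) by (rewrite E; field; lra).
  assert (1 < (x + / x) / 2).
  { assert (0 < (x - 1) ^ 2 / (2 * x)).
    { apply Rdiv_lt_0_compat; [|lra]. apply pow2_gt_0. lra. }
    replace ((x - 1) ^ 2 / (2 * x)) with ((x + / x) / 2 - 1) in H by (field; lra). lra. }
  nra.
Qed.

(** Up to terms that the continuity of [m] and [N] makes continuous, the entropy flux relative
    to the jump is [m * (m ^ 2 / rho ^ 2 / 2 + c ^ 2 * ln rho)]. As [m ^ 2 = c ^ 2 r1 r2],
    with [t = r2 / r1] the condition becomes [m * ((/ t - t) / 2 + ln t) <= 0], where the
    second factor has the sign of [1 - t]. *)
Lemma entropy_jump_density (c xi m r1 r2 : R) :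
  0 < c -> 0 < r1 -> 0 < r2 ->
  m ^ 2 / r1 + c ^ 2 * r1 = m ^ 2 / r2 + c ^ 2 * r2 ->
  (energy_flux c r2 (m + xi * r2) - xi * energy c r2 (m + xi * r2)) -
  (energy_flux c r1 (m + xi * r1) - xi * energy c r1 (m + xi * r1)) <= 0 ->
  0 <= m * (r2 - r1).
Proof.
  intros Hc H1 H2 HN He.
  destruct (Req_dec r1 r2) as [->|Hne]; [nra|].
  assert (EH : forall r, 0 < r ->
    energy_flux c r (m + xi * r) - xi * energy c r (m + xi * r) =
    m * (m ^ 2 / r ^ 2 / 2 + c ^ 2 * ln r) + xi * (m ^ 2 / r + c ^ 2 * r) +
    m * xi ^ 2 / 2 + c ^ 2 * m).
  { intros r Hr. unfold energy, energy_flux. field. lra. }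
  rewrite !EH in He by assumption. rewrite HN in He.
  destruct (equal_N_product c m r1 r2 H1 H2 HN) as [Heq|RH]; [contradiction|].
  rewrite RH in He.
  assert (He2 : c ^ 2 * (m * ((r1 / r2 - r2 / r1) / 2 + (ln r2 - ln r1))) <= 0).
  { replace (c ^ 2 * (m * ((r1 / r2 - r2 / r1) / 2 + (ln r2 - ln r1)))) with
     (m * (c ^ 2 * (r1 * r2) / r2 ^ 2 / 2 + c ^ 2 * ln r2) -
      m * (c ^ 2 * (r1 * r2) / r1 ^ 2 / 2 + c ^ 2 * ln r1)) by (field; lra). lra. }
  assert (He3 : m * ((r1 / r2 - r2 / r1) / 2 + (ln r2 - ln r1)) <= 0).
  { apply Rmult_le_reg_l with (c ^ 2); [nra|]. lra. }
  destruct (Rlt_dec r1 r2) as [Hlt|Hge].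
  - assert (K := sinh_lt (r2 / r1) ltac:(apply Rlt_div_r; lra)).
    rewrite ln_div in K by lra. replace (/ (r2 / r1)) with (r1 / r2) in K by (field; lra). nra.
  - assert (K := sinh_lt (r1 / r2) ltac:(apply Rlt_div_r; lra)).
    rewrite ln_div in K by lra. replace (/ (r1 / r2)) with (r2 / r1) in K by (field; lra). nra.
Qed.

Lemma filterlim_state (g : state -> R) (w : R -> state) (F : (R -> Prop) -> Prop) (l : state) :
  continuous g l -> filterlim w F (locally l) ->
  filterlim (fun x => g (w x)) F (locally (g l)).
Proof. intros Hg Hw. eapply filterlim_comp; [exact Hw|exact Hg]. Qed.

Lemma regulated_has_limits (g : state -> R) (w : R -> state) :
  (forall U, Omega U -> continuous g U) -> regulated w -> has_limits (fun x => g (w x)).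
Proof.
  intros Hg Hw x. destruct (Hw x) as [_ [[l [Hl Ll]] [r [Hr Lr]]]].
  split; [exists (g l)|exists (g r)]; apply filterlim_state; auto.
Qed.

Lemma RInt_minus_point (e G : R -> R) (x l : R) :
  has_limits e -> (forall a b, a <= b -> G b - G a = - RInt e a b) ->
  filterlim e (at_left x) (locally l) -> filterlim e (at_right x) (locally l) ->
  is_derive G x (- l).
Proof.
  intros He HG Hl Hr. apply is_derive_Reals. intros ep Hep.
  destruct (proj1 (at_left_eps _ _ _) Hl (ep / 2) ltac:(lra)) as [d1 [Hd1 K1]].
  destruct (proj1 (at_right_eps _ _ _) Hr (ep / 2) ltac:(lra)) as [d2 [Hd2 K2]].
  exists (mkposreal (Rmin d1 d2) (Rmin_pos _ _ Hd1 Hd2)). intros h Hh Hhd. simpl in Hhd.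
  assert (L1 := Rmin_l d1 d2). assert (L2 := Rmin_r d1 d2).
  apply Rle_lt_trans with (ep / 2); [|lra].
  destruct (Rlt_dec 0 h) as [Hp|Hp].
  - rewrite Rabs_pos_eq in Hhd by lra.
    assert (K := RInt_near_const e x (x + h) l (ep / 2) ltac:(lra) (has_limits_ex_RInt _ _ _ He)).
    replace (x + h - x) with h in K by ring.
    rewrite HG by lra.
    replace (- RInt e x (x + h) / h - - l) with (- ((RInt e x (x + h) - l * h) / h)) by (field; lra).
    rewrite Rabs_Ropp. unfold Rdiv at 1. rewrite Rabs_mult, Rabs_inv, (Rabs_pos_eq h) by lra.
    apply Rle_div_l; [lra|]. apply K. intros y Hy. apply Rlt_le, K2. lra.
  - rewrite Rabs_left in Hhd by lra.
    assert (K := RInt_near_const e (x + h) x l (ep / 2) ltac:(lra) (has_limits_ex_RInt _ _ _ He)).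
    replace (x - (x + h)) with (- h) in K by ring.
    replace (G (x + h) - G x) with (- (G x - G (x + h))) by ring.
    rewrite HG by lra.
    replace (- - RInt e (x + h) x / h - - l) with (- ((RInt e (x + h) x - l * - h) / - h)) by (field; lra).
    rewrite Rabs_Ropp. unfold Rdiv at 1. rewrite Rabs_mult, Rabs_inv, (Rabs_pos_eq (- h)) by lra.
    apply Rle_div_l; [lra|]. apply K. intros y Hy. apply Rlt_le, K1. lra.
Qed.

Lemma RInt_minus_continuous (e G : R -> R) (x : R) :
  has_limits e -> (forall a b, a <= b -> G b - G a = - RInt e a b) -> continuous G x.
Proof.
  intros He HG.
  destruct (He x) as [[l Hl] [r Hr]].
  destruct (proj1 (at_left_eps _ _ _) Hl 1 ltac:(lra)) as [d1 [Hd1 K1]].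
  destruct (proj1 (at_right_eps _ _ _) Hr 1 ltac:(lra)) as [d2 [Hd2 K2]].
  set (C := Rabs l + Rabs r + 1).
  assert (HC : 0 < C) by (unfold C; generalize (Rabs_pos l) (Rabs_pos r); lra).
  apply continuous_eps. intros ep Hep.
  exists (Rmin (Rmin d1 d2) (ep / C)).
  assert (0 < ep / C) by (apply Rdiv_lt_0_compat; lra).
  split; [repeat apply Rmin_pos; lra|]. intros y Hy.
  assert (L0 := Rmin_l (Rmin d1 d2) (ep / C)). assert (L3 := Rmin_r (Rmin d1 d2) (ep / C)).
  assert (L1 := Rmin_l d1 d2). assert (L2 := Rmin_r d1 d2).
  assert (Bd : forall a b, a <= b -> x - d1 < a -> b < x + d2 -> (b <= x \/ x <= a) ->
            Rabs (G b - G a) <= C * (b - a)).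
  { intros a b Hab Ha Hb Hx.
    rewrite HG, Rabs_Ropp by lra.
    assert (K := RInt_near_const e a b 0 C Hab (has_limits_ex_RInt _ _ _ He)).
    rewrite Rmult_0_l, Rminus_0_r in K. apply K. intros z Hz.
    unfold C. rewrite Rminus_0_r. destruct Hx.
    - specialize (K1 z ltac:(lra)). assert (T := Rabs_triang (e z - l) l).
      replace (e z - l + l) with (e z) in T by ring. generalize (Rabs_pos r). lra.
    - specialize (K2 z ltac:(lra)). assert (T := Rabs_triang (e z - r) r).
      replace (e z - r + r) with (e z) in T by ring. generalize (Rabs_pos l). lra. }
  assert (Hlt : C * Rabs (y - x) < ep).
  { replace ep with (C * (ep / C)) by (field; lra). apply Rmult_lt_compat_l; lra. }
  destruct (Rle_dec x y).
  - rewrite Rabs_pos_eq in * by lra. eapply Rle_lt_trans; [apply Bd|]; lra.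
  - rewrite (Rabs_left (y - x)) in * by lra. rewrite Rabs_minus_sym.
    eapply Rle_lt_trans; [apply Bd|]; lra.
Qed.

(** * From Riemann solutions to flows *)

Lemma filterlim_left_unique {V : NormedModule R_AbsRing} (w : R -> V) (x : R) (l1 l2 : V) :
  filterlim w (at_left x) (locally l1) -> filterlim w (at_left x) (locally l2) -> l1 = l2.
Proof. apply filterlim_locally_unique. Qed.

Lemma continuous_momentum_flux (c : R) (U : state) :
  Omega U -> continuous (momentum_flux c) U.
Proof.
  destruct U as [r q]. intros H. unfold Omega in H; simpl in H. unfold momentum_flux.
  apply continuous_Rplus.
  - apply (continuous_Rmult (fun U : R * R => snd U ^ 2) (fun U : R * R => / fst U)).
    + apply (continuous_comp snd (fun t => t ^ 2)); [apply continuous_snd|].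
      apply (ex_derive_continuous (fun t => t ^ 2)). auto_derive. trivial.
    + apply (continuous_fst_comp Rinv). simpl. apply continuous_Rinv. lra.
  - apply (continuous_Rmult (fun _ => c ^ 2) (fun U : R * R => fst U)); [apply continuous_const|apply continuous_fst].
Qed.

Lemma closed_between (F : (R -> Prop) -> Prop) {FF : ProperFilter F} (f : R -> R) (l a b : R) :
  filterlim f F (locally l) -> F (fun x => a < f x < b) -> a <= l <= b.
Proof.
  intros Hf HF.
  apply (closed_filterlim_loc (T := R_UniformSpace) (F := F) f (fun y => a <= y <= b)); auto.
  - revert HF. apply filter_imp. intros; lra.
  - apply closed_and; [apply closed_ge|apply closed_le].
Qed.

Lemma filterlim_sub_mul (F : (R -> Prop) -> Prop) {FF : Filter F} (f g : R -> R) (x lf lg : R) :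
  filterlim (fun y : R => y) F (locally x) ->
  filterlim f F (locally lf) -> filterlim g F (locally lg) ->
  filterlim (fun y => f y - y * g y) F (locally (lf - x * lg)).
Proof.
  intros Hx Hf Hg.
  apply (filterlim_comp_2 f (fun y => - (y * g y)) Rplus Hf (H := locally (- (x * lg))));
    [|exact (filterlim_plus (V := R_NormedModule) lf (- (x * lg)))].
  apply (filterlim_comp _ _ _ (fun y => y * g y) Ropp F (locally (x * lg)));
    [|exact (filterlim_opp (V := R_NormedModule) (x * lg))].
  exact (filterlim_comp_2 (fun y => y) g Rmult Hx Hg (filterlim_mult (K := R_AbsRing) x lg)).
Qed.

(** [weak_eq_jump], applied to mass and to the equation of [weak_eq_shift], shows that [m] and
    [N] are continuous and are primitives of [- rho] and [- 2 m]. [weak_ineq_jump], applied to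
    the energy with [x1 = x2], gives the entropy condition. *)
Lemma riemann_flow (c : R) (Ua Ub : state) (w : R -> state) :
  0 < c -> Omega Ua -> riemann_solution c Ua Ub w ->
  exists wl wr : R -> state,
    (forall x, filterlim w (at_left x) (locally (wl x))) /\
    let m x := snd (wl x) - x * fst (wl x) in
    let N x := m x ^ 2 / fst (wl x) + c ^ 2 * fst (wl x) in
    flow c 1 m N (fun x => fst (wl x)) (fun x => fst (wr x)) /\
    far_left m (fun x => fst (wl x)) (fun x => fst (wr x)) (fst Ua) (snd Ua / fst Ua).
Proof.
  intros Hc HUa [Reg Sol Left _].
  destruct (functional_choice (fun x l => Omega l /\ filterlim w (at_left x) (locally l))) as [wl Hwl].
  { intros x. destruct (Reg x) as [_ [[l Hl] _]]. exists l; exact Hl. }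
  destruct (functional_choice (fun x l => Omega l /\ filterlim w (at_right x) (locally l))) as [wr Hwr].
  { intros x. destruct (Reg x) as [_ [_ [l Hl]]]. exists l; exact Hl. }
  exists wl, wr. split; [intros x; apply Hwl|].
  set (rho := fun x => fst (w x)). set (q := fun x => snd (w x)).
  set (rl := fun x => fst (wl x)). set (rr := fun x => fst (wr x)).
  intros m N.
  set (mr := fun x => snd (wr x) - x * rr x).
  assert (Prl : forall x, 0 < rl x) by (intros x; apply Hwl).
  assert (Prr : forall x, 0 < rr x) by (intros x; apply Hwr).
  assert (Prho : forall x, 0 < rho x) by (intros x; apply (Reg x)).
  assert (LL : forall (g : state -> R) x, (forall U, Omega U -> continuous g U) ->
     filterlim (fun y => g (w y)) (at_left x) (locally (g (wl x)))).
  { intros g x Hg. apply filterlim_state; [apply Hg|]; apply Hwl. }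
  assert (LR : forall (g : state -> R) x, (forall U, Omega U -> continuous g U) ->
     filterlim (fun y => g (w y)) (at_right x) (locally (g (wr x)))).
  { intros g x Hg. apply filterlim_state; [apply Hg|]; apply Hwr. }
  assert (Cid : forall x, filterlim (fun y : R => y) (at_left x) (locally x) /\
                          filterlim (fun y : R => y) (at_right x) (locally x)).
  { intros x. split; intros P HP; apply (filter_le_within _ _); exact HP. }
  assert (LinL : forall f g x lf lg, filterlim f (at_left x) (locally lf) ->
     filterlim g (at_left x) (locally lg) ->
     filterlim (fun y => f y - y * g y) (at_left x) (locally (lf - x * lg))).
  { intros. apply filterlim_sub_mul; [apply within_filter, locally_filter|apply Cid|assumption|assumption]. }
  assert (LinR : forall f g x lf lg, filterlim f (at_right x) (locally lf) ->
     filterlim g (at_right x) (locally lg) ->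
     filterlim (fun y => f y - y * g y) (at_right x) (locally (lf - x * lg))).
  { intros. apply filterlim_sub_mul; [apply within_filter, locally_filter|apply Cid|assumption|assumption]. }
  assert (Cfst : forall U : state, Omega U -> continuous (fun U : R * R => fst U) U)
    by (intros; apply continuous_fst).
  assert (Csnd : forall U : state, Omega U -> continuous (fun U : R * R => snd U) U)
    by (intros; apply continuous_snd).
  assert (Hrho : has_limits rho) by (apply (regulated_has_limits (fun U => fst U)); auto).
  assert (Hq : has_limits q) by (apply (regulated_has_limits (fun U => snd U)); auto).
  assert (Hfl : has_limits (fun x => momentum_flux c (w x)))
    by (apply regulated_has_limits; [apply continuous_momentum_flux|assumption]).
  assert (Hlin : forall f g, has_limits f -> has_limits g -> has_limits (fun y => f y - y * g y)).
  { intros f g Hf Hg x. destruct (Hf x) as [[l1 H1] [r1 K1]], (Hg x) as [[l2 H2] [r2 K2]].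
    split; eexists; [apply LinL|apply LinR]; eassumption. }
  destruct Sol as [Smass Smom Sent].
  set (mm := fun x => q x - x * rho x).
  assert (Hmm : has_limits mm) by (apply Hlin; assumption).
  assert (Wmass : weak_eq mm rho).
  { apply (weak_eq_of_pairing mm rho q); auto. intros x; unfold mm; ring. }
  set (P := fun x => momentum_flux c (w x) - x * q x).
  assert (HP : has_limits P) by (apply Hlin; assumption).
  assert (Wmom : weak_eq P q).
  { apply (weak_eq_of_pairing P q (fun x => momentum_flux c (w x))); auto. intros x; unfold P; ring. }
  assert (WN := weak_eq_shift _ _ _ _ Hmm Hrho HP Hq Wmass Wmom).
  assert (mmL : forall x, filterlim mm (at_left x) (locally (m x))).
  { intros x. apply LinL; [apply (LL (fun U => snd U)), Csnd|apply (LL (fun U => fst U)), Cfst]. }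
  assert (mmR : forall x, filterlim mm (at_right x) (locally (mr x))).
  { intros x. apply LinR; [apply (LR (fun U => snd U)), Csnd|apply (LR (fun U => fst U)), Cfst]. }
  assert (Jm : forall x y, x <= y -> mr y - m x + RInt rho x y = 0).
  { intros x y Hxy. apply (weak_eq_jump mm rho); auto. }
  assert (Emr : forall x, mr x = m x).
  { intros x. assert (K := Jm x x (Rle_refl x)). rewrite RInt_point in K.
    unfold zero in K; simpl in K. lra. }
  assert (Dm : forall x y, x <= y -> m y - m x = - RInt rho x y).
  { intros x y Hxy. rewrite <- (Emr y). generalize (Jm x y Hxy). lra. }
  set (NN := fun x => P x - x * mm x).
  assert (HNN : has_limits NN) by (apply Hlin; assumption).
  set (e2 := fun x => q x + mm x - x * rho x).
  assert (He2 : has_limits e2).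
  { apply (Hlin (fun x => q x + mm x) rho); [apply has_limits_plus; assumption|assumption]. }
  set (Nr := fun x => mr x ^ 2 / rr x + c ^ 2 * rr x).
  assert (NL : forall x, filterlim NN (at_left x) (locally (N x))).
  { intros x. replace (N x) with (momentum_flux c (wl x) - x * snd (wl x) - x * m x).
    - apply LinL; [|apply mmL].
      apply LinL; [apply LL, continuous_momentum_flux|apply (LL (fun U => snd U)), Csnd].
    - unfold N, m, momentum_flux. fold (rl x). generalize (Prl x). intros. field. lra. }
  assert (NR : forall x, filterlim NN (at_right x) (locally (Nr x))).
  { intros x. replace (Nr x) with (momentum_flux c (wr x) - x * snd (wr x) - x * mr x).
    - apply LinR; [|apply mmR].
      apply LinR; [apply LR, continuous_momentum_flux|apply (LR (fun U => snd U)), Csnd].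
    - unfold Nr, mr, momentum_flux. fold (rr x). generalize (Prr x). intros. field. lra. }
  assert (JN : forall x y, x <= y -> Nr y - N x + RInt e2 x y = 0).
  { intros x y Hxy. apply (weak_eq_jump NN e2); auto. }
  assert (ENr : forall x, Nr x = N x).
  { intros x. assert (K := JN x x (Rle_refl x)). rewrite RInt_point in K.
    unfold zero in K; simpl in K. lra. }
  assert (DN : forall x y, x <= y -> N y - N x = - RInt e2 x y).
  { intros x y Hxy. rewrite <- (ENr y). generalize (JN x y Hxy). lra. }
  assert (e2L : forall x, filterlim e2 (at_left x) (locally (2 * m x))).
  { intros x. replace (2 * m x) with (snd (wl x) + m x - x * rl x) by (unfold m; fold (rl x); ring).
    apply LinL; [|apply (LL (fun U => fst U)), Cfst].
    eapply filterlim_comp_2; [apply (LL (fun U => snd U)), Csnd|apply mmL|].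
    exact (filterlim_plus (V := R_NormedModule) _ _). }
  assert (e2R : forall x, filterlim e2 (at_right x) (locally (2 * m x))).
  { intros x. rewrite <- Emr.
    replace (2 * mr x) with (snd (wr x) + mr x - x * rr x) by (unfold mr; ring).
    apply LinR; [|apply (LR (fun U => fst U)), Cfst].
    eapply filterlim_comp_2; [apply (LR (fun U => snd U)), Csnd|apply mmR|].
    exact (filterlim_plus (V := R_NormedModule) _ _). }
  destruct (energy_pair c) as [EC FC EConv ECompat].
  assert (Cen : forall U, Omega U -> continuous (fun U : R * R => energy c (fst U) (snd U)) U).
  { intros [a b] HU. apply (C1_on_continuous Omega); [exact open_Omega|exact EC|exact HU]. }
  assert (Cfl : forall U, Omega U -> continuous (fun U : R * R => energy_flux c (fst U) (snd U)) U).
  { intros [a b] HU. apply (C1_on_continuous Omega); [exact open_Omega|exact FC|exact HU]. }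
  set (en := fun x => energy c (rho x) (q x)). set (ef := fun x => energy_flux c (rho x) (q x)).
  assert (Hen : has_limits en) by (apply (regulated_has_limits (fun U => energy c (fst U) (snd U))); auto).
  assert (Hef : has_limits ef) by (apply (regulated_has_limits (fun U => energy_flux c (fst U) (snd U))); auto).
  set (H := fun x => ef x - x * en x).
  assert (HH : has_limits H) by (apply Hlin; assumption).
  assert (Wen : weak_ineq H en).
  { apply (weak_ineq_of_pairing H en ef); auto.
    - intros x; unfold H; ring.
    - intros phi a b M Ht Hp. apply (Sent (energy c) (energy_flux c)); auto. apply energy_pair. }
  assert (Ent : forall x, 0 <= m x * (rr x - rl x)).
  { intros x.
    assert (K := weak_ineq_jump H en x x
      (energy_flux c (rl x) (snd (wl x)) - x * energy c (rl x) (snd (wl x)))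
      (energy_flux c (rr x) (snd (wr x)) - x * energy c (rr x) (snd (wr x))) HH Hen Wen (Rle_refl x)).
    rewrite RInt_point in K. unfold zero in K; simpl in K. rewrite Rplus_0_r in K.
    apply (entropy_jump_density c x); auto.
    - transitivity (N x); [reflexivity|]. rewrite <- ENr. unfold Nr. rewrite Emr. reflexivity.
    - replace (m x + x * rl x) with (snd (wl x)) by (unfold m; fold (rl x); ring).
      rewrite <- (Emr x). replace (mr x + x * rr x) with (snd (wr x)) by (unfold mr; ring).
      apply K.
      + apply LinL; [apply (LL (fun U => energy_flux c (fst U) (snd U))), Cfl|
                     apply (LL (fun U => energy c (fst U) (snd U))), Cen].
      + apply LinR; [apply (LR (fun U => energy_flux c (fst U) (snd U))), Cfl|
                     apply (LR (fun U => energy c (fst U) (snd U))), Cen]. }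
  assert (RhoL : forall x, filterlim rho (at_left x) (locally (rl x))).
  { intros x. apply (LL (fun U => fst U)), Cfst. }
  assert (RhoR : forall x, filterlim rho (at_right x) (locally (rr x))).
  { intros x. apply (LR (fun U => fst U)), Cfst. }
  assert (NearL : forall y a b s t, s < y < t -> (forall z, s < z < t -> a < rho z < b) -> a <= rl y <= b).
  { intros y a b s t Hy Hz. apply (closed_between (at_left y) rho); [apply RhoL|].
    exists (mkposreal (y - s) ltac:(lra)). intros z Hzy Hzl.
    change (Rabs (z - y) < y - s) in Hzy. apply Rabs_def2 in Hzy. apply Hz; lra. }
  assert (NearR : forall y a b s t, s < y < t -> (forall z, s < z < t -> a < rho z < b) -> a <= rr y <= b).
  { intros y a b s t Hy Hz. apply (closed_between (at_right y) rho); [apply RhoR|].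
    exists (mkposreal (t - y) ltac:(lra)). intros z Hzy Hzl.
    change (Rabs (z - y) < t - y) in Hzy. apply Rabs_def2 in Hzy. apply Hz; lra. }
  split.
  - split; auto.
    + intros x. rewrite <- ENr. unfold Nr. rewrite Emr. reflexivity.
    + intros x y Hxy. rewrite Rmult_1_l.
      replace (m x - m y) with (- (m y - m x)) by ring. rewrite Dm, Ropp_involutive by lra.
      destruct (proj1 (at_right_eps _ _ _) (RhoR x) (rr x / 2)) as [d [Hd K]]; [generalize (Prr x); lra|].
      set (z := Rmin y (x + d / 2)).
      assert (z <= y) by apply Rmin_l. assert (z <= x + d / 2) by apply Rmin_r.
      assert (x < z) by (apply Rmin_glb_lt; lra).
      rewrite <- (RInt_Chasles_R rho x z y) by (apply has_limits_ex_RInt, Hrho).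
      assert (I1 : RInt (fun _ => rr x / 2) x z <= RInt rho x z).
      { apply RInt_le; [lra|apply ex_RInt_const|apply has_limits_ex_RInt, Hrho|].
        intros t Ht. specialize (K t ltac:(lra)). apply Rabs_def2 in K. lra. }
      rewrite RInt_const in I1. unfold scal in I1; simpl in I1; unfold mult in I1; simpl in I1.
      assert (I2 : 0 <= RInt rho z y).
      { apply RInt_ge_0; [lra|apply has_limits_ex_RInt, Hrho|]. intros; apply Rlt_le, Prho. }
      unfold plus; simpl. assert (0 < (z - x) * (rr x / 2)); [|lra].
      apply Rmult_lt_0_compat; [lra|]. generalize (Prr x); lra.
    + intros x. apply (RInt_minus_continuous rho); assumption.
    + intros x Hx. replace (- (1) * rl x) with (- rl x) by ring.
      apply (RInt_minus_point rho); auto. rewrite Hx. apply RhoR.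
    + intros x. replace (-2 * 1 * m x) with (- (2 * m x)) by ring.
      apply (RInt_minus_point e2); auto.
    + intros x. rewrite Rmult_1_l. apply Ent.
    + intros x e He.
      destruct (proj1 (at_left_eps _ _ _) (RhoL x) (e / 2) ltac:(lra)) as [d [Hd K]].
      exists d. split; [assumption|]. intros y Hy.
      assert (Hz : forall z, x - d < z < x -> rl x - e / 2 < rho z < rl x + e / 2).
      { intros z Hz. specialize (K z Hz). apply Rabs_def2 in K. lra. }
      split; apply Rabs_def1;
      generalize (NearL y _ _ _ _ Hy Hz) (NearR y _ _ _ _ Hy Hz); lra.
    + intros x e He.
      destruct (proj1 (at_right_eps _ _ _) (RhoR x) (e / 2) ltac:(lra)) as [d [Hd K]].
      exists d. split; [assumption|]. intros y Hy.
      assert (Hz : forall z, x < z < x + d -> rr x - e / 2 < rho z < rr x + e / 2).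
      { intros z Hz. specialize (K z Hz). apply Rabs_def2 in K. lra. }
      split; apply Rabs_def1;
      generalize (NearL y _ _ _ _ Hy Hz) (NearR y _ _ _ _ Hy Hz); lra.
  - intros e He. specialize (Left (-1) ltac:(lra)).
    assert (L1 : filterlim (fun t => rho (-1 / t)) (at_right 0) (locally (fst Ua))).
    { apply (filterlim_state (fun U => fst U)); [apply Cfst; assumption|exact Left]. }
    assert (L2 : filterlim (fun t => q (-1 / t)) (at_right 0) (locally (snd Ua))).
    { apply (filterlim_state (fun U => snd U)); [apply Csnd; assumption|exact Left]. }
    destruct (proj1 (at_right_eps _ _ _) L1 (e / 2) ltac:(lra)) as [d1 [Hd1 K1]].
    destruct (proj1 (at_right_eps _ _ _) L2 (e / 2) ltac:(lra)) as [d2 [Hd2 K2]].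
    set (d := Rmin d1 d2). assert (Hd : 0 < d) by (apply Rmin_pos; lra).
    assert (d <= d1) by apply Rmin_l. assert (d <= d2) by apply Rmin_r.
    assert (Far : forall z, z < - / d ->
      (fst Ua - e / 2 < rho z < fst Ua + e / 2) /\ (snd Ua - e / 2 < q z < snd Ua + e / 2)).
    { intros z Hz. assert (0 < / d) by (apply Rinv_0_lt_compat; lra).
      assert (B : 0 < - / z < d).
      { split.
        - assert (/ z < 0) by (apply Rinv_lt_0_compat; lra). lra.
        - replace (- / z) with (/ - z) by (field; lra).
          rewrite <- (Rinv_inv d). apply Rinv_lt_contravar; [|lra].
          apply Rmult_lt_0_compat; lra. }
      specialize (K1 (- / z) ltac:(lra)). specialize (K2 (- / z) ltac:(lra)).
      replace (-1 / (- / z)) with z in K1, K2 by (field; lra).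
      apply Rabs_def2 in K1. apply Rabs_def2 in K2. lra. }
    exists (- / d - 1). intros x Hx.
    assert (HxI : x - 1 < x < - / d) by lra.
    assert (B1 : fst Ua - e / 2 <= rl x <= fst Ua + e / 2).
    { apply (NearL x _ _ _ _ HxI). intros z Hz. apply Far; lra. }
    assert (B2 : fst Ua - e / 2 <= rr x <= fst Ua + e / 2).
    { apply (NearR x _ _ _ _ HxI). intros z Hz. apply Far; lra. }
    assert (B3 : snd Ua - e / 2 <= snd (wl x) <= snd Ua + e / 2).
    { apply (closed_between (at_left x) q); [apply (LL (fun U => snd U)), Csnd|].
      exists (mkposreal 1 Rlt_0_1). intros z Hzy Hzl.
      change (Rabs (z - x) < 1) in Hzy. apply Rabs_def2 in Hzy. apply Far; lra. }
    split; [|split]; apply Rabs_def1; try lra.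
    + replace (m x + x * rl x - fst Ua * (snd Ua / fst Ua)) with (snd (wl x) - snd Ua); [lra|].
      unfold m, Omega in *. fold (rl x). field. lra.
    + replace (m x + x * rl x - fst Ua * (snd Ua / fst Ua)) with (snd (wl x) - snd Ua); [lra|].
      unfold m, Omega in *. fold (rl x). field. lra.
Qed.

(** Where [wave_u] falls below [- c] the 1-wave curve is replaced by the sonic line [a = - c
    r], whose states are reached by 2-fans. *)
Lemma V_minus_shape (c r0 a0 v r a : R) :
  0 < c -> 0 < r0 -> a0 / r0 <= c -> V_minus c r0 a0 v (r, a) ->
  0 < r /\ (0 <= a -> a <= c * r) /\
  (- (c * r) <= a ->
     wave_u c (a0 / r0) r0 r <= c /\ a = r * Rmax (wave_u c (a0 / r0) r0 r) (- c)).
Proof.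
  intros Hc Hr0 Ha0 [r' [q [[Ub [w [HUb [Hw Hlim]]]] E]]].
  injection E as -> ->.
  assert (HUa : Omega (r0, a0 + v * r0)) by exact Hr0.
  destruct (riemann_flow c _ Ub w Hc HUa Hw) as [wl [wr [Hwl [F Far]]]].
  assert (Ev : wl v = (r', q)) by (eapply filterlim_left_unique; [apply Hwl|exact Hlim]).
  assert (Pr := flow_rl_pos F v). simpl in Pr. rewrite Ev in Pr. simpl in Pr.
  simpl fst in Far. simpl snd in Far.
  replace ((a0 + v * r0) / r0) with (v + a0 / r0) in Far by (field; lra).
  destruct (left_state c _ _ _ _ r0 (v + a0 / r0) v Hc Hr0 F Far ltac:(lra)) as [L1 L2].
  rewrite Ev in L1, L2. simpl in L1, L2.
  assert (Ek : wave_u c (v + a0 / r0) r0 r' - v = wave_u c (a0 / r0) r0 r') by (unfold wave_u; ring).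
  rewrite Ek in L2. auto.
Qed.

(** * Integration by parts over sectors *)

Lemma continuity_2d_of_continuous (f : R -> R -> R) (x y : R) :
  continuous (fun z : R * R => f (fst z) (snd z)) (x, y) -> continuity_2d_pt f x y.
Proof.
  intros H. apply continuity_2d_pt_filterlim. exact H.
Qed.

Lemma continuous_ray (f : R -> R -> R) (t y : R) :
  continuous (fun z : R * R => f (fst z) (snd z)) (t, t * y) ->
  continuous (fun z : R * R => f (fst z) (fst z * snd z)) (t, y).
Proof.
  intros H.
  apply (continuous_comp_2 (fun z : R * R => fst z) (fun z : R * R => fst z * snd z) f).
  - apply continuous_fst.
  - apply continuous_Rmult; [apply continuous_fst|apply continuous_snd].
  - exact H.
Qed.

Lemma continuous_snd_comp (f : R -> R) (z : R * R) :
  continuous f (snd z) -> continuous (fun z : R * R => f (snd z)) z.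
Proof. intros H. apply (continuous_comp snd f); [apply continuous_snd|exact H]. Qed.

Lemma continuous_section (f : R -> R -> R) (x y : R) :
  continuous (fun z : R * R => f (fst z) (snd z)) (x, y) -> continuous (f x) y.
Proof.
  intros H.
  apply (continuous_comp_2 (fun _ : R => x) (fun s : R => s) f).
  - apply continuous_const.
  - apply continuous_id.
  - exact H.
Qed.

(** The derivative in t of [t * (e y * phi t (t * y))]. *)
Definition sector_dt (e : R -> R) (phi : R -> R -> R) (t y : R) : R :=
  e y * (phi t (t * y) + t * (D1 phi t (t * y) + y * D2 phi t (t * y))).

Lemma test_continuous (phi : R -> R -> R) (t x : R) :
  C1_on (fun _ => True) phi -> continuous (fun z : R * R => phi (fst z) (snd z)) (t, x).
Proof. intros H. apply (C1_on_continuous (fun _ => True)); [apply open_all|exact H|trivial]. Qed.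

Lemma test_continuous_D1 (phi : R -> R -> R) (t x : R) :
  C1_on (fun _ => True) phi -> continuous (fun z : R * R => D1 phi (fst z) (snd z)) (t, x).
Proof. intros H. destruct (H t x I) as [_ [_ [K _]]]. exact K. Qed.

Lemma test_continuous_D2 (phi : R -> R -> R) (t x : R) :
  C1_on (fun _ => True) phi -> continuous (fun z : R * R => D2 phi (fst z) (snd z)) (t, x).
Proof. intros H. destruct (H t x I) as [_ [_ [_ K]]]. exact K. Qed.

Lemma is_derive_ray (phi : R -> R -> R) (t y : R) :
  C1_on (fun _ => True) phi ->
  is_derive (fun s => phi s (s * y)) t (D1 phi t (t * y) + y * D2 phi t (t * y)).
Proof.
  intros H. evar_last.
  - apply (C1_on_chain (fun _ => True) phi (fun s => s) (fun s => s * y) t 1 y open_all H I).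
    + auto_derive; [trivial|ring].
    + auto_derive; [trivial|ring].
  - simpl. ring.
Qed.

Lemma is_derive_sector (e : R -> R) (phi : R -> R -> R) (t y : R) :
  C1_on (fun _ => True) phi ->
  is_derive (fun s => s * (e y * phi s (s * y))) t (sector_dt e phi t y).
Proof.
  intros H. evar_last.
  - apply (is_derive_mult (fun s => s) (fun s => e y * phi s (s * y)));
      [apply is_derive_id| |intros; apply Rmult_comm].
    apply is_derive_scal, is_derive_ray, H.
  - unfold plus, mult, one, sector_dt; simpl. ring.
Qed.

Lemma continuous_sector_dt (e : R -> R) (phi : R -> R -> R) (t y : R) :
  (forall x, continuous e x) -> C1_on (fun _ => True) phi ->
  continuous (fun z : R * R => sector_dt e phi (fst z) (snd z)) (t, y).
Proof.
  intros He H. unfold sector_dt.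
  apply continuous_Rmult; [apply (continuous_snd_comp e), He|].
  apply continuous_Rplus.
  - apply (continuous_ray phi), test_continuous, H.
  - apply continuous_Rmult; [apply continuous_fst|].
    apply continuous_Rplus.
    + apply (continuous_ray (D1 phi)), test_continuous_D1, H.
    + apply continuous_Rmult; [apply continuous_snd|].
      apply (continuous_ray (D2 phi)), test_continuous_D2, H.
Qed.

Lemma is_derive_sector_mass (e : R -> R) (phi : R -> R -> R) (x1 x2 t : R) :
  (forall x, continuous e x) -> C1_on (fun _ => True) phi ->
  is_derive (fun s => RInt (fun y => s * (e y * phi s (s * y))) x1 x2) t
    (RInt (sector_dt e phi t) x1 x2).
Proof.
  intros He H.
  assert (E : forall u v, Derive (fun z => z * (e v * phi z (z * v))) u = sector_dt e phi u v).
  { intros. apply is_derive_unique, is_derive_sector, H. }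
  evar_last.
  - apply (is_derive_RInt_param (fun s y => s * (e y * phi s (s * y)))).
    + apply filter_forall. intros s y _. eexists. apply is_derive_sector, H.
    + intros y _. apply (continuity_2d_pt_ext (sector_dt e phi)); [intros; symmetry; apply E|].
      apply continuity_2d_of_continuous, continuous_sector_dt; assumption.
    + apply filter_forall. intros s. apply ex_RInt_continuous_R.
      intros y _. apply (continuous_section (fun s y => s * (e y * phi s (s * y)))).
      apply continuous_Rmult; [apply continuous_fst|].
      apply continuous_Rmult; [apply (continuous_snd_comp e), He|].
      apply (continuous_ray phi), test_continuous, H.
  - apply RInt_ext. intros y _. apply E.
Qed.

Lemma continuous_sector_mass_dt (e : R -> R) (phi : R -> R -> R) (x1 x2 t : R) :
  x1 <= x2 -> (forall x, continuous e x) -> C1_on (fun _ => True) phi ->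
  continuous (fun s => RInt (sector_dt e phi s) x1 x2) t.
Proof.
  intros Hx He H. apply continuous_RInt_param; [exact Hx| |].
  - intros y _. apply continuity_2d_of_continuous, continuous_sector_dt; assumption.
  - apply filter_forall. intros s. apply ex_RInt_continuous_R.
    intros y _. apply (continuous_section (sector_dt e phi)), continuous_sector_dt; assumption.
Qed.

Definition sector_integrand (e h : R -> R) (phi : R -> R -> R) (t x : R) : R :=
  e (x / t) * D1 phi t x + (h (x / t) + x / t * e (x / t)) * D2 phi t x.

(** In the variable y = x / t, the integrand is [sector_dt] plus the derivative of [h y * phi
    t (t * y)], because [h' = - e]. *)
Lemma is_RInt_sector (e h : R -> R) (phi : R -> R -> R) (x1 x2 t : R) :
  0 < t -> (forall x, continuous e x) -> (forall x, is_derive h x (- e x)) ->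
  C1_on (fun _ => True) phi ->
  is_RInt (sector_integrand e h phi t) (t * x1) (t * x2)
    (RInt (sector_dt e phi t) x1 x2 + (h x2 * phi t (t * x2) - h x1 * phi t (t * x1))).
Proof.
  intros Ht He Hh H.
  assert (Ch : forall x, continuous h x) by (intros; eapply is_derive_continuous, Hh).
  assert (I1 : is_RInt (sector_dt e phi t) x1 x2 (RInt (sector_dt e phi t) x1 x2)).
  { apply RInt_correct_R, ex_RInt_continuous_R.
    intros y _. apply (continuous_section (sector_dt e phi)), continuous_sector_dt; assumption. }
  assert (I2 : is_RInt (fun y => - e y * phi t (t * y) + h y * (t * D2 phi t (t * y))) x1 x2
                 (h x2 * phi t (t * x2) - h x1 * phi t (t * x1))).
  { apply (is_RInt_derive_R (fun y => h y * phi t (t * y))).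
    - intros y _. apply (is_derive_mult h (fun y => phi t (t * y))); [apply Hh| |intros; apply Rmult_comm].
      evar_last.
      + apply (is_derive_comp (fun s => phi t s) (fun y => t * y) y (D2 phi t (t * y)) t).
        * apply Derive_correct. apply (H t (t * y) I).
        * auto_derive; [trivial|ring].
      + unfold scal; simpl. reflexivity.
    - intros y _. apply (continuous_section (fun t y => - e y * phi t (t * y) + h y * (t * D2 phi t (t * y)))).
      apply continuous_Rplus.
      + apply continuous_Rmult.
        * apply continuous_Ropp, (continuous_snd_comp e), He.
        * apply (continuous_ray phi), test_continuous, H.
      + apply continuous_Rmult; [apply (continuous_snd_comp h), Ch|].
        apply continuous_Rmult; [apply continuous_fst|].
        apply (continuous_ray (D2 phi)), test_continuous_D2, H. }
  assert (I3 := is_RInt_plus (V := R_NormedModule) _ _ _ _ _ _ I1 I2).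
  assert (Hit : / t * (t * x1) + 0 = x1 /\ / t * (t * x2) + 0 = x2) by (split; field; lra).
  destruct Hit as [Hx1 Hx2].
  rewrite <- Hx1 in I3 at 1. rewrite <- Hx2 in I3 at 1.
  apply (is_RInt_comp_lin (V := R_NormedModule)) in I3.
  eapply is_RInt_ext; [|exact I3].
  intros x _. unfold sector_integrand, sector_dt, scal, plus; simpl. unfold mult; simpl.
  replace (t * (/ t * x + 0)) with x by (field; lra).
  replace (/ t * x + 0) with (x / t) by (unfold Rdiv; ring).
  field. lra.
Qed.

Lemma test_outside (phi : R -> R -> R) (a b M t x : R) :
  test_function phi a b M -> M < Rabs x -> phi t x = 0 /\ D1 phi t x = 0 /\ D2 phi t x = 0.
Proof.
  intros [_ [HM [_ Hz]]] Hx.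
  assert (Z : forall s y, M < Rabs y -> phi s y = 0).
  { intros s y Hy. apply Hz. intros [_ K]. assert (Rabs y <= M) by (apply Rabs_le; lra). lra. }
  split; [apply Z, Hx|]. split.
  - unfold D1. rewrite (Derive_ext _ (fun _ => 0)) by (intros; apply Z, Hx). apply Derive_const.
  - unfold D2. rewrite (Derive_ext_loc _ (fun _ => 0)); [apply Derive_const|].
    exists (mkposreal (Rabs x - M) ltac:(lra)). intros y Hy.
    change (Rabs (y - x) < Rabs x - M) in Hy. apply Z.
    assert (T := Rabs_triang y (x - y)). replace (y + (x - y)) with x in T by ring.
    rewrite (Rabs_minus_sym x y) in T. lra.
Qed.

Lemma continuous_zero_limit (f : R -> R) (x : R) :
  continuous f x -> (forall d, 0 < d -> exists y, Rabs (y - x) < d /\ f y = 0) -> f x = 0.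
Proof.
  intros Hf H. apply cond_eq. intros e He. rewrite Rminus_0_r.
  destruct (proj1 (continuous_eps _ _) Hf e He) as [d [Hd K]].
  destruct (H d Hd) as [y [Hy Ey]]. specialize (K y Hy).
  rewrite Ey, Rminus_0_l, Rabs_Ropp in K. exact K.
Qed.

Lemma test_boundary (phi : R -> R -> R) (a b M x : R) :
  test_function phi a b M -> phi a x = 0 /\ phi b x = 0.
Proof.
  intros [Hab [HM [HC Hz]]].
  assert (C : forall t, continuous (fun s => phi s x) t).
  { intros t. apply (ex_derive_continuous (fun s => phi s x)). apply (HC t x I). }
  split; apply (continuous_zero_limit (fun s => phi s x)); auto; intros d Hd.
  - exists (a - d / 2). split; [rewrite Rabs_left; lra|]. apply Hz. lra.
  - exists (b + d / 2). split; [rewrite Rabs_pos_eq; lra|]. apply Hz. lra.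
Qed.

(** By [is_RInt_sector] the inner integral is a time derivative plus boundary terms. The
    former integrates to 0, as [phi] vanishes at both ends of its time interval, and among the
    latter only those on the ray [x = s t] remain. *)
Lemma two_sector_pairing (e f el hl er hr : R -> R) (s : R) (phi : R -> R -> R) (a b M : R) :
  (forall x, continuous el x) -> (forall x, is_derive hl x (- el x)) ->
  (forall x, continuous er x) -> (forall x, is_derive hr x (- er x)) ->
  (forall x, x < s -> e x = el x /\ f x = hl x + x * el x) ->
  (forall x, s < x -> e x = er x /\ f x = hr x + x * er x) ->
  test_function phi a b M ->
  weak_pairing (fun t x => e (x / t)) (fun t x => f (x / t)) phi a b M =
  (hl s - hr s) * RInt (fun t => phi t (t * s)) a b.
Proof.
  intros Cl Dl Cr Dr Hl Hr T. assert (T' := T). destruct T' as [Hab [HM [HC _]]].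
  (* The rays x = K t and x = - K t stay outside the support of phi. *)
  set (K := M / a + Rabs s + 1).
  assert (HMa : 0 < M / a) by (apply Rdiv_lt_0_compat; lra).
  assert (HsK : - K < s < K).
  { unfold K. generalize (Rle_abs s) (Rle_abs (- s)). rewrite Rabs_Ropp. lra. }
  assert (HKM : forall t, a <= t -> M < t * K).
  { intros t Ht. assert (M = a * (M / a)) by (field; lra).
    assert (M / a < K) by (unfold K; generalize (Rabs_pos s); lra). nra. }
  set (G := fun t => RInt (sector_dt el phi t) (- K) s + RInt (sector_dt er phi t) s K).
  assert (In : forall t, a < t < b ->
    RInt (fun x => e (x / t) * D1 phi t x + f (x / t) * D2 phi t x) (- M) M =
    G t + (hl s - hr s) * phi t (t * s)).
  { intros t Ht. assert (Kt := HKM t ltac:(lra)).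
    set (g := fun x => e (x / t) * D1 phi t x + f (x / t) * D2 phi t x).
    assert (IL := is_RInt_sector el hl phi (- K) s t ltac:(lra) Cl Dl HC).
    assert (IR := is_RInt_sector er hr phi s K t ltac:(lra) Cr Dr HC).
    rewrite (proj1 (test_outside phi a b M t (t * - K) T
      ltac:(rewrite Rabs_left; nra))) in IL.
    rewrite (proj1 (test_outside phi a b M t (t * K) T ltac:(rewrite Rabs_pos_eq; nra))) in IR.
    assert (IL' : is_RInt g (t * - K) (t * s)
       (RInt (sector_dt el phi t) (- K) s + (hl s * phi t (t * s) - hl (- K) * 0))).
    { eapply is_RInt_ext; [|exact IL]. intros x Hx.
      rewrite Rmin_left, Rmax_right in Hx by nra.
      destruct (Hl (x / t)) as [E1 E2]; [apply Rlt_div_l; lra|].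
      unfold g, sector_integrand. rewrite E1, E2. reflexivity. }
    assert (IR' : is_RInt g (t * s) (t * K)
       (RInt (sector_dt er phi t) s K + (hr K * 0 - hr s * phi t (t * s)))).
    { eapply is_RInt_ext; [|exact IR]. intros x Hx.
      rewrite Rmin_left, Rmax_right in Hx by nra.
      destruct (Hr (x / t)) as [E1 E2]; [apply Rlt_div_r; lra|].
      unfold g, sector_integrand. rewrite E1, E2. reflexivity. }
    assert (IT := is_RInt_Chasles (V := R_NormedModule) _ _ _ _ _ _ IL' IR').
    assert (X : ex_RInt g (t * - K) (t * K)) by (eexists; exact IT).
    assert (X2 : ex_RInt g (- M) (t * K)).
    { apply (ex_RInt_Chasles_2 (V := R_CompleteNormedModule) g (t * - K)); [nra|exact X]. }
    assert (X1 : ex_RInt g (t * - K) (- M)).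
    { apply (ex_RInt_Chasles_1 (V := R_CompleteNormedModule) g _ _ (t * K)); [nra|exact X]. }
    assert (X3 : ex_RInt g (- M) M).
    { apply (ex_RInt_Chasles_1 (V := R_CompleteNormedModule) g _ _ (t * K)); [lra|exact X2]. }
    assert (X4 : ex_RInt g M (t * K)).
    { apply (ex_RInt_Chasles_2 (V := R_CompleteNormedModule) g (- M)); [lra|exact X2]. }
    assert (E1 : RInt g (t * - K) (- M) = 0).
    { rewrite (RInt_ext g (fun _ => 0)); [rewrite RInt_const; apply Rmult_0_r|].
      intros x Hx. rewrite Rmin_left, Rmax_right in Hx by nra.
      destruct (test_outside phi a b M t x T ltac:(rewrite Rabs_left; lra)) as [_ [Z1 Z2]].
      unfold g. rewrite Z1, Z2. eq_in_R. ring. }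
    assert (E2 : RInt g M (t * K) = 0).
    { rewrite (RInt_ext g (fun _ => 0)); [rewrite RInt_const; apply Rmult_0_r|].
      intros x Hx. rewrite Rmin_left, Rmax_right in Hx by nra.
      destruct (test_outside phi a b M t x T ltac:(rewrite Rabs_pos_eq; lra)) as [_ [Z1 Z2]].
      unfold g. rewrite Z1, Z2. eq_in_R. ring. }
    assert (E3 : RInt g (t * - K) (t * K) = RInt g (- M) M).
    { rewrite <- (RInt_Chasles_R g _ (- M) _ X1 X2).
      rewrite <- (RInt_Chasles_R g _ M _ X3 X4).
      rewrite E1, E2. unfold plus; simpl. ring. }
    rewrite <- E3, (is_RInt_unique _ _ _ _ IT). unfold plus, G; simpl. ring. }
  set (Psi := fun t => RInt (fun y => t * (el y * phi t (t * y))) (- K) s +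
                       RInt (fun y => t * (er y * phi t (t * y))) s K).
  assert (IG : is_RInt G a b (Psi b - Psi a)).
  { apply (is_RInt_derive_R Psi).
    - intros t _. apply is_derive_Rplus; apply is_derive_sector_mass; assumption.
    - intros t _. apply continuous_Rplus;
      apply continuous_sector_mass_dt; auto; lra. }
  assert (PZ : forall t, phi t = (fun _ => 0) \/ (forall x, phi t x = 0) -> Psi t = 0).
  { intros t Ht. unfold Psi.
    rewrite (RInt_ext _ (fun _ => 0) (- K) s), (RInt_ext _ (fun _ => 0) s K).
    - rewrite !RInt_const. unfold scal; simpl; unfold mult; simpl. ring.
    - intros y _. destruct Ht as [Ht|Ht]; rewrite Ht; eq_in_R; ring.
    - intros y _. destruct Ht as [Ht|Ht]; rewrite Ht; eq_in_R; ring. }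
  rewrite (PZ a), (PZ b) in IG by (right; intros x; apply (test_boundary phi a b M x T)).
  assert (IP : is_RInt (fun t => phi t (t * s)) a b (RInt (fun t => phi t (t * s)) a b)).
  { apply RInt_correct_R, ex_RInt_continuous_R.
    intros t _. apply (ex_derive_continuous (fun t => phi t (t * s))).
    eexists. apply is_derive_ray, HC. }
  unfold weak_pairing.
  rewrite (RInt_ext _ (fun t => plus (G t) (scal (hl s - hr s) (phi t (t * s))))).
  2:{ intros t Ht. rewrite Rmin_left, Rmax_right in Ht by lra. rewrite In by lra. reflexivity. }
  apply is_RInt_unique. evar_last.
  - apply (is_RInt_plus (V := R_NormedModule)); [exact IG|].
    apply (is_RInt_scal (V := R_NormedModule)). exact IP.
  - unfold plus, scal; simpl. unfold mult; simpl. ring.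
Qed.

(** * Simple waves and shocks *)

(** Entropies without convexity, so as to include the two conserved quantities and to treat
    all three balance laws at once. *)
Record flux_pair (c : R) (eta Q : R -> R -> R) : Prop := {
  pair_C1 : C1_on Omega eta;
  pair_flux_C1 : C1_on Omega Q;
  pair_compat : forall rho q, 0 < rho ->
    D1 Q rho q = (c ^ 2 - (q / rho) ^ 2) * D2 eta rho q /\
    D2 Q rho q = D1 eta rho q + 2 * (q / rho) * D2 eta rho q
}.

Lemma entropy_flux_pair (c : R) (eta Q : R -> R -> R) : entropy_pair c eta Q -> flux_pair c eta Q.
Proof. intros [H1 H2 _ H4]. split; assumption. Qed.

Lemma C1_on_fst : C1_on Omega (fun r q => r).
Proof.
  apply (C1_on_intro _ _ (fun _ _ => 1) (fun _ _ => 0) open_Omega); intros x y _.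
  - apply @is_derive_id.
  - apply @is_derive_const.
  - apply continuous_const.
  - apply continuous_const.
Qed.

Lemma C1_on_snd : C1_on Omega (fun r q => q).
Proof.
  apply (C1_on_intro _ _ (fun _ _ => 0) (fun _ _ => 1) open_Omega); intros x y _.
  - apply @is_derive_const.
  - apply @is_derive_id.
  - apply continuous_const.
  - apply continuous_const.
Qed.

Lemma mass_pair (c : R) : flux_pair c (fun r q => r) (fun r q => q).
Proof.
  split; [apply C1_on_fst|apply C1_on_snd|]. intros r q Hr. unfold D1, D2.
  rewrite !Derive_const, !Derive_id. split; ring.
Qed.

Lemma momentum_pair (c : R) : flux_pair c (fun r q => q) (fun r q => momentum_flux c (r, q)).
Proof.
  assert (E1 : forall x y, Omega (x, y) ->
    is_derive (fun s => momentum_flux c (s, y)) x (c ^ 2 - (y / x) ^ 2)).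
  { intros x y H. unfold Omega in H; simpl in H. unfold momentum_flux; simpl.
    auto_derive; [lra|field; lra]. }
  assert (E2 : forall x y, Omega (x, y) ->
    is_derive (fun s => momentum_flux c (x, s)) y (2 * (y / x))).
  { intros x y H. unfold Omega in H; simpl in H. unfold momentum_flux; simpl.
    auto_derive; [trivial|field; lra]. }
  assert (Cu : forall x y, Omega (x, y) -> continuous (fun z : R * R => snd z / fst z) (x, y)).
  { intros x y H. unfold Omega in H; simpl in H.
    apply (continuous_quot (fun t => t)); [lra|apply continuous_id]. }
  split; [apply C1_on_snd| |].
  - apply (C1_on_intro _ _ _ _ open_Omega E1 E2); intros x y H.
    + apply continuous_Rminus; [apply continuous_const|].
      apply (continuous_comp (fun z : R * R => snd z / fst z) (fun t => t ^ 2)); [apply Cu, H|].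
      apply (ex_derive_continuous (fun t => t ^ 2)). auto_derive. trivial.
    + apply continuous_Rmult; [apply continuous_const|apply Cu, H].
  - intros r q Hr.
    assert (F1 : D1 (fun r q => momentum_flux c (r, q)) r q = c ^ 2 - (q / r) ^ 2)
      by apply is_derive_unique, E1, Hr.
    assert (F2 : D2 (fun r q => momentum_flux c (r, q)) r q = 2 * (q / r))
      by apply is_derive_unique, E2, Hr.
    assert (F3 : D1 (fun r q : R => q) r q = 0) by exact (Derive_const q r).
    assert (F4 : D2 (fun r q : R => q) r q = 1) by exact (Derive_id q).
    rewrite F1, F2, F3, F4. split; ring.
Qed.

(** Continuous self-similar solutions, with the balance laws in the form [h' = - e] that
    [two_sector_pairing] uses. *)
Record simple_wave (c : R) (W : R -> state) : Prop := {
  wave_Omega : forall x, Omega (W x);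
  wave_continuous : forall x, continuous W x;
  wave_balance : forall eta Q, flux_pair c eta Q -> forall x,
    is_derive (fun y => Q (fst (W y)) (snd (W y)) - y * eta (fst (W y)) (snd (W y))) x
      (- eta (fst (W x)) (snd (W x)))
}.

Lemma const_wave (c : R) (U : state) : Omega U -> simple_wave c (fun _ => U).
Proof.
  intros HU. split; [auto|intros; apply continuous_const|].
  intros eta Q _ x. auto_derive; [trivial|ring].
Qed.

(** Here [u - x] has the constant value [k], which is [c] in a 1-fan and [- c] in a 2-fan. *)
Definition fan (k r1 x1 x : R) : state :=
  (r1 * exp (- (x - x1) / k), r1 * exp (- (x - x1) / k) * (x + k)).

(** A fan satisfies [q' = x rho'], so that the balance reduces to [(c ^ 2 - (u - x) ^ 2) * D2
    eta * rho' = 0]. *)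
Lemma fan_wave (c k r1 x1 : R) : k ^ 2 = c ^ 2 -> k <> 0 -> 0 < r1 ->
  simple_wave c (fan k r1 x1).
Proof.
  intros Hk Hk0 Hr.
  set (r := fun x => r1 * exp (- (x - x1) / k)).
  assert (Pr : forall x, 0 < r x) by (intros; apply Rmult_lt_0_compat; [lra|apply exp_pos]).
  assert (Dr : forall x, is_derive r x (- (r x / k))).
  { intros x. unfold r. auto_derive; [trivial|]. unfold Rminus, Rdiv. ring. }
  assert (Dq : forall x, is_derive (fun x => r x * (x + k)) x (- (r x / k) * x)).
  { intros x. evar_last.
    - apply (is_derive_mult r (fun x => x + k) x (- (r x / k)) 1);
        [apply Dr| |intros; apply Rmult_comm].
      auto_derive; [trivial|ring].
    - unfold plus, mult; simpl. field. exact Hk0. }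
  split.
  - intros x. apply Pr.
  - intros x. unfold fan.
    apply (continuous_comp_2 r (fun x => r x * (x + k)) (fun a b : R => (a, b))).
    + eapply is_derive_continuous, Dr.
    + eapply is_derive_continuous, Dq.
    + eapply continuous_ext; [|apply continuous_id]. intros [a b]; reflexivity.
  - intros eta Q [H1 H2 H3] x. simpl. fold (r x).
    destruct (H3 (r x) (r x * (x + k)) (Pr x)) as [E1 E2].
    assert (K1 := C1_on_chain Omega Q r (fun x => r x * (x + k)) x _ _ open_Omega H2 (Pr x) (Dr x) (Dq x)).
    assert (K2 := C1_on_chain Omega eta r (fun x => r x * (x + k)) x _ _ open_Omega H1 (Pr x) (Dr x) (Dq x)).
    cbv beta in K1, K2.
    set (fQ := fun s => Q (r s) (r s * (s + k))) in *.
    set (fe := fun s => eta (r s) (r s * (s + k))) in *.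
    change (is_derive (fun y => fQ y - y * fe y) x (- fe x)).
    assert (K3 := is_derive_mult (fun y : R => y) fe x 1 _ (is_derive_id x) K2 Rmult_comm).
    assert (K4 := is_derive_Rminus fQ (fun y => y * fe y) x _ _ K1 K3).
    evar_last.
    + exact K4.
    + rewrite E1, E2. unfold minus, plus, opp, mult, one, fe; simpl.
      replace (r x * (x + k) / r x) with (x + k) by (field; apply Rgt_not_eq, Pr).
      set (e1 := D1 eta (r x) (r x * (x + k))). set (e2 := D2 eta (r x) (r x * (x + k))).
      set (e := eta (r x) (r x * (x + k))).
      transitivity (- e + - (r x / k) * (c ^ 2 - k ^ 2) * e2); [ring|].
      rewrite Hk. ring.
Qed.

Lemma is_derive_glue (f f1 f2 : R -> R) (x l : R) :
  is_derive f1 x l -> is_derive f2 x l ->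
  (forall y, y <= x -> f y = f1 y) -> (forall y, x <= y -> f y = f2 y) ->
  is_derive f x l.
Proof.
  intros H1 H2 E1 E2. apply is_derive_Reals. apply is_derive_Reals in H1. apply is_derive_Reals in H2.
  intros e He. destruct (H1 e He) as [d1 K1]. destruct (H2 e He) as [d2 K2].
  exists (mkposreal (Rmin d1 d2) (Rmin_pos _ _ (cond_pos d1) (cond_pos d2))).
  intros h Hh Hd. simpl in Hd.
  assert (Rabs h < d1) by (eapply Rlt_le_trans; [exact Hd|apply Rmin_l]).
  assert (Rabs h < d2) by (eapply Rlt_le_trans; [exact Hd|apply Rmin_r]).
  destruct (Rle_dec 0 h).
  - rewrite (E2 (x + h)), (E2 x) by lra. auto.
  - rewrite (E1 (x + h)), (E1 x) by lra. auto.
Qed.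

Lemma continuous_Rmax_l (a x : R) : continuous (Rmax a) x.
Proof.
  apply continuous_eps. intros e He. exists e. split; [assumption|].
  intros y Hy. eapply Rle_lt_trans; [|exact Hy].
  unfold Rmax. destruct (Rle_dec a x), (Rle_dec a y);
  unfold Rabs; repeat destruct Rcase_abs; lra.
Qed.

Lemma continuous_Rmin_r (a x : R) : continuous (fun y => Rmin y a) x.
Proof.
  apply continuous_eps. intros e He. exists e. split; [assumption|].
  intros y Hy. eapply Rle_lt_trans; [|exact Hy].
  unfold Rmin. destruct (Rle_dec x a), (Rle_dec y a);
  unfold Rabs; repeat destruct Rcase_abs; lra.
Qed.

(** At [a] the balance law gives the same derivative on both sides. Together with [wave_stop]
    this turns a fan on the whole line into one between two constant states, and allows the
    fan to be empty. *)
Lemma wave_start (c a : R) (W : R -> state) :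
  simple_wave c W -> simple_wave c (fun x => W (Rmax a x)).
Proof.
  intros [H1 H2 H3]. split; [auto| |].
  - intros x. apply (continuous_comp (Rmax a) W); [apply continuous_Rmax_l|apply H2].
  - intros eta Q HP x.
    assert (K1 := wave_balance c _ (const_wave c (W a) (H1 a)) eta Q HP x). simpl in K1.
    assert (K2 := H3 eta Q HP x).
    destruct (Rtotal_order x a) as [Hx|[->|Hx]].
    + rewrite Rmax_left by lra. eapply is_derive_ext_loc; [|exact K1].
      exists (mkposreal (a - x) ltac:(lra)). intros y Hy.
      change (Rabs (y - x) < a - x) in Hy. apply Rabs_def2 in Hy.
      rewrite Rmax_left by lra. reflexivity.
    + rewrite Rmax_left by lra.
      eapply is_derive_glue; [exact K1|exact K2| |]; intros y Hy; simpl.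
      * rewrite Rmax_left by lra. reflexivity.
      * rewrite Rmax_right by lra. reflexivity.
    + rewrite Rmax_right by lra. eapply is_derive_ext_loc; [|exact K2].
      exists (mkposreal (x - a) ltac:(lra)). intros y Hy.
      change (Rabs (y - x) < x - a) in Hy. apply Rabs_def2 in Hy.
      rewrite Rmax_right by lra. reflexivity.
Qed.

Lemma wave_stop (c a : R) (W : R -> state) :
  simple_wave c W -> simple_wave c (fun x => W (Rmin x a)).
Proof.
  intros [H1 H2 H3]. split; [auto| |].
  - intros x. apply (continuous_comp (fun y => Rmin y a) W); [apply continuous_Rmin_r|apply H2].
  - intros eta Q HP x.
    assert (K1 := wave_balance c _ (const_wave c (W a) (H1 a)) eta Q HP x). simpl in K1.
    assert (K2 := H3 eta Q HP x).
    destruct (Rtotal_order x a) as [Hx|[->|Hx]].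
    + rewrite Rmin_left by lra. eapply is_derive_ext_loc; [|exact K2].
      exists (mkposreal (a - x) ltac:(lra)). intros y Hy.
      change (Rabs (y - x) < a - x) in Hy. apply Rabs_def2 in Hy.
      rewrite Rmin_left by lra. reflexivity.
    + rewrite Rmin_left by lra.
      eapply is_derive_glue; [exact K2|exact K1| |]; intros y Hy; simpl.
      * rewrite Rmin_left by lra. reflexivity.
      * rewrite Rmin_right by lra. reflexivity.
    + rewrite Rmin_right by lra. eapply is_derive_ext_loc; [|exact K1].
      exists (mkposreal (x - a) ltac:(lra)). intros y Hy.
      change (Rabs (y - x) < x - a) in Hy. apply Rabs_def2 in Hy.
      rewrite Rmin_right by lra. reflexivity.
Qed.

Definition glue (s : R) (Wl Wr : R -> state) (x : R) : state :=
  if Rlt_dec x s then Wl x else Wr x.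

Lemma glue_left (s : R) (Wl Wr : R -> state) (x : R) : x < s -> glue s Wl Wr x = Wl x.
Proof. intros. unfold glue. destruct (Rlt_dec x s); [reflexivity|lra]. Qed.

Lemma glue_right (s : R) (Wl Wr : R -> state) (x : R) : s <= x -> glue s Wl Wr x = Wr x.
Proof. intros. unfold glue. destruct (Rlt_dec x s); [lra|reflexivity]. Qed.

Definition jump (eta Q : R -> R -> R) (s : R) (Ul Ur : state) : R :=
  (Q (fst Ul) (snd Ul) - s * eta (fst Ul) (snd Ul)) -
  (Q (fst Ur) (snd Ur) - s * eta (fst Ur) (snd Ur)).

Lemma glue_pairing (c s : R) (Wl Wr : R -> state) (eta Q phi : R -> R -> R) (a b M : R) :
  simple_wave c Wl -> simple_wave c Wr -> flux_pair c eta Q -> test_function phi a b M ->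
  weak_pairing (fun t x => eta (fst (glue s Wl Wr (x / t))) (snd (glue s Wl Wr (x / t))))
    (fun t x => Q (fst (glue s Wl Wr (x / t))) (snd (glue s Wl Wr (x / t)))) phi a b M =
  jump eta Q s (Wl s) (Wr s) * RInt (fun t => phi t (t * s)) a b.
Proof.
  intros [L1 L2 L3] [R1 R2 R3] HP HT.
  assert (Ce : forall W : R -> state, (forall x, Omega (W x)) -> (forall x, continuous W x) ->
    forall x, continuous (fun y => eta (fst (W y)) (snd (W y))) x).
  { intros W HW CW x. apply (continuous_comp W (fun U : R * R => eta (fst U) (snd U))); [apply CW|].
    assert (HX := HW x). destruct (W x) as [p q].
    apply (C1_on_continuous Omega); [exact open_Omega|apply HP|exact HX]. }
  apply (two_sector_pairing
    (fun x => eta (fst (glue s Wl Wr x)) (snd (glue s Wl Wr x)))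
    (fun x => Q (fst (glue s Wl Wr x)) (snd (glue s Wl Wr x)))
    (fun x => eta (fst (Wl x)) (snd (Wl x)))
    (fun x => Q (fst (Wl x)) (snd (Wl x)) - x * eta (fst (Wl x)) (snd (Wl x)))
    (fun x => eta (fst (Wr x)) (snd (Wr x)))
    (fun x => Q (fst (Wr x)) (snd (Wr x)) - x * eta (fst (Wr x)) (snd (Wr x))) s phi a b M); auto.
  - intros x Hx. rewrite glue_left by lra. split; ring.
  - intros x Hx. rewrite glue_right by lra. split; ring.
Qed.

(** By [glue_pairing] each weak equation reduces to the jump at [s]. *)
Lemma glue_riemann (c s xl xr : R) (Ua Ub : state) (Wl Wr : R -> state) :
  simple_wave c Wl -> simple_wave c Wr ->
  jump (fun r q => r) (fun r q => q) s (Wl s) (Wr s) = 0 ->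
  jump (fun r q => q) (fun r q => momentum_flux c (r, q)) s (Wl s) (Wr s) = 0 ->
  (forall eta Q, entropy_pair c eta Q -> 0 <= jump eta Q s (Wl s) (Wr s)) ->
  xl <= s -> s <= xr ->
  (forall x, x < xl -> Wl x = Ua) -> (forall x, xr < x -> Wr x = Ub) ->
  riemann_solution c Ua Ub (glue s Wl Wr).
Proof.
  intros HL HR J1 J2 J3 Hxl Hxr Ea Eb.
  assert (LL : forall x, x <= s -> filterlim (glue s Wl Wr) (at_left x) (locally (Wl x))).
  { intros x Hx. apply (filterlim_ext_loc Wl).
    - exists (mkposreal 1 Rlt_0_1). intros y _ Hy. symmetry. apply glue_left. lra.
    - intros P HP. apply (filter_le_within _ _). apply (wave_continuous c Wl HL x P HP). }
  assert (RL : forall x, s < x -> filterlim (glue s Wl Wr) (at_left x) (locally (Wr x))).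
  { intros x Hx. apply (filterlim_ext_loc Wr).
    - exists (mkposreal (x - s) ltac:(lra)). intros y Hy _.
      change (Rabs (y - x) < x - s) in Hy. apply Rabs_def2 in Hy.
      symmetry. apply glue_right. lra.
    - intros P HP. apply (filter_le_within _ _). apply (wave_continuous c Wr HR x P HP). }
  assert (RR : forall x, s <= x -> filterlim (glue s Wl Wr) (at_right x) (locally (Wr x))).
  { intros x Hx. apply (filterlim_ext_loc Wr).
    - exists (mkposreal 1 Rlt_0_1). intros y _ Hy. symmetry. apply glue_right. lra.
    - intros P HP. apply (filter_le_within _ _). apply (wave_continuous c Wr HR x P HP). }
  assert (LR : forall x, x < s -> filterlim (glue s Wl Wr) (at_right x) (locally (Wl x))).
  { intros x Hx. apply (filterlim_ext_loc Wl).
    - exists (mkposreal (s - x) ltac:(lra)). intros y Hy _.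
      change (Rabs (y - x) < s - x) in Hy. apply Rabs_def2 in Hy.
      symmetry. apply glue_left. lra.
    - intros P HP. apply (filter_le_within _ _). apply (wave_continuous c Wl HL x P HP). }
  split.
  - intros x. split; [|split].
    + unfold glue. destruct (Rlt_dec x s); [apply HL|apply HR].
    + destruct (Rle_dec x s).
      * exists (Wl x). split; [apply HL|apply LL; lra].
      * exists (Wr x). split; [apply HR|apply RL; lra].
    + destruct (Rlt_dec x s).
      * exists (Wl x). split; [apply HL|apply LR; lra].
      * exists (Wr x). split; [apply HR|apply RR; lra].
  - split.
    + intros phi a b M HT.
      rewrite (glue_pairing c s Wl Wr (fun r q => r) (fun r q => q)) by (auto using mass_pair).
      rewrite J1. ring.
    + intros phi a b M HT.
      assert (K := glue_pairing c s Wl Wr (fun r q => q) (fun r q => momentum_flux c (r, q))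
        phi a b M HL HR (momentum_pair c) HT).
      rewrite J2, Rmult_0_l in K. rewrite <- K.
      unfold weak_pairing. apply RInt_ext. intros t _. apply RInt_ext. intros x _.
      simpl. reflexivity.
    + intros eta Q HE phi a b M HT Hp.
      rewrite (glue_pairing c) by (auto using entropy_flux_pair).
      apply Rmult_le_pos; [auto|].
      assert (HC : C1_on (fun _ => True) phi) by apply HT.
      apply RInt_ge_0; [destruct HT; lra| |intros; apply Hp].
      apply ex_RInt_continuous_R. intros t _.
      apply (ex_derive_continuous (fun t => phi t (t * s))).
      eexists. apply is_derive_ray, HC.
  - intros x Hx.
    apply (filterlim_ext_loc (fun _ => Ua)); [|apply filterlim_const].
    set (d := - x / (Rabs xl + 1)).
    assert (Hd : 0 < d) by (apply Rdiv_lt_0_compat; [lra|generalize (Rabs_pos xl); lra]).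
    exists (mkposreal d Hd). intros t Ht Ht0.
    change (Rabs (t - 0) < d) in Ht. rewrite Rminus_0_r, Rabs_pos_eq in Ht by lra.
    assert (Hlt : x / t < xl).
    { apply Rlt_div_l; [lra|]. unfold d in Ht.
      apply Rlt_div_r in Ht; [|generalize (Rabs_pos xl); lra].
      generalize (Rle_abs (- xl)). rewrite Rabs_Ropp. nra. }
    rewrite glue_left by lra. symmetry. apply Ea, Hlt.
  - intros x Hx.
    apply (filterlim_ext_loc (fun _ => Ub)); [|apply filterlim_const].
    set (d := x / (Rabs xr + 1)).
    assert (Hd : 0 < d) by (apply Rdiv_lt_0_compat; [lra|generalize (Rabs_pos xr); lra]).
    exists (mkposreal d Hd). intros t Ht Ht0.
    change (Rabs (t - 0) < d) in Ht. rewrite Rminus_0_r, Rabs_pos_eq in Ht by lra.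
    assert (Hlt : xr < x / t).
    { apply Rlt_div_r; [lra|]. unfold d in Ht.
      apply Rlt_div_r in Ht; [|generalize (Rabs_pos xr); lra].
      generalize (Rle_abs xr). nra. }
    rewrite glue_right by lra. symmetry. apply Eb, Hlt.
Qed.

(** The chord slopes at [S] in the direction of [U] are at most the full increment, and they
    tend to the directional derivative. *)
Lemma convex_gradient (c : R) (eta Q : R -> R -> R) (S U : state) :
  entropy_pair c eta Q -> Omega S -> Omega U ->
  eta (fst S) (snd S) + D1 eta (fst S) (snd S) * (fst U - fst S) +
    D2 eta (fst S) (snd S) * (snd U - snd S) <= eta (fst U) (snd U).
Proof.
  intros HE HS HU.
  destruct S as [r q]. destruct U as [r' q']. unfold Omega in *. simpl in *.
  set (g := fun l => eta (r + l * (r' - r)) (q + l * (q' - q))).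
  assert (Dg : is_derive g 0 (D1 eta r q * (r' - r) + D2 eta r q * (q' - q))).
  { assert (K := C1_on_chain Omega eta (fun l => r + l * (r' - r)) (fun l => q + l * (q' - q)) 0
      (r' - r) (q' - q) open_Omega (entropy_C1 _ _ _ HE)).
    cbv beta in K.
    replace (r + 0 * (r' - r)) with r in K by ring.
    replace (q + 0 * (q' - q)) with q in K by ring.
    apply K; [exact HS| |]; auto_derive; trivial; ring. }
  set (L := D1 eta r q * (r' - r) + D2 eta r q * (q' - q)) in *.
  apply Rnot_lt_le. intro Hlt.
  apply is_derive_Reals in Dg.
  set (e := eta r q + L - eta r' q').
  destruct (Dg e) as [d K]; [unfold e, L; lra|].
  set (l := Rmin 1 (d / 2)).
  assert (Hd := cond_pos d).
  assert (Hl : 0 < l) by (apply Rmin_pos; lra).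
  assert (l <= 1) by apply Rmin_l. assert (l <= d / 2) by apply Rmin_r.
  specialize (K l ltac:(lra) ltac:(rewrite Rabs_pos_eq; lra)).
  rewrite Rplus_0_l in K.
  assert (Cv := entropy_convex _ _ _ HE (r', q') (r, q) l HU HS ltac:(lra)). simpl in Cv.
  replace (l * r' + (1 - l) * r) with (r + l * (r' - r)) in Cv by ring.
  replace (l * q' + (1 - l) * q) with (q + l * (q' - q)) in Cv by ring.
  fold (g l) in Cv.
  assert (G0 : g 0 = eta r q) by (unfold g; f_equal; ring).
  rewrite G0 in K.
  assert ((g l - eta r q) / l <= eta r' q' - eta r q) by (apply Rle_div_l; lra).
  apply Rabs_def2 in K. unfold e in K. lra.
Qed.

(** The state behind the 1-shock of speed [u0 - c * s] that leaves the state of density [r0]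
    and velocity [u0]. *)
Definition shock_state (c r0 u0 s : R) : state :=
  (r0 * s ^ 2, r0 * (u0 * s ^ 2 - c * (s ^ 3 - s))).

(** The jump vanishes at [s = 1]. By the Rankine-Hugoniot relation and the compatibility of
    [Q] with [eta], its derivative in [s] is [c] times the excess of [eta] at the left state
    over its tangent plane at the shock state, which is nonnegative by convexity. *)
Lemma shock_entropy (c r0 u0 s : R) (eta Q : R -> R -> R) :
  0 < c -> 0 < r0 -> 1 <= s -> entropy_pair c eta Q ->
  0 <= jump eta Q (u0 - c * s) (r0, r0 * u0) (shock_state c r0 u0 s).
Proof.
  intros Hc Hr Hs HE.
  set (U := (r0, r0 * u0) : state).
  set (rho := fun s => r0 * s ^ 2). set (q := fun s => r0 * (u0 * s ^ 2 - c * (s ^ 3 - s))).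
  assert (Pr : forall s, 0 < s -> 0 < rho s).
  { intros t Ht. unfold rho. apply Rmult_lt_0_compat; [lra|]. apply pow_lt, Ht. }
  set (E := fun s => jump eta Q (u0 - c * s) U (shock_state c r0 u0 s)).
  set (dE := fun s => c * (eta r0 (r0 * u0) - eta (rho s) (q s)
     - D1 eta (rho s) (q s) * (r0 - rho s) - D2 eta (rho s) (q s) * (r0 * u0 - q s))).
  assert (DE : forall s, 0 < s -> is_derive E s (dE s)).
  { intros t Ht. destruct HE as [H1 H2 _ H4].
    assert (Dr : is_derive rho t (r0 * (2 * t))) by (unfold rho; auto_derive; [trivial|ring]).
    assert (Dq : is_derive q t (r0 * (u0 * (2 * t) - c * (3 * t ^ 2 - 1))))
      by (unfold q; auto_derive; [trivial|ring]).
    assert (K1 := C1_on_chain Omega Q rho q t _ _ open_Omega H2 (Pr t Ht) Dr Dq).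
    assert (K2 := C1_on_chain Omega eta rho q t _ _ open_Omega H1 (Pr t Ht) Dr Dq).
    destruct (H4 (rho t) (q t) (Pr t Ht)) as [E1 E2].
    unfold E, jump, shock_state, U. simpl fst. simpl snd.
    fold (rho t) (q t).
    apply (is_derive_ext (fun s => (Q r0 (r0 * u0) - (u0 - c * s) * eta r0 (r0 * u0)) -
       (Q (rho s) (q s) - (u0 - c * s) * eta (rho s) (q s)))); [reflexivity|].
    evar_last.
    - apply is_derive_Rminus.
      + instantiate (1 := c * eta r0 (r0 * u0)). auto_derive; [trivial|ring].
      + apply is_derive_Rminus; [exact K1|].
        apply (is_derive_mult (fun s => u0 - c * s)); [|exact K2|intros; apply Rmult_comm].
        instantiate (1 := - c). auto_derive; [trivial|ring].
    - rewrite E1, E2. unfold minus, plus, opp, mult; simpl. unfold dE.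
      set (e1 := D1 eta (rho t) (q t)). set (e2 := D2 eta (rho t) (q t)).
      set (e := eta (rho t) (q t)). unfold rho, q. field. lra. }
  destruct (MVT_gen E 1 s dE) as [z [Hz Ez]].
  - rewrite Rmin_left, Rmax_right by lra. intros x Hx. apply DE. lra.
  - rewrite Rmin_left, Rmax_right by lra. intros x Hx. apply continuity_pt_filterlim.
    eapply is_derive_continuous, DE. lra.
  - rewrite Rmin_left, Rmax_right in Hz by lra.
    assert (E1 : E 1 = 0).
    { assert (S1 : shock_state c r0 u0 1 = U) by (unfold shock_state, U; f_equal; ring).
      unfold E. rewrite S1. unfold jump. ring. }
    assert (0 <= dE z).
    { assert (G := convex_gradient c eta Q (rho z, q z) U HE (Pr z ltac:(lra)) Hr).
      simpl in G. unfold dE. apply Rmult_le_pos; lra. }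
    change (0 <= E s). nra.
Qed.

Lemma shock_conservation (c r0 u0 s : R) : 0 < r0 -> 0 < s ->
  jump (fun r q => r) (fun r q => q) (u0 - c * s) (r0, r0 * u0) (shock_state c r0 u0 s) = 0 /\
  jump (fun r q => q) (fun r q => momentum_flux c (r, q)) (u0 - c * s) (r0, r0 * u0)
    (shock_state c r0 u0 s) = 0.
Proof.
  intros Hr Hs. unfold jump, shock_state, momentum_flux; simpl. split; [ring|field].
  split; lra.
Qed.

(** * Construction of the reachable states *)

Lemma continuous_u_drop (x : R) : continuous u_drop x.
Proof.
  unfold u_drop.
  assert (Cs : forall x, continuous (fun y => exp (y / 2) - exp (- (y / 2))) x).
  { intros y. apply (ex_derive_continuous (fun y => exp (y / 2) - exp (- (y / 2)))). auto_derive. trivial. }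
  apply (continuous_ext (fun y => y + Rmax 0 (exp (y / 2) - exp (- (y / 2)) - y))).
  - intros y. unfold Rmax. destruct (Rle_dec 0 _), (Rle_dec y _); lra.
  - apply continuous_Rplus; [apply continuous_id|].
    apply (continuous_comp (fun y => exp (y / 2) - exp (- (y / 2)) - y) (Rmax 0)); [|apply continuous_Rmax_l].
    apply continuous_Rminus; [apply Cs|apply continuous_id].
Qed.

Lemma wave_glue_self (s : R) (W : R -> state) (x : R) : glue s W W x = W x.
Proof. unfold glue. destruct (Rlt_dec x s); reflexivity. Qed.

Lemma glue_limit_left (s : R) (Wl Wr : R -> state) (v : R) :
  s < v -> continuous Wr v -> filterlim (glue s Wl Wr) (at_left v) (locally (Wr v)).
Proof.
  intros Hv HC. apply (filterlim_ext_loc Wr).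
  - exists (mkposreal (v - s) ltac:(lra)). intros y Hy _.
    change (Rabs (y - v) < v - s) in Hy. apply Rabs_def2 in Hy.
    symmetry. apply glue_right. lra.
  - intros P HP. apply (filter_le_within _ _). apply (HC P HP).
Qed.

Lemma exp_ln_ratio (c r r0 y : R) : 0 < c -> 0 < r0 -> 0 < r -> y = c * ln (r / r0) ->
  r0 * exp (y / c) = r.
Proof.
  intros Hc H0 Hr ->. replace (c * ln (r / r0) / c) with (ln (r / r0)) by (field; lra).
  rewrite exp_ln by (apply Rdiv_lt_0_compat; lra). field. lra.
Qed.

(** The fan ends at the speed [v + k - c], where [k] is the relative velocity reached, so it
    is complete before [v]. *)
Lemma V_minus_rarefaction (c r0 z v r : R) :
  0 < c -> 0 < r0 -> 0 < r <= r0 -> wave_u c z r0 r <= c ->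
  V_minus c r0 (r0 * z) v (r, r * wave_u c z r0 r).
Proof.
  intros Hc H0 Hr Hk.
  assert (Hln : ln (r / r0) <= 0).
  { rewrite <- ln_1. apply ln_le; [apply Rdiv_lt_0_compat; lra|]. apply Rle_div_l; lra. }
  assert (Ek : wave_u c z r0 r = z - c * ln (r / r0)) by (unfold wave_u; rewrite u_drop_neg by lra; reflexivity).
  set (k := wave_u c z r0 r) in *.
  set (x1 := v + z - c). set (x2 := v + k - c).
  assert (H12 : x1 <= x2) by (unfold x1, x2; nra).
  set (W := fun x => fan c r0 x1 (Rmax x1 (Rmin x x2))).
  assert (HW : simple_wave c W).
  { apply (wave_stop c x2 (fun y => fan c r0 x1 (Rmax x1 y))), wave_start, fan_wave; lra. }
  assert (F1 : fan c r0 x1 x1 = (r0, r0 * z + v * r0)).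
  { unfold fan. replace (- (x1 - x1) / c) with 0 by (field; lra). rewrite exp_0.
    unfold x1. f_equal; ring. }
  assert (F2 : fan c r0 x1 x2 = (r, r * (v + k))).
  { unfold fan. rewrite (exp_ln_ratio c r r0) by (try lra; unfold x1, x2; lra).
    unfold x2. f_equal; ring. }
  exists r, (r * (v + k)). split; [|f_equal; ring].
  exists (r, r * (v + k)), (glue x2 W W). split; [apply Hr|]. split.
  - apply (glue_riemann c x2 x1 x2); auto.
    + unfold jump; ring.
    + unfold jump; ring.
    + intros eta Q _. unfold jump. lra.
    + lra.
    + intros x Hx. unfold W. rewrite Rmin_left, Rmax_left by lra. exact F1.
    + intros x Hx. unfold W. rewrite Rmin_right, Rmax_right by lra. exact F2.
  - apply (filterlim_ext W); [intros; symmetry; apply wave_glue_self|].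
    replace (r, r * (v + k)) with (W v).
    + intros P HP. apply (filter_le_within _ _). apply (wave_continuous c W HW v P HP).
    + unfold W. rewrite Rmin_right, Rmax_right by (unfold x2 in *; lra). exact F2.
Qed.

(** If the velocity behind the shock is below [v - c], a 2-fan starts before [v]. It is
    stopped at [v], where it has reached the density [r] on the sonic line; otherwise the fan
    is empty. *)
Lemma V_minus_shock (c r0 z v rs r : R) :
  0 < c -> 0 < r0 -> z <= c -> r0 < rs -> rs <= r ->
  (rs = r /\ - c <= wave_u c z r0 r \/ wave_u c z r0 rs + c + c * ln (r / rs) = 0) ->
  V_minus c r0 (r0 * z) v (r, r * Rmax (wave_u c z r0 rs) (- c)).
Proof.
  intros Hc H0 Hz Hrs Hr Hcase.
  set (s := sqrt (rs / r0)).
  assert (Hq : 1 < rs / r0) by (apply Rlt_div_r; lra).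
  assert (Es : s ^ 2 = rs / r0) by (unfold s; rewrite <- Rsqr_pow2; apply Rsqr_sqrt; lra).
  assert (Hs : 1 < s) by (unfold s; rewrite <- sqrt_1; apply sqrt_lt_1; lra).
  assert (Ers : rs = r0 * s ^ 2) by (rewrite Es; field; lra).
  set (k := wave_u c z r0 rs) in *.
  assert (Ek : k = z - c * (s - / s)) by (unfold k; rewrite Ers; apply wave_u_sqr; lra).
  set (sg := v + z - c * s).
  set (x1 := v + k + c). set (x2 := Rmax x1 v).
  assert (H12 : x1 <= x2) by apply Rmax_l.
  assert (Hinv : 0 < / s) by (apply Rinv_0_lt_compat; lra).
  assert (Hsg1 : sg <= x1) by (unfold sg, x1; rewrite Ek; nra).
  assert (Hsgv : sg < v) by (unfold sg; nra).
  set (W := fun x => fan (- c) rs x1 (Rmax x1 (Rmin x x2))).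
  assert (HW : simple_wave c W).
  { apply (wave_stop c x2 (fun y => fan (- c) rs x1 (Rmax x1 y))), wave_start, fan_wave; lra. }
  set (UL := (r0, r0 * z + v * r0) : state).
  assert (HUL : UL = (r0, r0 * (v + z))) by (unfold UL; f_equal; ring).
  assert (F1 : fan (- c) rs x1 x1 = (rs, rs * (v + k))).
  { unfold fan. replace (- (x1 - x1) / - c) with 0 by (field; lra). rewrite exp_0.
    unfold x1. f_equal; ring. }
  assert (Wsg : W sg = shock_state c r0 (v + z) s).
  { unfold W. rewrite (Rmin_left sg) by lra. rewrite Rmax_left, F1 by lra.
    unfold shock_state. rewrite Ers, Ek. f_equal. field. lra. }
  assert (Wv : W v = (r, r * (v + Rmax k (- c)))).
  { unfold W. rewrite (Rmin_left v) by (unfold x2; apply Rmax_r).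
    destruct Hcase as [[-> Hk]|Hk].
    - rewrite Rmax_left, F1 by (unfold x1; fold k in Hk; lra). fold k in Hk.
      rewrite (Rmax_left k) by lra. reflexivity.
    - assert (0 <= ln (r / rs)).
      { rewrite <- ln_1. apply ln_le; [lra|]. apply Rle_div_r; lra. }
      assert (k <= - c) by nra.
      rewrite (Rmax_right x1) by (unfold x1; lra). rewrite (Rmax_right k) by lra.
      unfold fan. replace (- (v - x1) / - c) with ((v - x1) / c) by (field; lra).
      rewrite (exp_ln_ratio c r rs) by (try lra; unfold x1; lra).
      f_equal. }
  destruct (shock_conservation c r0 (v + z) s H0 ltac:(lra)) as [J1 J2].
  replace (v + z - c * s) with sg in J1, J2 by (unfold sg; ring).
  rewrite <- Wsg, <- HUL in J1, J2.
  exists r, (r * (v + Rmax k (- c))). split; [|f_equal; ring].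
  exists (fan (- c) rs x1 x2), (glue sg (fun _ => UL) W). split; [|split].
  - unfold fan, Omega; simpl. apply Rmult_lt_0_compat; [lra|apply exp_pos].
  - apply (glue_riemann c sg sg x2); auto.
    + apply const_wave. exact H0.
    + intros eta Q HE. rewrite Wsg, HUL.
      replace sg with (v + z - c * s) by (unfold sg; ring).
      apply shock_entropy; auto; lra.
    + lra.
    + lra.
    + intros x Hx. unfold W. rewrite Rmin_right, Rmax_right by lra. reflexivity.
  - rewrite <- Wv. apply glue_limit_left; [exact Hsgv|]. apply (wave_continuous c W HW).
Qed.

(** If the 1-wave curve is below the sonic line at [r], a shock leads to a lower density from
    which a 2-fan reaches [r] at speed [v]. *)
Lemma V_minus_mem (c r0 a0 v r : R) :
  0 < c -> 0 < r0 -> - c <= a0 / r0 <= c -> 0 < r -> wave_u c (a0 / r0) r0 r <= c ->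
  V_minus c r0 a0 v (r, r * Rmax (wave_u c (a0 / r0) r0 r) (- c)).
Proof.
  intros Hc H0 Hz Hr Hk.
  set (z := a0 / r0) in *.
  replace a0 with (r0 * z) by (unfold z; field; lra).
  destruct (Rle_dec r r0) as [Hrr|Hrr].
  - assert (K := wave_u_antitone c z r0 r r0 Hc H0 Hr Hrr). rewrite wave_u_base in K by lra.
    rewrite Rmax_left by lra. apply V_minus_rarefaction; auto; lra.
  - destruct (Rle_dec (- c) (wave_u c z r0 r)) as [Hsub|Hsup].
    + apply (V_minus_shock c r0 z v r r); auto; lra.
    + set (L := ln (r / r0)).
      assert (HL : 0 < L).
      { unfold L. rewrite <- ln_1. apply ln_increasing; [lra|]. apply Rlt_div_r; lra. }
      (* t is the logarithm of rs / r0: a 2-fan from the state behind the shock raises the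
         velocity by c ln (r / rs), which must lead to the sonic value - c. *)
      destruct (IVT_gen (fun t => z - c * u_drop t + c * (L - t)) 0 L (- c)) as [t [Ht Et]].
      * intros t. apply continuity_pt_filterlim.
        apply (continuous_Rplus (fun t => z - c * u_drop t) (fun t => c * (L - t))).
        -- apply continuous_Rminus; [apply continuous_const|].
           apply continuous_Rmult; [apply continuous_const|apply continuous_u_drop].
        -- apply (ex_derive_continuous (fun t => c * (L - t))). auto_derive. trivial.
      * rewrite u_drop_neg by lra.
        assert (z - c * u_drop L + c * (L - L) < - c).
        { unfold L at 1. change (wave_u c z r0 r + c * (L - L) < - c).
          replace (L - L) with 0 by ring. lra. }
        assert (- c <= z - c * 0 + c * (L - 0)) by nra.
        rewrite Rmin_right, Rmax_left by lra. lra.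
      * rewrite Rmin_left, Rmax_right in Ht by lra.
        assert (Ht0 : 0 < t).
        { destruct (Req_dec t 0) as [->|]; [|lra]. rewrite u_drop_neg in Et by lra. nra. }
        set (rs := r0 * exp t).
        assert (Hrs : r0 < rs).
        { unfold rs. rewrite <- (Rmult_1_r r0) at 1. apply Rmult_lt_compat_l; [lra|].
          rewrite <- exp_0. apply exp_increasing, Ht0. }
        assert (Ekrs : wave_u c z r0 rs = z - c * u_drop t).
        { unfold wave_u, rs. replace (r0 * exp t / r0) with (exp t) by (field; lra).
          rewrite ln_exp. reflexivity. }
        assert (Eln : ln (r / rs) = L - t).
        { unfold rs, L. rewrite !ln_div, ln_mult, ln_exp; try lra; try apply exp_pos.
          apply Rmult_lt_0_compat; [lra|apply exp_pos]. }
        assert (Hle : rs <= r).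
        { unfold rs. replace r with (r0 * exp L).
          - apply Rmult_le_compat_l; [lra|]. destruct (Req_dec t L) as [->|]; [lra|].
            apply Rlt_le, exp_increasing. lra.
          - unfold L. rewrite exp_ln by (apply Rdiv_lt_0_compat; lra). field. lra. }
        replace (Rmax (wave_u c z r0 r) (- c)) with (Rmax (wave_u c z r0 rs) (- c)).
        -- apply (V_minus_shock c r0 z v rs r); auto; [lra|]. right. rewrite Ekrs, Eln. lra.
        -- rewrite !Rmax_right; [reflexivity|lra|]. rewrite Ekrs. nra.
Qed.

(** * Uniqueness of the balanced pair *)

(** The subsonic part of [V_minus] as a graph over the density. *)
Definition branch (c z r0 r : R) : R := r * Rmax (wave_u c z r0 r) (- c).

(** This bounds the slope of [r * wave_u] by [wave_u - c]; it comes from [ln x > 1 - / x]. *)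
Lemma wave_u_gap (c z r0 r1 r2 : R) : 0 < c -> 0 < r0 -> 0 < r1 -> r1 < r2 ->
  r2 * wave_u c z r0 r2 < r1 * wave_u c z r0 r1 - (r2 - r1) * (c - wave_u c z r0 r1).
Proof.
  intros Hc H0 H1 H12.
  assert (K := wave_u_decr c z r0 r1 r2 Hc H0 H1 ltac:(lra)).
  assert (P : 0 < ln (r2 / r1)).
  { rewrite <- ln_1. apply ln_increasing; [lra|]. apply Rlt_div_r; lra. }
  assert (L : 1 - r1 / r2 < ln (r2 / r1)).
  { assert (L := exp_ineq1 (- ln (r2 / r1)) ltac:(lra)).
    rewrite exp_Ropp, exp_ln in L by (apply Rdiv_lt_0_compat; lra).
    replace (/ (r2 / r1)) with (r1 / r2) in L by (field; lra). lra. }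
  assert (K2 : wave_u c z r0 r2 < wave_u c z r0 r1 - c * (1 - r1 / r2)) by nra.
  replace (r1 * wave_u c z r0 r1 - (r2 - r1) * (c - wave_u c z r0 r1))
    with (r2 * (wave_u c z r0 r1 - c * (1 - r1 / r2))) by (field; lra).
  apply Rmult_lt_compat_l; lra.
Qed.

Lemma wave_u_strict (c z r0 r1 r2 : R) : 0 < c -> 0 < r0 -> 0 < r1 -> r1 < r2 ->
  wave_u c z r0 r2 < wave_u c z r0 r1.
Proof.
  intros Hc H0 H1 H12. assert (K := wave_u_decr c z r0 r1 r2 Hc H0 H1 ltac:(lra)).
  assert (0 < ln (r2 / r1)).
  { rewrite <- ln_1. apply ln_increasing; [lra|]. apply Rlt_div_r; lra. }
  nra.
Qed.

Lemma branch_decr (c z r0 r1 r2 : R) : 0 < c -> 0 < r0 -> 0 < r1 -> r1 < r2 ->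
  wave_u c z r0 r1 <= c -> branch c z r0 r2 < branch c z r0 r1.
Proof.
  intros Hc H0 H1 H12 Hk.
  assert (G := wave_u_gap c z r0 r1 r2 Hc H0 H1 H12).
  assert (S := wave_u_strict c z r0 r1 r2 Hc H0 H1 H12).
  unfold branch, Rmax.
  set (k1 := wave_u c z r0 r1) in *. set (k2 := wave_u c z r0 r2) in *.
  assert (0 <= (r2 - r1) * (c - k1)) by (apply Rmult_le_pos; lra).
  assert (0 < c * (r2 - r1)) by (apply Rmult_lt_0_compat; lra).
  destruct (Rle_dec k1 (- c)), (Rle_dec k2 (- c)); try lra.
  assert (0 < r1 * (k1 + c)) by (apply Rmult_lt_0_compat; lra). lra.
Qed.

Lemma branch_slope (c z r0 r1 r2 : R) : 0 < c -> 0 < r0 -> 0 < r1 -> r1 <= r2 ->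
  wave_u c z r0 r1 <= 0 -> c * (r2 - r1) <= branch c z r0 r1 - branch c z r0 r2.
Proof.
  intros Hc H0 H1 H12 Hk.
  destruct (Req_dec r1 r2) as [->|Hne]; [lra|].
  assert (G := wave_u_gap c z r0 r1 r2 Hc H0 H1 ltac:(lra)).
  assert (S := wave_u_strict c z r0 r1 r2 Hc H0 H1 ltac:(lra)).
  unfold branch, Rmax.
  set (k1 := wave_u c z r0 r1) in *. set (k2 := wave_u c z r0 r2) in *.
  assert (0 <= (r2 - r1) * - k1) by (apply Rmult_le_pos; lra).
  destruct (Rle_dec k1 (- c)), (Rle_dec k2 (- c)); try lra.
  assert (0 < r1 * (k1 + c)) by (apply Rmult_lt_0_compat; lra). lra.
Qed.

Lemma branch_le_iff (c z r0 r1 r2 : R) : 0 < c -> 0 < r0 -> 0 < r1 ->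
  wave_u c z r0 r1 <= c -> branch c z r0 r1 <= branch c z r0 r2 -> r2 <= r1.
Proof.
  intros Hc H0 H1 Hk Hb. apply Rnot_lt_le; intro.
  assert (K := branch_decr c z r0 r1 r2 Hc H0 H1 H Hk). lra.
Qed.

Lemma branch_subsonic (c z r0 r : R) : 0 < c -> 0 < r -> wave_u c z r0 r <= c ->
  - (c * r) <= branch c z r0 r <= c * r.
Proof.
  intros Hc Hr Hk. unfold branch.
  assert (- c <= Rmax (wave_u c z r0 r) (- c) <= c).
  { split; [apply Rmax_r|apply Rmax_lub; lra]. }
  nra.
Qed.

Lemma u_drop_surjective (w : R) : exists t, u_drop t = w.
Proof.
  destruct (Rle_dec w 0) as [Hw|Hw]; [exists w; apply u_drop_neg, Hw|].
  destruct (IVT_gen u_drop 0 w w) as [t [_ Et]].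
  - intros t. apply continuity_pt_filterlim, continuous_u_drop.
  - rewrite (u_drop_neg 0) by lra.
    assert (K := u_drop_slope 0 w ltac:(lra)). rewrite (u_drop_neg 0) in K by lra.
    rewrite Rmin_left, Rmax_right by lra. lra.
  - exists t; exact Et.
Qed.

Lemma wave_u_surjective (c z r0 y : R) : 0 < c -> 0 < r0 -> exists r, 0 < r /\ wave_u c z r0 r = y.
Proof.
  intros Hc H0. destruct (u_drop_surjective ((z - y) / c)) as [t Ht].
  exists (r0 * exp t). split; [apply Rmult_lt_0_compat; [lra|apply exp_pos]|].
  unfold wave_u. replace (r0 * exp t / r0) with (exp t) by (field; lra).
  rewrite ln_exp, Ht. field. lra.
Qed.

Lemma continuous_wave_u (c z r0 r : R) : 0 < r0 -> 0 < r -> continuous (wave_u c z r0) r.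
Proof.
  intros H0 Hr. unfold wave_u.
  apply continuous_Rminus; [apply continuous_const|].
  apply continuous_Rmult; [apply continuous_const|].
  apply (continuous_comp (fun r => ln (r / r0)) u_drop); [|apply continuous_u_drop].
  apply (ex_derive_continuous (fun r => ln (r / r0))). auto_derive.
  apply Rdiv_lt_0_compat; lra.
Qed.

Lemma continuous_branch (c z r0 r : R) : 0 < r0 -> 0 < r -> continuous (branch c z r0) r.
Proof.
  intros H0 Hr. unfold branch.
  apply (continuous_Rmult (fun r => r)); [apply continuous_id|].
  apply (continuous_ext (fun r => Rmax (- c) (wave_u c z r0 r))); [intros; apply Rmax_comm|].
  apply (continuous_comp (wave_u c z r0) (Rmax (- c))); [apply continuous_wave_u; assumption|].
  apply continuous_Rmax_l.
Qed.

(** By [branch_slope] the branch lies below a line of slope [- c] through [rs], so it has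
    reached [- a] at [rs + a / c]. *)
Lemma branch_inverse (c z r0 rs a : R) : 0 < c -> 0 < r0 -> 0 < rs ->
  wave_u c z r0 rs = 0 -> 0 <= a ->
  exists y, rs <= y /\ wave_u c z r0 y <= 0 /\ branch c z r0 y = - a.
Proof.
  intros Hc H0 Hrs Hk Ha.
  assert (B0 : branch c z r0 rs = 0) by (unfold branch; rewrite Hk, Rmax_left by lra; ring).
  set (y1 := rs + a / c).
  assert (Hac : 0 <= a / c) by (apply Rdiv_le_0_compat; lra).
  assert (B1 : branch c z r0 y1 <= - a).
  { assert (K := branch_slope c z r0 rs y1 Hc H0 Hrs ltac:(unfold y1; lra) ltac:(lra)).
    replace (c * (y1 - rs)) with a in K by (unfold y1; field; lra). lra. }
  destruct (IVT_gen (fun y => branch c z r0 (Rmax rs y)) rs y1 (- a)) as [y [Hy Ey]].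
  - intros y. apply continuity_pt_filterlim.
    apply (continuous_comp (Rmax rs) (branch c z r0)); [apply continuous_Rmax_l|].
    apply continuous_branch; [lra|]. apply Rlt_le_trans with rs; [lra|apply Rmax_l].
  - rewrite !Rmax_right by (unfold y1; lra). rewrite Rmax_left by lra.
    rewrite Rmin_right by lra. lra.
  - rewrite Rmin_left, Rmax_right in Hy by (unfold y1; lra). rewrite Rmax_right in Ey by lra.
    exists y. split; [lra|]. split; [|exact Ey].
    rewrite <- Hk. apply wave_u_antitone; lra.
Qed.

Definition weight (c : R) (D : R -> R -> R) (a r : R) : R :=
  1 / Rabs (D r a) * (c ^ 2 - a ^ 2 / r ^ 2).

(** The drag force of the reflected problem. *)
Definition odd_mirror (D : R -> R -> R) (r a : R) : R := - D r (- a).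

Lemma drag_mirror (D : R -> R -> R) : drag_force D -> drag_force (odd_mirror D).
Proof.
  intros [H1 H2 H3 H4 H5 H6]. unfold odd_mirror. split.
  - apply C1_on_opp. apply C1_on_flip; [exact open_Omega|auto|exact H1].
  - intros r a Hr Ha. assert (K := H3 r (- a) Hr ltac:(lra)). lra.
  - intros r a Hr Ha. assert (K := H2 r (- a) Hr ltac:(lra)). lra.
  - intros r Hr. rewrite Ropp_0, H4; lra.
  - intros r a1 a2 Hr Ha. assert (K := H5 r (- a2) (- a1) Hr ltac:(lra)). lra.
  - intros r1 r2 a Hr1 Hr. rewrite !Rabs_Ropp. apply H6; assumption.
Qed.

Lemma weight_mirror (c : R) (D : R -> R -> R) (a r : R) :
  weight c (odd_mirror D) (- a) r = weight c D a r.
Proof.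
  unfold weight, odd_mirror. rewrite Rabs_Ropp, Ropp_involutive.
  replace ((- a) ^ 2) with (a ^ 2) by ring. reflexivity.
Qed.

Lemma drag_continuous (D : R -> R -> R) (r a : R) : drag_force D -> 0 < r ->
  continuous (fun z : R * R => D (fst z) (snd z)) (r, a).
Proof.
  intros HD Hr. apply (C1_on_continuous Omega); [exact open_Omega|apply HD|exact Hr].
Qed.

Lemma drag_nonzero (D : R -> R -> R) (r a : R) : drag_force D -> 0 < r -> a <> 0 -> 0 < Rabs (D r a).
Proof.
  intros HD Hr Ha. apply Rabs_pos_lt.
  destruct (Rtotal_order a 0) as [H|[H|H]]; [|contradiction|].
  - apply Rlt_not_eq, (drag_neg D HD); assumption.
  - apply Rgt_not_eq, (drag_pos D HD); assumption.
Qed.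

Lemma weight_continuous (c : R) (D : R -> R -> R) (a r : R) :
  drag_force D -> 0 < r -> a <> 0 ->
  continuous (fun z : R * R => weight c D (fst z) (snd z)) (a, r).
Proof.
  intros HD Hr Ha. unfold weight.
  apply continuous_Rmult.
  - apply continuous_Rmult; [apply continuous_const|].
    apply (continuous_comp (fun z : R * R => Rabs (D (snd z) (fst z))) Rinv).
    + apply (continuous_comp (fun z : R * R => D (snd z) (fst z)) Rabs); [|apply continuous_Rabs].
      apply (continuous_comp_2 (fun z : R * R => snd z) (fun z : R * R => fst z) D);
        [apply continuous_snd|apply continuous_fst|]. apply drag_continuous; assumption.
    + apply continuous_Rinv, Rgt_not_eq, drag_nonzero; assumption.
  - apply continuous_Rminus; [apply continuous_const|].
    apply (continuous_Rmult (fun z : R * R => fst z ^ 2)).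
    + apply (continuous_fst_comp (fun t => t ^ 2)).
      apply (ex_derive_continuous (fun t => t ^ 2)). auto_derive. trivial.
    + apply (continuous_snd_comp (fun t => / t ^ 2)). simpl snd.
      apply (ex_derive_continuous (fun t => / t ^ 2)). auto_derive. nra.
Qed.

Lemma weight_ex_RInt (c : R) (D : R -> R -> R) (a r1 r2 : R) :
  drag_force D -> 0 < r1 -> 0 < r2 -> a <> 0 -> ex_RInt (weight c D a) r1 r2.
Proof.
  intros HD H1 H2 Ha. apply ex_RInt_continuous_R.
  intros r Hr. apply (continuous_section (weight c D)), weight_continuous; auto.
  apply Rlt_le_trans with (Rmin r1 r2); [apply Rmin_glb_lt; assumption|apply Hr].
Qed.

Lemma weight_nonneg (c : R) (D : R -> R -> R) (a r : R) :
  drag_force D -> 0 < r -> a <> 0 -> Rabs a <= c * r -> 0 <= weight c D a r.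
Proof.
  intros HD Hr Ha Hs. unfold weight. assert (P := drag_nonzero D r a HD Hr Ha).
  apply Rmult_le_pos; [apply Rdiv_le_0_compat; lra|].
  replace (c ^ 2 - a ^ 2 / r ^ 2) with (((c * r) ^ 2 - a ^ 2) / r ^ 2) by (field; lra).
  apply Rdiv_le_0_compat; [|nra].
  rewrite <- (pow2_abs a). generalize (Rabs_pos a). nra.
Qed.

Lemma weight_nonpos (c : R) (D : R -> R -> R) (a r : R) :
  drag_force D -> 0 < c -> 0 < r -> a <> 0 -> c * r <= Rabs a -> weight c D a r <= 0.
Proof.
  intros HD Hc Hr Ha Hs. unfold weight. assert (P := drag_nonzero D r a HD Hr Ha).
  assert (0 <= 1 / Rabs (D r a)) by (apply Rdiv_le_0_compat; lra).
  assert (0 <= (a ^ 2 - (c * r) ^ 2) / r ^ 2).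
  { apply Rdiv_le_0_compat; [|nra]. rewrite <- (pow2_abs a). generalize (Rabs_pos a).
    assert (0 < c * r) by nra. nra. }
  replace (c ^ 2 - a ^ 2 / r ^ 2) with (- ((a ^ 2 - (c * r) ^ 2) / r ^ 2)) by (field; lra).
  nra.
Qed.

Lemma F_diff (c : R) (D : R -> R -> R) (a r1 r2 : R) :
  drag_force D -> 0 < c -> 0 < r1 -> 0 < r2 -> a <> 0 ->
  F c D a r1 - F c D a r2 = RInt (weight c D a) r2 r1.
Proof.
  intros HD Hc H1 H2 Ha. unfold F.
  change (RInt (weight c D a) (Rabs a / c) r1 - RInt (weight c D a) (Rabs a / c) r2 =
    RInt (weight c D a) r2 r1).
  assert (0 < Rabs a / c) by (apply Rdiv_lt_0_compat; [apply Rabs_pos_lt, Ha|lra]).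
  rewrite <- (RInt_Chasles_R (weight c D a) (Rabs a / c) r2 r1)
    by (apply weight_ex_RInt; auto).
  unfold plus; simpl. ring.
Qed.

(** [F] is smallest at the sonic density. A unit drop therefore starts strictly above it and,
    as both densities are on the same side, ends at a smaller subsonic density. *)
Lemma F_drop_subsonic (c : R) (D : R -> R -> R) (a r1 r2 : R) :
  drag_force D -> 0 < c -> 0 < r1 -> 0 < r2 -> a <> 0 -> Rabs a <= c * r1 ->
  0 <= (Rabs a / c - r2) * (Rabs a / c - r1) -> F c D a r1 - F c D a r2 = 1 ->
  Rabs a <= c * r2 /\ r2 < r1 /\ RInt (weight c D a) r2 r1 = 1.
Proof.
  intros HD Hc H1 H2 Ha Hs Hp HF. rewrite F_diff in HF by assumption.
  set (s := Rabs a / c) in *.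
  assert (Es : Rabs a = c * s) by (unfold s; field; lra).
  assert (Hs1 : s <= r1) by (apply Rmult_le_reg_l with c; lra).
  assert (Ps : 0 < s) by (apply Rdiv_lt_0_compat; [apply Rabs_pos_lt, Ha|lra]).
  assert (Hs2 : s <= r2).
  { apply Rnot_lt_le; intro Hlt.
    assert (Hr1 : r1 = s) by nra. clear H1; subst r1.
    assert (RInt (weight c D a) r2 s <= 0); [|lra].
    replace 0 with (RInt (fun _ => 0) r2 s) by (rewrite RInt_const; apply Rmult_0_r).
    apply RInt_le; [lra|apply weight_ex_RInt; auto|apply ex_RInt_const|].
    intros r Hr. apply weight_nonpos; auto; [lra|]. rewrite Es. nra. }
  split; [rewrite Es; apply Rmult_le_compat_l; lra|]. split; [|exact HF].
  apply Rnot_le_lt; intro Hle.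
  rewrite <- opp_RInt_swap_R in HF by (apply weight_ex_RInt; auto).
  assert (0 <= RInt (weight c D a) r1 r2).
  { apply RInt_ge_0; [lra|apply weight_ex_RInt; auto|].
    intros r Hr. apply weight_nonneg; auto; [lra|]. rewrite Es. apply Rmult_le_compat_l; lra. }
  unfold opp in HF; simpl in HF. lra.
Qed.

Lemma weight_decr (c : R) (D : R -> R -> R) (a1 a2 r : R) :
  drag_force D -> 0 < r -> 0 < a1 -> a1 < a2 -> a2 <= c * r ->
  weight c D a2 r < weight c D a1 r.
Proof.
  intros HD Hr H1 H12 Hs. unfold weight.
  assert (P1 := drag_pos D HD r a1 Hr H1). assert (I := drag_incr D HD r a1 a2 Hr H12).
  rewrite !Rabs_pos_eq by lra.
  assert (0 < 1 / D r a2) by (apply Rdiv_lt_0_compat; lra).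
  assert (1 / D r a2 < 1 / D r a1).
  { unfold Rdiv. rewrite !Rmult_1_l. apply Rinv_lt_contravar; [nra|lra]. }
  assert (E : forall a, c ^ 2 - a ^ 2 / r ^ 2 = ((c * r) ^ 2 - a ^ 2) / r ^ 2) by (intros; field; lra).
  assert (0 <= c ^ 2 - a2 ^ 2 / r ^ 2).
  { rewrite E. apply Rdiv_le_0_compat; nra. }
  assert (c ^ 2 - a2 ^ 2 / r ^ 2 < c ^ 2 - a1 ^ 2 / r ^ 2).
  { rewrite !E. apply Rmult_lt_compat_r; [apply Rinv_0_lt_compat; nra|nra]. }
  nra.
Qed.

(** Both the nonnegative integrand and the interval shrink when [a] grows. *)
Lemma weight_integral_decr (c : R) (D : R -> R -> R) (a1 a2 p1 p2 r1 r2 : R) :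
  drag_force D -> 0 < c -> 0 < p1 -> 0 < a1 -> a1 < a2 -> a2 <= c * p2 -> a1 <= c * p1 ->
  p1 <= p2 -> p2 < r2 -> r2 <= r1 ->
  RInt (weight c D a2) p2 r2 < RInt (weight c D a1) p1 r1.
Proof.
  intros HD Hc Hp1 Ha1 Ha Hs2 Hs1 Hp Hr2 Hr.
  assert (X : forall a x y, 0 < a -> 0 < x -> 0 < y -> ex_RInt (weight c D a) x y)
    by (intros; apply weight_ex_RInt; auto; lra).
  assert (NN : forall x, p1 <= x -> 0 <= weight c D a1 x).
  { intros x Hx. apply weight_nonneg; auto; [lra|lra|]. rewrite Rabs_pos_eq by lra. nra. }
  apply Rlt_le_trans with (RInt (weight c D a1) p2 r2).
  - apply RInt_lt; [lra| | |].
    + intros x Hx. apply (continuous_section (weight c D)), weight_continuous; auto; lra.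
    + intros x Hx. apply (continuous_section (weight c D)), weight_continuous; auto; lra.
    + intros x Hx. apply weight_decr; auto; [lra|nra].
  - rewrite <- (RInt_Chasles_R _ p1 p2 r1) by (apply X; lra).
    rewrite <- (RInt_Chasles_R _ p2 r2 r1) by (apply X; lra).
    assert (0 <= RInt (weight c D a1) p1 p2) by (apply RInt_ge_0; [lra|apply X; lra|intros; apply NN; lra]).
    assert (0 <= RInt (weight c D a1) r2 r1) by (apply RInt_ge_0; [lra|apply X; lra|intros; apply NN; lra]).
    unfold plus; simpl. lra.
Qed.

(** The germ restricted to subsonic pairs. The sonic bound on the smaller density implies the
    one on the larger. *)
Definition transfer (c : R) (D : R -> R -> R) (rm rp a : R) : Prop :=
  (a = 0 /\ rm = rp) \/
  (0 < a /\ a <= c * rp /\ rp < rm /\ RInt (weight c D a) rp rm = 1) \/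
  (a < 0 /\ - a <= c * rm /\ rm < rp /\ RInt (weight c D a) rm rp = 1).

Lemma transfer_mirror (c : R) (D : R -> R -> R) (rm rp a : R) :
  transfer c D rm rp a -> transfer c (odd_mirror D) rp rm (- a).
Proof.
  assert (E : forall x y, RInt (weight c (odd_mirror D) (- a)) x y = RInt (weight c D a) x y).
  { intros. apply RInt_ext. intros. apply weight_mirror. }
  unfold transfer. rewrite !E.
  intros [[H1 H2]|[[H1 H2]|[H1 H2]]].
  - left. split; [lra|auto].
  - right; right. split; [lra|]. rewrite Ropp_involutive. tauto.
  - right; left. split; [lra|]. tauto.
Qed.

Record balanced (c : R) (D : R -> R -> R) (zl rl zr rr rm rp a : R) : Prop := {
  bal_m_pos : 0 < rm;
  bal_p_pos : 0 < rp;
  bal_m_wave_u : wave_u c zl rl rm <= c;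
  bal_p_wave_u : wave_u c zr rr rp <= c;
  bal_m : a = branch c zl rl rm;
  bal_p : - a = branch c zr rr rp;
  bal_transfer : transfer c D rm rp a
}.

Arguments bal_m_pos {c D zl rl zr rr rm rp a}.
Arguments bal_p_pos {c D zl rl zr rr rm rp a}.
Arguments bal_m_wave_u {c D zl rl zr rr rm rp a}.
Arguments bal_p_wave_u {c D zl rl zr rr rm rp a}.
Arguments bal_m {c D zl rl zr rr rm rp a}.
Arguments bal_p {c D zl rl zr rr rm rp a}.
Arguments bal_transfer {c D zl rl zr rr rm rp a}.

Lemma balanced_mirror (c : R) (D : R -> R -> R) (zl rl zr rr rm rp a : R) :
  balanced c D zl rl zr rr rm rp a -> balanced c (odd_mirror D) zr rr zl rl rp rm (- a).
Proof.
  intros [H1 H2 H3 H4 H5 H6 H7]. split; auto.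
  - lra.
  - apply transfer_mirror, H7.
Qed.

Lemma weight_mirror_twice (D : R -> R -> R) (c a r : R) :
  weight c (odd_mirror (odd_mirror D)) a r = weight c D a r.
Proof.
  rewrite <- (Ropp_involutive a) at 1. rewrite !weight_mirror. reflexivity.
Qed.

(** As the flux grows, the left density decreases and the right one increases along their
    branches. The flux has the sign of the difference of the two densities, so two solutions
    have fluxes of the same sign, and [weight_integral_decr] prevents both integrals from
    being 1. *)
Lemma balanced_order (c : R) (D : R -> R -> R) (zl rl zr rr rm1 rp1 a1 rm2 rp2 a2 : R) :
  drag_force D -> 0 < c -> 0 < rl -> 0 < rr ->
  balanced c D zl rl zr rr rm1 rp1 a1 -> balanced c D zl rl zr rr rm2 rp2 a2 -> ~ a1 < a2.
Proof.
  intros HD Hc Hl Hr B1 B2 Hlt.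
  assert (Hm : rm2 <= rm1).
  { apply (branch_le_iff c zl rl rm1 rm2); auto; [apply B1|apply B1|].
    rewrite <- (bal_m B1), <- (bal_m B2). lra. }
  assert (Hp : rp1 <= rp2).
  { apply (branch_le_iff c zr rr rp2 rp1); auto; [apply B2|apply B2|].
    rewrite <- (bal_p B1), <- (bal_p B2). lra. }
  assert (P1 := bal_p_pos B1). assert (P2 := bal_m_pos B2).
  destruct (bal_transfer B1) as [[E1 F1]|[[E1 [S1 [O1 I1]]]|[E1 [S1 [O1 I1]]]]];
  destruct (bal_transfer B2) as [[E2 F2]|[[E2 [S2 [O2 I2]]]|[E2 [S2 [O2 I2]]]]];
  try lra.
  - assert (K := weight_integral_decr c D a1 a2 rp1 rp2 rm1 rm2 HD Hc P1 E1 Hlt S2 S1 Hp O2 Hm). lra.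
  - assert (K := weight_integral_decr c (odd_mirror D) (- a2) (- a1) rm2 rm1 rp2 rp1
      (drag_mirror D HD) Hc P2 ltac:(lra) ltac:(lra) S1 S2 Hm O1 Hp).
    rewrite (RInt_ext _ (weight c D a1)) in K by (intros; apply weight_mirror).
    rewrite (RInt_ext (weight c (odd_mirror D) (- a2)) (weight c D a2)) in K
      by (intros; apply weight_mirror).
    lra.
Qed.

Lemma balanced_unique (c : R) (D : R -> R -> R) (zl rl zr rr rm1 rp1 a1 rm2 rp2 a2 : R) :
  drag_force D -> 0 < c -> 0 < rl -> 0 < rr ->
  balanced c D zl rl zr rr rm1 rp1 a1 -> balanced c D zl rl zr rr rm2 rp2 a2 ->
  rm1 = rm2 /\ rp1 = rp2 /\ a1 = a2.
Proof.
  intros HD Hc Hl Hr B1 B2.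
  assert (E : a1 = a2).
  { destruct (Rtotal_order a1 a2) as [H|[H|H]]; [exfalso|exact H|exfalso].
    - exact (balanced_order c D zl rl zr rr rm1 rp1 a1 rm2 rp2 a2 HD Hc Hl Hr B1 B2 H).
    - exact (balanced_order c D zl rl zr rr rm2 rp2 a2 rm1 rp1 a1 HD Hc Hl Hr B2 B1 H). }
  destruct B1 as [P1 Q1 K1 L1 M1 N1 _]. destruct B2 as [P2 Q2 K2 L2 M2 N2 _].
  split; [|split; [|exact E]]; apply Rle_antisym.
  - apply (branch_le_iff c zl rl rm2 rm1); auto; lra.
  - apply (branch_le_iff c zl rl rm1 rm2); auto; lra.
  - apply (branch_le_iff c zr rr rp2 rp1); auto; lra.
  - apply (branch_le_iff c zr rr rp1 rp2); auto; lra.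
Qed.

(** * Existence of the balanced pair *)

(** The moving interval is mapped onto [[0, 1]] in order to use [continuous_RInt_param]. *)
Lemma weight_integral_continuous (c : R) (D : R -> R -> R) (A P : R -> R) (x : R) :
  drag_force D -> (forall y, 0 < P y) -> continuous A x -> continuous P x -> 0 < x -> 0 < A x ->
  continuous (fun y => RInt (weight c D (A y)) (P y) y) x.
Proof.
  intros HD HP CA CP Hx HA.
  set (g := fun y s => (y - P y) * weight c D (A y) ((y - P y) * s + P y)).
  assert (Pos : forall y s, 0 < y -> 0 <= s <= 1 -> 0 < (y - P y) * s + P y).
  { intros y s Hy Hs. assert (Py := HP y).
    replace ((y - P y) * s + P y) with (y * s + P y * (1 - s)) by ring.
    destruct (Req_dec s 0) as [->|]; [lra|].
    assert (0 < y * s) by (apply Rmult_lt_0_compat; lra).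
    assert (0 <= P y * (1 - s)) by (apply Rmult_le_pos; lra). lra. }
  assert (E0 : forall y, (y - P y) * 0 + P y = P y) by (intros; ring).
  assert (E1 : forall y, (y - P y) * 1 + P y = y) by (intros; ring).
  assert (Near : locally x (fun y => 0 < y /\ 0 < A y)).
  { destruct (proj1 (continuous_eps _ _) CA (A x) HA) as [d [Hd K]].
    exists (mkposreal (Rmin d x) (Rmin_pos _ _ Hd Hx)). intros y Hy.
    change (Rabs (y - x) < Rmin d x) in Hy.
    assert (L1 := Rmin_l d x). assert (L2 := Rmin_r d x).
    specialize (K y ltac:(lra)). apply Rabs_def2 in K. apply Rabs_def2 in Hy. lra. }
  assert (Eg : forall y, 0 < y -> 0 < A y ->
    RInt (g y) 0 1 = RInt (weight c D (A y)) (P y) y).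
  { intros y Hy HAy. unfold g.
    assert (K := RInt_comp_lin (V := R_CompleteNormedModule) (weight c D (A y)) (y - P y) (P y) 0 1).
    rewrite E0, E1 in K.
    apply K. apply weight_ex_RInt; auto. lra. }
  apply (continuous_ext_loc _ (fun y => RInt (g y) 0 1)).
  { revert Near. apply filter_imp. intros y [Hy HAy]. apply Eg; assumption. }
  assert (Cg : forall y s, continuous A y -> continuous P y -> 0 < y -> 0 < A y -> 0 <= s <= 1 ->
    continuous (fun z : R * R => g (fst z) (snd z)) (y, s)).
  { intros y s CAy CPy Hy HAy Hs. unfold g.
    assert (CPz : continuous (fun z : R * R => P (fst z)) (y, s))
      by (apply continuous_fst_comp; exact CPy).
    assert (CdP : continuous (fun z : R * R => fst z - P (fst z)) (y, s)).
    { apply continuous_Rminus; [apply continuous_fst|exact CPz]. }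
    apply continuous_Rmult; [exact CdP|].
    apply (continuous_comp_2 (fun z : R * R => A (fst z))
      (fun z : R * R => (fst z - P (fst z)) * snd z + P (fst z)) (weight c D)).
    - apply continuous_fst_comp; exact CAy.
    - apply continuous_Rplus; [|exact CPz].
      apply continuous_Rmult; [exact CdP|apply continuous_snd].
    - apply weight_continuous; [exact HD|apply Pos; assumption|simpl; lra]. }
  apply (continuous_RInt_param g 0 1 x); [lra| |].
  - intros s Hs. apply continuity_2d_of_continuous, Cg; assumption.
  - revert Near. apply filter_imp. intros y [Hy HAy].
    apply (ex_RInt_ext (fun s => scal (y - P y) (weight c D (A y) ((y - P y) * s + P y))));
      [reflexivity|].
    apply (ex_RInt_comp_lin (V := R_NormedModule) (weight c D (A y))).
    rewrite E0, E1.
    apply weight_ex_RInt; auto. lra.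
Qed.

(** The left density [x] runs over its branch from the sonic value [xlo] to the stagnation
    value [rm0], and the right density [P] is the one with the same flux. At [xlo] the flux is
    [c * xlo], which forces [xlo <= P], so that the integral is at most 0. Near [rm0] the flux
    tends to 0 and so does the drag, while the interval keeps a positive length, so that the
    integral exceeds 1. *)
Lemma balanced_exists_pos (c : R) (D : R -> R -> R) (zl rl zr rr rm0 rp0 : R) :
  drag_force D -> 0 < c -> 0 < rl -> 0 < rr -> 0 < rm0 -> 0 < rp0 ->
  wave_u c zl rl rm0 = 0 -> wave_u c zr rr rp0 = 0 -> rp0 < rm0 ->
  exists rm rp a, balanced c D zl rl zr rr rm rp a.
Proof.
  intros HD Hc Hl Hr Hm0 Hp0 Km0 Kp0 Hlt.
  destruct (wave_u_surjective c zl rl c Hc Hl) as [xlo [Hxlo Kxlo]].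
  assert (Hxm : xlo < rm0).
  { apply Rnot_le_lt; intro Hle.
    assert (K := wave_u_antitone c zl rl rm0 xlo Hc Hl Hm0 Hle). lra. }
  set (A := branch c zl rl).
  assert (A0 : A rm0 = 0) by (unfold A, branch; rewrite Km0, Rmax_left by lra; ring).
  assert (Kx : forall x, xlo <= x -> wave_u c zl rl x <= c).
  { intros x Hx. apply Rle_trans with (wave_u c zl rl xlo); [apply wave_u_antitone; lra|lra]. }
  assert (Apos : forall x, xlo <= x < rm0 -> 0 < A x).
  { intros x Hx. rewrite <- A0. apply branch_decr; try lra. apply Kx; lra. }
  destruct (functional_choice (fun a y => rp0 <= y /\ wave_u c zr rr y <= 0 /\
      branch c zr rr y = - Rmax 0 a)) as [P HP].
  { intros a. apply (branch_inverse c zr rr rp0); auto. apply Rmax_l. }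
  assert (Plip : forall a b, P a <= P b -> c * (P b - P a) <= Rmax 0 b - Rmax 0 a).
  { intros a b Hab. destruct (HP a) as [Ha1 [Ha2 Ha3]]. destruct (HP b) as [Hb1 [Hb2 Hb3]].
    assert (K := branch_slope c zr rr (P a) (P b) Hc Hr ltac:(lra) Hab Ha2). lra. }
  assert (CPa : forall a, continuous P a).
  { intros a. apply continuous_eps. intros e He.
    destruct (proj1 (continuous_eps _ _) (continuous_Rmax_l 0 a) (c * e) ltac:(nra)) as [d [Hd K]].
    exists d. split; [assumption|]. intros y Hy. specialize (K y Hy). apply Rabs_def2 in K.
    apply Rabs_def1.
    - destruct (Rle_dec (P a) (P y)); [|lra]. assert (L := Plip a y ltac:(assumption)). nra.
    - destruct (Rle_dec (P y) (P a)); [|lra]. assert (L := Plip y a ltac:(assumption)). nra. }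
  assert (CA : forall x, 0 < x -> continuous A x) by (intros; apply continuous_branch; lra).
  assert (PApos : forall y, 0 < P (A y)) by (intros y; destruct (HP (A y)); lra).
  set (Phi := fun x => RInt (weight c D (A x)) (P (A x)) x).
  assert (CPhi : forall x, xlo <= x < rm0 -> continuous Phi x).
  { intros x Hx. apply (weight_integral_continuous c D A (fun y => P (A y)) x HD).
    - exact PApos.
    - apply CA; lra.
    - apply (continuous_comp A P); [apply CA; lra|apply CPa].
    - lra.
    - apply Apos; lra. }
  assert (PA : forall x, xlo <= x < rm0 -> branch c zr rr (P (A x)) = - A x).
  { intros x Hx. destruct (HP (A x)) as [_ [_ ->]]. rewrite Rmax_right; [reflexivity|].
    apply Rlt_le, Apos, Hx. }
  assert (PS : forall x, xlo <= x < rm0 -> A x <= c * P (A x)).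
  { intros x Hx. destruct (HP (A x)) as [Q1 [Q2 _]].
    assert (K := branch_subsonic c zr rr (P (A x)) Hc (PApos x) ltac:(lra)).
    rewrite PA in K by assumption. lra. }
  set (d := rm0 - rp0). assert (Hd : 0 < d) by (unfold d; lra).
  assert (Big : exists x1, xlo < x1 < rm0 /\ 1 <= Phi x1).
  { assert (CD : continuous (D rp0) 0).
    { apply (continuous_section D), drag_continuous; assumption. }
    destruct (proj1 (continuous_eps _ _) CD (c ^ 2 * d / 4)) as [dD [HdD KD]].
    { assert (0 < c ^ 2 * d) by (apply Rmult_lt_0_compat; nra). lra. }
    rewrite (drag_0 D HD rp0 Hp0) in KD.
    (* For fluxes below del the drag at rp0 is small, the right density stays within d / 4 of
       rp0, and the factor c^2 - a^2 / r^2 is at least c^2 / 2. *)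
    set (del := Rmin dD (Rmin (c * d / 4) (c * rp0 / 2))).
    assert (Hdel : 0 < del).
    { apply Rmin_pos; [assumption|]. apply Rmin_pos; [nra|nra]. }
    assert (L1 : del <= dD) by apply Rmin_l.
    assert (L2 : del <= Rmin (c * d / 4) (c * rp0 / 2)) by apply Rmin_r.
    assert (L3 := Rmin_l (c * d / 4) (c * rp0 / 2)). assert (L4 := Rmin_r (c * d / 4) (c * rp0 / 2)).
    destruct (proj1 (continuous_eps _ _) (CA rm0 Hm0) del Hdel) as [eta [Heta KA]].
    set (st := Rmin (eta / 2) (Rmin (d / 4) ((rm0 - xlo) / 2))).
    assert (Hst : 0 < st) by (apply Rmin_pos; [lra|apply Rmin_pos; lra]).
    assert (M1 : st <= eta / 2) by apply Rmin_l.
    assert (M2 : st <= Rmin (d / 4) ((rm0 - xlo) / 2)) by apply Rmin_r.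
    assert (M3 := Rmin_l (d / 4) ((rm0 - xlo) / 2)). assert (M4 := Rmin_r (d / 4) ((rm0 - xlo) / 2)).
    set (x1 := rm0 - st).
    assert (Hx1 : xlo < x1 < rm0) by (unfold x1; lra).
    exists x1. split; [exact Hx1|].
    assert (Ap := Apos x1 ltac:(lra)).
    assert (Asm : A x1 < del).
    { assert (K := KA x1 ltac:(unfold x1; rewrite Rabs_left; lra)). rewrite A0 in K.
      apply Rabs_def2 in K. lra. }
    destruct (HP (A x1)) as [Q1 [Q2 Q3]].
    assert (HPle : P (A x1) <= rp0 + d / 4).
    { assert (K := branch_slope c zr rr rp0 (P (A x1)) Hc Hr Hp0 Q1 ltac:(lra)).
      rewrite (PA x1) in K by lra.
      assert (B0 : branch c zr rr rp0 = 0) by (unfold branch; rewrite Kp0, Rmax_left by lra; ring).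
      rewrite B0 in K. assert (c * (P (A x1) - rp0) <= c * (d / 4)) by lra.
      apply Rmult_le_reg_l in H; lra. }
    set (a := A x1) in *.
    assert (Dp := drag_pos D HD rp0 a Hp0 Ap).
    assert (Dsm : D rp0 a < c ^ 2 * d / 4).
    { assert (K := KD a ltac:(rewrite Rminus_0_r, Rabs_pos_eq; lra)). rewrite Rminus_0_r in K.
      apply Rabs_def2 in K. lra. }
    assert (Hw : forall r, P a < r < x1 -> 1 / D rp0 a * (c ^ 2 / 2) <= weight c D a r).
    { intros r Hrr. unfold weight.
      assert (Drp := drag_pos D HD r a ltac:(lra) Ap).
      assert (Dd := drag_abs_decr D HD rp0 r a Hp0 ltac:(lra)).
      rewrite !Rabs_pos_eq in Dd by lra. rewrite Rabs_pos_eq by lra.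
      apply Rmult_le_compat.
      - apply Rlt_le, Rdiv_lt_0_compat; lra.
      - nra.
      - unfold Rdiv. rewrite !Rmult_1_l. apply Rinv_le_contravar; lra.
      - assert (a ^ 2 / r ^ 2 <= c ^ 2 / 2); [|lra].
        assert (0 < r) by lra.
        apply Rle_div_l; [nra|].
        assert (a <= c * r / 2) by nra. assert (0 <= c * r) by nra. nra. }
    assert (I1 : RInt (fun _ => 1 / D rp0 a * (c ^ 2 / 2)) (P a) x1 <= Phi x1).
    { unfold Phi. fold a. apply RInt_le; [unfold x1, d in *; lra|apply ex_RInt_const| |].
      - apply weight_ex_RInt; [exact HD|apply PApos|lra|lra].
      - intros r Hrr. apply Hw; lra. }
    eapply Rle_trans; [|exact I1]. rewrite RInt_const. unfold scal; simpl. unfold mult; simpl.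
    assert (Hlen : d / 2 <= x1 - P a) by (unfold x1, d in *; lra).
    assert (HD1 : 1 <= d / 2 * (1 / D rp0 a * (c ^ 2 / 2))).
    { replace (d / 2 * (1 / D rp0 a * (c ^ 2 / 2))) with ((c ^ 2 * d / 4) / D rp0 a) by (field; lra).
      apply Rle_div_r; lra. }
    eapply Rle_trans; [exact HD1|]. apply Rmult_le_compat_r; [|lra].
    apply Rmult_le_pos; [apply Rlt_le, Rdiv_lt_0_compat; lra|nra]. }
  destruct Big as [x1 [Hx1 Big]].
  assert (Small : Phi xlo <= 0).
  { assert (Ax : A xlo = c * xlo) by (unfold A, branch; rewrite Kxlo, Rmax_left by lra; ring).
    assert (Axp : 0 < A xlo) by (apply Apos; lra).
    assert (K := PS xlo ltac:(lra)). rewrite Ax in K.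
    assert (xlo <= P (A xlo)) by (rewrite Ax; apply Rmult_le_reg_l with c; lra).
    unfold Phi. rewrite <- opp_RInt_swap_R
      by (apply weight_ex_RInt; auto; lra).
    assert (0 <= RInt (weight c D (A xlo)) xlo (P (A xlo))).
    { apply RInt_ge_0; [assumption|apply weight_ex_RInt; auto; lra|].
      intros r Hrr. apply weight_nonneg; auto; [lra|lra|].
      rewrite Rabs_pos_eq, Ax by lra. apply Rmult_le_compat_l; lra. }
    unfold opp; simpl. lra. }
  destruct (IVT_gen (fun x => Phi (Rmax xlo (Rmin x x1))) xlo x1 1) as [x [Hx Ex]].
  - intros x. apply continuity_pt_filterlim.
    apply (continuous_comp (fun x => Rmax xlo (Rmin x x1)) Phi).
    + apply (continuous_comp (fun x => Rmin x x1) (Rmax xlo));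
        [apply continuous_Rmin_r|apply continuous_Rmax_l].
    + apply CPhi. split; [apply Rmax_l|]. apply Rmax_lub_lt; [lra|].
      apply Rle_lt_trans with x1; [apply Rmin_r|lra].
  - rewrite (Rmin_left xlo), (Rmin_left x1), (Rmax_left xlo), (Rmax_right xlo x1) by lra.
    rewrite Rmin_left, Rmax_right by lra. lra.
  - rewrite Rmin_left, Rmax_right in Hx by lra.
    rewrite (Rmin_left x), (Rmax_right xlo) in Ex by lra.
    assert (Hxr : xlo <= x < rm0) by lra.
    destruct (HP (A x)) as [Q1 [Q2 Q3]].
    exists x, (P (A x)), (A x). split; auto.
    + lra.
    + apply Kx; lra.
    + lra.
    + symmetry. apply PA, Hxr.
    + right; left. split; [apply Apos, Hxr|]. split; [apply PS, Hxr|]. split; [|exact Ex].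
      apply Rnot_le_lt; intro Hle. unfold Phi in Ex.
      assert (Ap := Apos x Hxr).
      rewrite <- opp_RInt_swap_R in Ex
        by (apply weight_ex_RInt; auto; lra).
      assert (0 <= RInt (weight c D (A x)) x (P (A x))).
      { apply RInt_ge_0; [assumption|apply weight_ex_RInt; auto; lra|].
        intros r Hrr. apply weight_nonneg; auto; [lra|lra|].
        assert (K := branch_subsonic c zl rl x Hc ltac:(lra) (Kx x ltac:(lra))).
        fold A in K. rewrite Rabs_pos_eq by lra. nra. }
      unfold opp in Ex; simpl in Ex. lra.
Qed.

Lemma transfer_ext (c : R) (D D' : R -> R -> R) (rm rp a : R) :
  (forall r, weight c D a r = weight c D' a r) -> transfer c D rm rp a -> transfer c D' rm rp a.
Proof.
  intros E. unfold transfer.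
  rewrite (RInt_ext (weight c D a) (weight c D' a) rp rm) by (intros; apply E).
  rewrite (RInt_ext (weight c D a) (weight c D' a) rm rp) by (intros; apply E).
  auto.
Qed.

(** The order of the stagnation densities of the two branches decides the sign of the flux,
    and reflection exchanges the two strict cases. *)
Lemma balanced_exists (c : R) (D : R -> R -> R) (zl rl zr rr : R) :
  drag_force D -> 0 < c -> 0 < rl -> 0 < rr ->
  exists rm rp a, balanced c D zl rl zr rr rm rp a.
Proof.
  intros HD Hc Hl Hr.
  destruct (wave_u_surjective c zl rl 0 Hc Hl) as [rm0 [Hm0 Km0]].
  destruct (wave_u_surjective c zr rr 0 Hc Hr) as [rp0 [Hp0 Kp0]].
  destruct (Rtotal_order rp0 rm0) as [H|[H|H]].
  - apply (balanced_exists_pos c D zl rl zr rr rm0 rp0); auto.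
  - exists rm0, rp0, 0. split; auto; try lra.
    + unfold branch. rewrite Km0, Rmax_left; lra.
    + unfold branch. rewrite Kp0, Rmax_left; lra.
    + left. auto.
  - destruct (balanced_exists_pos c (odd_mirror D) zr rr zl rl rp0 rm0) as [rp [rm [a B]]];
      auto using drag_mirror.
    exists rm, rp, (- a). apply balanced_mirror in B. destruct B. split; auto.
    apply (transfer_ext c (odd_mirror (odd_mirror D))); [|assumption].
    intros; apply weight_mirror_twice.
Qed.

(** * The germ and the theorem *)

(** The conclusion of [V_minus_shape]. *)
Definition branch_shape (c z r0 r a : R) : Prop :=
  0 < r /\ (0 <= a -> a <= c * r) /\
  (- (c * r) <= a -> wave_u c z r0 r <= c /\ a = branch c z r0 r).

(** A state of [V_minus] with positive flux is subsonic, which excludes the fourth case of the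
    germ; the fifth is excluded in the same way by the reflected state of [V_plus]. *)
Lemma germ_balanced (c : R) (D : R -> R -> R) (v zl rl zr rr rm am rp ap : R) :
  drag_force D -> 0 < c ->
  branch_shape c zl rl rm am -> branch_shape c zr rr rp (- ap) ->
  germ c D v (rm, am + v * rm) (rp, ap + v * rp) ->
  am = ap /\ balanced c D zl rl zr rr rm rp am.
Proof.
  intros HD Hc [Pm [Sm Bm]] [Pp [Sp Bp]] HG.
  unfold germ in HG. cbn [fst snd] in HG.
  replace (am + v * rm - v * rm) with am in HG by ring.
  replace (ap + v * rp - v * rp) with ap in HG by ring.
  destruct HG as [_ [_ [Ea HG]]]. subst ap.
  split; [reflexivity|].
  assert (K : - (c * rm) <= am <= c * rm /\ - (c * rp) <= am <= c * rp /\ transfer c D rm rp am).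
  { destruct HG as [[E0 [E1 _]]|[[Ha [Hp HF]]|[[Ha [Hp HF]]|[[H1 [H2 _]]|[H1 [H2 _]]]]]].
    - subst am. assert (0 < c * rm) by nra. assert (0 < c * rp) by nra.
      split; [lra|]. split; [lra|]. left. auto.
    - rewrite <- (Rabs_pos_eq am) in Hp at 1 by lra.
      rewrite <- (Rabs_pos_eq am) in Hp at 2 by lra.
      destruct (F_drop_subsonic c D am rm rp HD Hc Pm Pp) as [S1 [S2 S3]]; auto.
      + lra.
      + rewrite Rabs_pos_eq by lra. apply Sm. lra.
      + rewrite Rabs_pos_eq in S1 by lra. specialize (Sm ltac:(lra)).
        split; [nra|]. split; [nra|]. right; left. auto.
    - rewrite Rmult_comm in Hp.
      destruct (F_drop_subsonic c D am rp rm HD Hc Pp Pm) as [S1 [S2 S3]]; auto.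
      + lra.
      + rewrite Rabs_left by lra. apply Sp. lra.
      + rewrite Rabs_left in S1 by lra. specialize (Sp ltac:(lra)).
        split; [nra|]. split; [nra|]. right; right. auto.
    - exfalso. assert (0 < c * rm) by nra. specialize (Sm ltac:(lra)). lra.
    - exfalso. assert (0 < c * rp) by nra. specialize (Sp ltac:(lra)). lra. }
  destruct K as [K1 [K2 K3]].
  destruct (Bm ltac:(lra)) as [M1 M2]. destruct (Bp ltac:(lra)) as [N1 N2].
  split; auto.
Qed.

Lemma balanced_germ (c : R) (D : R -> R -> R) (v zl rl zr rr rm rp a : R) :
  drag_force D -> 0 < c -> balanced c D zl rl zr rr rm rp a ->
  germ c D v (rm, a + v * rm) (rp, a + v * rp).
Proof.
  intros HD Hc [Pm Pp Km Kp Bm Bp HT].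
  assert (Sm := branch_subsonic c zl rl rm Hc Pm Km).
  assert (Sp := branch_subsonic c zr rr rp Hc Pp Kp).
  rewrite <- Bm in Sm. rewrite <- Bp in Sp.
  unfold germ. cbn [fst snd].
  replace (a + v * rm - v * rm) with a by ring.
  replace (a + v * rp - v * rp) with a by ring.
  split; [exact Pm|]. split; [exact Pp|]. split; [reflexivity|].
  assert (Sub : forall x r, x <= c * r -> x / c - r <= 0).
  { intros x r H. assert (x / c <= r) by (apply Rle_div_l; lra). lra. }
  destruct HT as [[H1 H2]|[[H1 [H2 [H3 H4]]]|[H1 [H2 [H3 H4]]]]].
  - left. subst. auto.
  - right; left. split; [exact H1|]. split; [|rewrite F_diff by (auto; lra); exact H4].
    assert (A1 := Sub a rp ltac:(lra)). assert (A2 := Sub a rm ltac:(lra)). nra.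
  - right; right; left. split; [exact H1|]. split; [|rewrite F_diff by (auto; lra); exact H4].
    rewrite Rabs_left by lra.
    assert (A1 := Sub (- a) rp ltac:(lra)). assert (A2 := Sub (- a) rm ltac:(lra)). nra.
Qed.

Theorem proposition3p11
  (c : R) (hc : 0 < c)
  (D : R -> R -> R) (hD : drag_force D)
  (v rhoL alphaL rhoR alphaR uL uR : R)
  (hrhoL : 0 < rhoL) (hrhoR : 0 < rhoR)
  (huL : uL = v + alphaL / rhoL) (huR : uR = v + alphaR / rhoR)
  (hL : - c <= uL - v <= c) (hR : - c <= uR - v <= c) :
  let admissible (p : (R * R) * (R * R)) : Prop :=
    let (rhom, alpham) := fst p in
    let (rhop, alphap) := snd p in
    V_minus c rhoL alphaL v (rhom, alpham) /\
    V_plus c rhoR alphaR v (rhop, alphap) /\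
    germ c D v (rhom, alpham + v * rhom) (rhop, alphap + v * rhop) in
  (exists! p : (R * R) * (R * R), admissible p) /\
  (forall p : (R * R) * (R * R), admissible p ->
     subsonic c (fst p) /\ subsonic c (snd p)).
Proof.
  intros admissible.
  set (zl := alphaL / rhoL). set (zr := - alphaR / rhoR).
  assert (Hzl : - c <= zl <= c) by (unfold zl; lra).
  assert (Hzr : - c <= zr <= c).
  { replace zr with (- (alphaR / rhoR)) by (unfold zr; field; lra). lra. }
  assert (Adm : forall rm am rp ap, admissible ((rm, am), (rp, ap)) ->
    am = ap /\ balanced c D zl rhoL zr rhoR rm rp am).
  { intros rm am rp ap [HV [HW HG]]. apply V_plus_mirror in HW.
    apply (germ_balanced c D v zl rhoL zr rhoR rm am rp ap hD hc); [| |exact HG].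
    - apply (V_minus_shape c rhoL alphaL v rm am hc hrhoL ltac:(apply Hzl) HV).
    - apply (V_minus_shape c rhoR (- alphaR) (- v) rp (- ap) hc hrhoR ltac:(apply Hzr) HW). }
  split.
  - destruct (balanced_exists c D zl rhoL zr rhoR hD hc hrhoL hrhoR) as [rm [rp [a HB]]].
    assert (B := HB). destruct B as [Pm Pp Km Kp Bm Bp _].
    exists ((rm, a), (rp, a)). split.
    + split; [|split].
      * rewrite Bm. apply (V_minus_mem c rhoL alphaL v rm); auto.
      * apply V_plus_mirror. rewrite Bp.
        apply (V_minus_mem c rhoR (- alphaR) (- v) rp); auto.
      * apply (balanced_germ c D v zl rhoL zr rhoR); assumption.
    + intros [[rm' am'] [rp' ap']] H. apply Adm in H. destruct H as [<- HB'].
      destruct (balanced_unique c D zl rhoL zr rhoR rm rp a rm' rp' am' hD hc hrhoL hrhoR HB HB')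
        as [-> [-> ->]]. reflexivity.
  - intros [[rm am] [rp ap]] H. apply Adm in H. destruct H as [<- [Pm Pp Km Kp Bm Bp _]].
    unfold subsonic; cbn [fst snd]. split.
    + rewrite Bm. apply branch_subsonic; assumption.
    + assert (K := branch_subsonic c zr rhoR rp hc Pp Kp). lra.
Qed.
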